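(* Let $d\ge 1$, $\lambda>0$, let $\mu_1$ be the Cauchy distribution $d\mu_1(x)=\frac{\lambda}{\pi(x^2+\lambda^2)}dx$, let $\mu_2$ be any probability measure on $\mathbb{R}$, and let $\mu=\mu_1*\mu_2$. Let $H^\omega=\Delta+V^\omega$ be the Anderson model on $\ell^2(\mathbb{Z}^d)$ with single site distribution $\mu$, let $\nu$ be its density of states measure, and let $h^{\omega_2}=\Delta+V^{\omega_2}$ be the Anderson model on $\ell^2(\mathbb{Z}^d)$ with single site distribution $\mu_2$. Then for every $t\in\mathbb{R}$ the Fourier transform $\hat\nu(t)=\int_{\mathbb{R}}e^{-itx}\,d\nu(x)$ is given by $$\hat{\nu}(t)=e^{-\lambda|t|}\;\mathbb{E}\Big(\big\langle e_0, e^{-ith^{\omega_2}}e_0\big\rangle\Big),$$ where $\{e_n\}_{n\in\mathbb{Z}^d}$ is the standard basis of $\ell^2(\mathbb{Z}^d)$.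
   Context: Anderson model with single site distribution (SSD) $\kappa$ (a probability measure on $\mathbb{R}$): the random self-adjoint operator $\Delta+V^\omega$ on $\ell^2(\mathbb{Z}^d)$, where $(\Delta u)(n)=\sum_{|k-n|=1}u(k)$ and $(V^\omega u)(n)=\omega_n u(n)$, with $\{\omega_n\}_{n\in\mathbb{Z}^d}$ i.i.d. real random variables of law $\kappa$ (realised on the product probability space). $\mathbb{E}$ denotes expectation. Density of states measure: let $\Lambda_L=\{n\in\mathbb{Z}^d:|n_i|\le L,\ 1\le i\le d\}$, let $\chi_L$ be the orthogonal projection onto $\ell^2(\Lambda_L)$, $H^\omega_L=\chi_L H^\omega\chi_L$ (a symmetric matrix of order $(2L+1)^d$), and let $\mathcal{N}^\omega_L(E)$ be the number of eigenvalues of $H^\omega_L$ that are $\le E$, counted with multiplicity. The integrated density of states is the (nonrandom) limit $\mathcal{N}(E)=\lim_{L\to\infty}(2L+1)^{-d}\mathcal{N}^\omega_L(E)$ for a.e. $\omega$, and the density of states measure (DOSm) $\nu$ is the probability measure with $\nu(-\infty,E]=\mathcal{N}(E)$; equivalently $\nu(B)=\mathbb{E}\langle e_0,E_{H^\omega}(B)e_0\rangle$ with $E_{H^\omega}$ the spectral measure of $H^\omega$. *)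

(* Defs.v *)
From mathcomp Require Import all_boot all_order all_algebra.
From mathcomp Require Import finmap complex.
From mathcomp Require Import all_classical all_reals all_analysis.

Set Implicit Arguments.
Unset Strict Implicit.
Unset Printing Implicit Defensive.

Import Order.TTheory GRing.Theory Num.Theory.
Import numFieldNormedType.Exports.

Local Open Scope classical_set_scope.
Local Open Scope ring_scope.
Local Open Scope complex_scope.

Section Measures.
Context {R : realType}.

Definition cauchy_pdf (lambda x : R) : R :=
  lambda / (pi * (x ^+ 2 + lambda ^+ 2)).

Definition cauchy_prob (lambda : R) (B : set R) : \bar R :=
  (\int[lebesgue_measure]_(x in B) (cauchy_pdf lambda x)%:E)%E.

Definition convolution (mu1 mu2 : set R -> \bar R) : set R -> \bar R :=
  pushforward (mu1 \x mu2)%E (fun p : R * R => p.1 + p.2).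

Definition cexpi (x : R) : R[i] := cos x +i* sin x.

Definition cintegral dT (T : measurableType dT) (mu : {measure set T -> \bar R})
    (f : T -> R[i]) : R[i] :=
  (\int[mu]_x complex.Re (f x)) +i* (\int[mu]_x complex.Im (f x)).

Definition fourier (nu : {measure set R -> \bar R}) (t : R) : R[i] :=
  cintegral nu (fun x => cexpi (- (t * x))).

(* Independence is required for every finite subfamily of the random
   variables; only the values of kappa on Borel sets matter. *)
Definition iid dT (T : measurableType dT) (P : probability T R) (I : choiceType)
    (X : I -> {RV P >-> R}) (kappa : set R -> \bar R) : Prop :=
  (forall (i : I) (B : set R), measurable B -> distribution P (X i) B = kappa B) /\
  (forall (J : {fset I}) (B : I -> set R),
     (forall i, i \in J -> measurable (B i)) ->
     P (\bigcap_(i in [set` J]) (X i @^-1` B i)) =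
     (\prod_(i <- J) P (X i @^-1` B i))%E).

End Measures.

(* Z^d, with the choiceType and zmodType structures of finite functions. *)
Notation lattice d := {ffun 'I_d -> int}.

Section Anderson.
Context {R : realType} {d : nat}.
Implicit Types (u v : lattice d -> R[i]) (V : lattice d -> R).

Definition l1norm (n : lattice d) : int := \sum_(i < d) `|n i|.

(* The sum ranges over the 2d nearest neighbours of n, a finite set. *)
Definition laplacian u : lattice d -> R[i] :=
  fun n => \sum_(k \in [set k : lattice d | l1norm (k - n) = 1]) u k.

Definition multiplication V u : lattice d -> R[i] := fun n => (V n)%:C * u n.

Definition anderson V u : lattice d -> R[i] :=
  fun n => laplacian u n + multiplication V u n.

Definition std_basis (n : lattice d) : lattice d -> R[i] := fun m => (m == n)%:R.

Definition l2sqnorm u : \bar R :=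
  \esum_(n in [set: lattice d]) ((Normc.normc (u n)) ^+ 2)%:E.

Definition l2 : set (lattice d -> R[i]) := [set u | (l2sqnorm u < +oo)%E].

(* Sum of an absolutely summable family; esum only sums nonnegative terms. *)
Definition rsum (f : lattice d -> R) : R :=
  fine (\esum_(n in [set: lattice d]) (f^\+ n)%:E) -
  fine (\esum_(n in [set: lattice d]) (f^\- n)%:E).

Definition inner u v : R[i] :=
  let w n := ((u n)^*)%C * v n in
  rsum (fun n => complex.Re (w n)) +i* rsum (fun n => complex.Im (w n)).

(* The domain on which Delta + V is self-adjoint; Delta is bounded. *)
Definition anderson_dom V : set (lattice d -> R[i]) :=
  [set u | l2 u /\ l2 (multiplication V u)].

(* Strongly continuous one-parameter unitary groups on l^2(Z^d), given by maps
   on all functions whose values outside l^2 are irrelevant. Each U t is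
   isometric, and it is onto l^2 because U (- t) is its inverse. *)
Record unitary_group (U : R -> (lattice d -> R[i]) -> lattice d -> R[i]) : Prop :=
  UnitaryGroup {
    ug_l2 : forall t u, l2 u -> l2 (U t u) ;
    ug_linear : forall t (a : R[i]) u v, l2 u -> l2 v ->
      U t (fun n => a * u n + v n) = (fun n => a * U t u n + U t v n) ;
    ug_isometry : forall t u, l2 u -> l2sqnorm (U t u) = l2sqnorm u ;
    ug_0 : forall u, l2 u -> U 0 u = u ;
    ug_add : forall s t u, l2 u -> U (s + t) u = U s (U t u) ;
    ug_continuous : forall s u, l2 u ->
      l2sqnorm (fun n => U t u n - U s u n) @[t --> s] --> (0 : \bar R)
  }.

(* U t = e^{-itA} for the self-adjoint operator A with domain D: U is the
   unitary group whose infinitesimal generator is - i A (Stone's theorem). The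
   equivalence says that the generator has domain exactly D. *)
Definition is_exp_mit (A : (lattice d -> R[i]) -> lattice d -> R[i])
    (D : set (lattice d -> R[i]))
    (U : R -> (lattice d -> R[i]) -> lattice d -> R[i]) : Prop :=
  unitary_group U /\
  forall u v, l2 u -> l2 v ->
    (l2sqnorm (fun n => (t^-1)%:C * (U t u n - u n) - v n) @[t --> 0^'] -->
       (0 : \bar R))
    <-> (D u /\ v = (fun n => - ('i)%C * A u n)).

(* Lambda_L = {n : |n_i| <= L}, enumerated through coordinates shifted by L. *)
Definition box (L : nat) : finType := {ffun 'I_d -> 'I_(2 * L + 1)}.

Definition site (L : nat) (j : box L) : lattice d :=
  [ffun i => (j i)%:Z - L%:Z].

(* The matrix of chi_L H chi_L: its entries are <e_m, H e_n>. *)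
Definition anderson_box V (L : nat) : 'M[R[i]]_#|box L| :=
  \matrix_(a, b) anderson V (std_basis (site (enum_val b))) (site (enum_val a)).

(* Number of eigenvalues <= E counted with (algebraic) multiplicity; all but
   finitely many terms of the sum vanish. *)
Definition eigenvalue_count (m : nat) (A : 'M[R[i]]_m) (E : R) : nat :=
  \sum_(x \in [set x : R | x <= E]) mup x%:C (char_poly A).

Definition is_dosm dT (T : measurableType dT) (P : probability T R)
    (X : lattice d -> {RV P >-> R}) (nu : probability R R) : Prop :=
  forall E : R, {ae P, forall w,
    (eigenvalue_count (anderson_box (fun n => X n w) L) E)%:R
      / ((2 * L + 1) ^ d)%N%:R @[L --> \oo] --> fine (nu `]-oo, E]%classic)}.

End Anderson.

(* Main.v *)
(* For lambda > 0 and t >= 0, the amplitude u_n(t) = <e_n, e^{-itH} e_0> solves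
   u' = -i (Delta + V) u. Consider the means E[e^{-i a.V} u_n(s)], where a.V is a
   combination of finitely many values of V with weights a >= 0. Following the
   equation at a site n while the weight t - s of V_n decreases removes the
   potential, moves the amplitude to the neighbours of n and keeps the total
   s + |a| constant. At time 0 these means are values of the characteristic
   function of V, and passing from mu_2 to mu_1 * mu_2 multiplies them by
   e^{-lambda |a|}: the Fourier transform of the Cauchy law is e^{-lambda |s|}, and
   all weights are nonnegative. The difference of the two families of means,
   corrected by e^{-lambda (s + |a|)}, is thus bounded, vanishes at time 0, and
   satisfies a hopping equation with bounded coefficients; iterating the mean
   value inequality r times bounds it by 2 (Ct)^r / r!.

   Only the equation at distance < r from the origin is used, so the comparison
   applies to the diagonal entries of e^{-itH_L} at all sites of the box at distance
   >= r from the boundary. Their average over the box is, up to boundary sites, the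
   normalised trace of e^{-itH_L}, which tends to the Fourier transform of the
   density of states measure. The same comparison for a fixed potential identifies
   the limit for h, and negative t follow by conjugation. *)
From HB Require Import structures.
Require Import Defs.
From mathcomp Require Import all_boot all_order all_algebra.
From mathcomp Require Import finmap complex.
From mathcomp Require Import all_classical all_reals all_analysis.
From mathcomp Require Import measurable_realfun ring lra zify.
Set Implicit Arguments.
Unset Strict Implicit.
Unset Printing Implicit Defensive.
Import Order.TTheory GRing.Theory Num.Theory.
Import numFieldNormedType.Exports.
Local Open Scope classical_set_scope.
Local Open Scope ring_scope.
Local Open Scope complex_scope.

(** * Complex-valued functions of a real variable *)

(** The potential is unbounded and the Cauchy law has no mean, so neither powers of H nor the term
    V_n u_n of the equation can be averaged. Values of V may enter expectations only through bounded
    phases, and this is what the decreasing weight achieves. The sign condition comes from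
    e^{-lambda |s|}, which is multiplicative only among arguments of one sign. Each iteration moves
    one site outwards and integrates once in time: r steps cost C^r, where C is the number of
    nearest neighbours, and gain t^r / r!. The Cauchy transform is found without contour integrals.
    As a function of the width y, the cosine transform J of the Poisson kernel satisfies J'' = s^2 J
    because the kernel is harmonic; boundedness leaves c e^{-sy}, and y -> 0 gives c = pi. Neither U
    nor a diagonalisation is assumed measurable in the realisation of V. Matrix propagators are
    measurable through their power series, and the amplitude in infinite volume is a pointwise limit
    of theirs. *)

Section ComplexParts.
Context {R : realType}.
Implicit Types (x y z : R[i]).

Lemma cReD x y : complex.Re (x + y) = complex.Re x + complex.Re y.
Proof. by case: x; case: y. Qed.

Lemma cImD x y : complex.Im (x + y) = complex.Im x + complex.Im y.
Proof. by case: x; case: y. Qed.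

Lemma cReN x : complex.Re (- x) = - complex.Re x. Proof. by case: x. Qed.

Lemma cImN x : complex.Im (- x) = - complex.Im x. Proof. by case: x. Qed.

Lemma cReM x y : complex.Re (x * y) =
  complex.Re x * complex.Re y - complex.Im x * complex.Im y.
Proof. by case: x; case: y. Qed.

Lemma cImM x y : complex.Im (x * y) =
  complex.Re x * complex.Im y + complex.Im x * complex.Re y.
Proof. by case: x => a b; case: y => c e. Qed.

Lemma cReJ x : complex.Re (x^*)%C = complex.Re x. Proof. by case: x. Qed.

Lemma cImJ x : complex.Im (x^*)%C = - complex.Im x. Proof. by case: x. Qed.

Lemma cRe_sum (I : Type) (r : seq I) (P : pred I) (F : I -> R[i]) :
  complex.Re (\sum_(i <- r | P i) F i) = \sum_(i <- r | P i) complex.Re (F i).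
Proof. exact: (big_morph _ cReD). Qed.

Lemma cIm_sum (I : Type) (r : seq I) (P : pred I) (F : I -> R[i]) :
  complex.Im (\sum_(i <- r | P i) F i) = \sum_(i <- r | P i) complex.Im (F i).
Proof. exact: (big_morph _ cImD). Qed.

Lemma complex_parts x y : complex.Re x = complex.Re y ->
  complex.Im x = complex.Im y -> x = y.
Proof. by case: x => a b; case: y => c e /= -> ->. Qed.

(** Bounding the components separately lets the real mean value theorem and real integral bounds act
    on each of them; the price is the factor 2 in [cleM]. *)
Definition cle z (c : R) : Prop :=
  `|complex.Re z| <= c /\ `|complex.Im z| <= c.

Lemma cle_eq0 z : (forall e, 0 < e -> cle z e) -> z = 0.
Proof.
move=> H; apply: complex_parts => /=; apply/eqP; rewrite -normr_eq0;
  rewrite eq_le normr_ge0 andbT; apply/ler_addgt0Pr => e e0; rewrite add0r.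
- by case: (H e e0).
- by case: (H e e0).
Qed.

Lemma cle_trans z (c c' : R) : cle z c -> c <= c' -> cle z c'.
Proof. by case=> h1 h2 h3; split; [exact: le_trans h1 h3|exact: le_trans h2 h3]. Qed.

Lemma cleN z c : cle z c -> cle (- z) c.
Proof. by rewrite /cle cReN cImN !normrN. Qed.

Lemma cleD x y a b : cle x a -> cle y b -> cle (x + y) (a + b).
Proof.
move=> [h1 h2] [h3 h4]; rewrite /cle cReD cImD.
by split; apply: le_trans (ler_normD _ _) _; apply: lerD.
Qed.

Lemma cleM x y a b : cle x a -> cle y b -> cle (x * y) (2 * (a * b)).
Proof.
move=> [h1 h2] [h3 h4]; rewrite /cle cReM cImM mulr_natl mulr2n.
split.
- apply: le_trans (ler_normB _ _) _; rewrite !normrM.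
  by apply: lerD; apply: ler_pM.
- apply: le_trans (ler_normD _ _) _; rewrite !normrM.
  by apply: lerD; apply: ler_pM.
Qed.

Lemma cle_sum (I : eqType) (r : seq I) (F : I -> R[i]) (c : R) :
  (forall i, i \in r -> cle (F i) c) ->
  cle (\sum_(i <- r) F i) ((size r)%:R * c).
Proof.
elim: r => [|i r IH] H; first by rewrite big_nil mul0r /cle/= normr0.
rewrite big_cons /= -natr1 mulrDl mul1r addrC; apply: cleD.
  by apply: IH => k kr; apply: H; rewrite inE kr orbT.
by apply: H; rewrite inE eqxx.
Qed.

Lemma normc_ge0 z : 0 <= Normc.normc z.
Proof. by case: z => a b; exact: sqrtr_ge0. Qed.

Lemma cle_normc z c : Normc.normc z <= c -> cle z c.
Proof.
move=> zc; case: z zc => a b /= zc; rewrite /cle /=.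
split; apply: le_trans zc; rewrite -sqrtr_sqr ler_wsqrtr//.
  by rewrite lerDl sqr_ge0.
by rewrite lerDr sqr_ge0.
Qed.

Lemma cexpiD (a b : R) : cexpi (a + b) = cexpi a * cexpi b :> R[i].
Proof.
apply: complex_parts => /=; rewrite ?cosD ?sinD//.
by rewrite addrC [sin a * _]mulrC mulrC addrC mulrC [cos b * _]mulrC addrC addrC.
Qed.

Lemma cexpi0 : cexpi 0 = 1 :> R[i].
Proof. by rewrite /cexpi cos0 sin0. Qed.

Lemma cexpiN (a : R) : cexpi (- a) = ((cexpi a)^*)%C :> R[i].
Proof. by rewrite /cexpi cosN sinN. Qed.

Lemma cle_cexpi (a : R) : cle (cexpi a) 1.
Proof.
split => /=; rewrite ler_norml.
- by rewrite cos_geN1 cos_le1.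
- by rewrite sin_geN1 sin_le1.
Qed.

Lemma normc_cexpi (a : R) : Normc.normc (cexpi a) = 1.
Proof. by rewrite /= cos2Dsin2 sqrtr1. Qed.

Lemma cle_cexpiM (a : R) z : Normc.normc z <= 1 -> cle (cexpi a * z) 1.
Proof. by move=> z1; apply: cle_normc; rewrite Normc.normcM normc_cexpi mul1r. Qed.

End ComplexParts.

Section ComplexDerivative.
Context {R : realType}.

(* Derivatives of complex functions of a real variable are taken componentwise,
   [R[i]] not being a normed module over [R]. *)
Definition cderive (f : R -> R[i]) (s : R) (l : R[i]) : Prop :=
  is_derive s 1 (fun x : R => complex.Re (f x)) (complex.Re l) /\
  is_derive s 1 (fun x : R => complex.Im (f x)) (complex.Im l).

Lemma cderive_eq (f : R -> R[i]) s l l' : cderive f s l -> l = l' -> cderive f s l'.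
Proof. by move=> + <-. Qed.

Lemma cderiveD (f g : R -> R[i]) s a b : cderive f s a -> cderive g s b ->
  cderive (fun x => f x + g x) s (a + b).
Proof.
move=> [f1 f2] [g1 g2]; rewrite /cderive cReD cImD; split.
- by under eq_fun do rewrite cReD; exact: is_deriveD.
- by under eq_fun do rewrite cImD; exact: is_deriveD.
Qed.

Lemma cderiveN (f : R -> R[i]) s a : cderive f s a -> cderive (fun x => - f x) s (- a).
Proof.
move=> [f1 f2]; rewrite /cderive cReN cImN; split.
- by under eq_fun do rewrite cReN; exact: is_deriveN.
- by under eq_fun do rewrite cImN; exact: is_deriveN.
Qed.

Lemma cderiveM (f g : R -> R[i]) s a b : cderive f s a -> cderive g s b ->
  cderive (fun x => f x * g x) s (a * g s + f s * b).
Proof.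
move=> [f1 f2] [g1 g2]; split.
- under eq_fun do rewrite cReM.
  have := is_deriveB (is_deriveM f1 g1) (is_deriveM f2 g2).
  move=> /is_derive_eq; apply; rewrite cReD !cReM /GRing.scale/=; ring.
- under eq_fun do rewrite cImM.
  have := is_deriveD (is_deriveM f1 g2) (is_deriveM f2 g1).
  move=> /is_derive_eq; apply; rewrite cImD !cImM /GRing.scale/=; ring.
Qed.

Lemma cderive_cst (z : R[i]) s : cderive (fun=> z) s 0.
Proof. by split; exact: is_derive_cst. Qed.

Lemma cderive_cexpi (f : R -> R) (s l : R) : is_derive s 1 f l ->
  cderive (fun x => cexpi (f x)) s (l%:C * 'i%C * cexpi (f s)).
Proof.
move=> fl; split => /=.
- have := is_derive1_comp (is_derive_cos (f s)) fl.
  move=> /is_derive_eq; apply; ring.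
- have := is_derive1_comp (is_derive_sin (f s)) fl.
  move=> /is_derive_eq; apply; ring.
Qed.

Lemma cderive_sum (I : Type) (r : seq I) (F : I -> R -> R[i]) (s : R) (l : I -> R[i]) :
  (forall i, cderive (F i) s (l i)) ->
  cderive (fun x => \sum_(i <- r) F i x) s (\sum_(i <- r) l i).
Proof.
move=> H; elim: r => [|i r IH].
  rewrite big_nil; under eq_fun do rewrite big_nil; exact: cderive_cst.
rewrite big_cons; under eq_fun do rewrite big_cons; exact: cderiveD.
Qed.

End ComplexDerivative.

Section MeanValue.
Context {R : realType}.

(** Both [f] and [- f], added to the primitive [K * s ^+ m.+1 / m.+1%:R] of the bound, vanish at 0
    and have nonnegative derivative on [0, t]. The divisor [m.+1] gained at each use builds the
    factorial in [hopping_bound]. *)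
Lemma mean_value_pow (f df : R -> R) (K t : R) (m : nat) : 0 <= t ->
  (forall s : R, is_derive s 1 f (df s)) -> f 0 = 0 ->
  (forall s : R, 0 <= s <= t -> `|df s| <= K * s ^+ m) ->
  `|f t| <= K * t ^+ m.+1 / m.+1%:R.
Proof.
move=> t0 fdf f0 dfK.
have m1 : (m.+1%:R : R) != 0 by rewrite pnatr_eq0.
have hp (c : R) (s : R) : is_derive s 1 (fun x => c * x ^+ m.+1 / m.+1%:R) (c * s ^+ m).
  have -> : (fun x : R => c * x ^+ m.+1 / m.+1%:R) =
            (c / m.+1%:R) \*: ((id : R -> R) ^+ m.+1).
    by apply/funext => x; rewrite exprfctE /GRing.scale/= mulrAC.
  have := is_deriveZ (c / m.+1%:R) (is_deriveX m.+1 (is_derive_id s 1)).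
  move=> /is_derive_eq; apply; rewrite /GRing.scale/= mulr1.
  by rewrite -mulrA; congr (_ * _); rewrite mulKf.
(* The sign [c] is 1 for the lower bound on [f t] and -1 for the upper one. *)
have key (c : R) : (forall s : R, 0 <= s <= t -> 0 <= c * df s + K * s ^+ m) ->
    0 <= c * f t + K * t ^+ m.+1 / m.+1%:R.
  move=> H.
  pose g (x : R) := c * f x + K * x ^+ m.+1 / m.+1%:R.
  have gd (s : R) : is_derive s 1 g (c * df s + K * s ^+ m).
    exact: (is_deriveD (is_deriveZ c (fdf s)) (hp K s)).
  have [|x] := @MVT_segment _ g (fun s => c * df s + K * s ^+ m) 0 t t0 (fun s _ => gd s).
    apply: derivable_within_continuous => s _.
    by have [] := gd s.
  rewrite in_itv/= => x0t e.
  have g0 : g 0 = 0 by rewrite /g f0 exprS !(mul0r, mulr0) addr0.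
  move: e; rewrite g0 !subr0 -/(g t) => ->.
  by rewrite mulr_ge0// H.
rewrite ler_norml; apply/andP; split.
- rewrite lerNl -subr_ge0 opprK addrC -[f t]mul1r; apply: key => s s0.
  have := dfK s s0; rewrite ler_norml => /andP[+ _]; lra.
- rewrite -subr_ge0 addrC -mulN1r; apply: key => s s0.
  have := dfK s s0; rewrite ler_norml => /andP[_]; lra.
Qed.

End MeanValue.

(** * Nearest neighbours and the iterated hopping estimate *)

Section Lattice.
Context {d : nat}.
Implicit Types n e : lattice d.

Lemma l1norm_ge0 n : 0 <= l1norm n.
Proof. exact: sumr_ge0. Qed.

Lemma l1norm0 : l1norm (0 : lattice d) = 0.
Proof. by rewrite /l1norm big1// => i _; rewrite ffunE normr0. Qed.

Lemma l1norm_leD n e : l1norm (n + e) <= l1norm n + l1norm e.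
Proof.
rewrite /l1norm -big_split/=; apply: ler_sum => i _.
by rewrite ffunE ler_normD.
Qed.

(** Each coordinate of such a vector is -1, 0 or 1, hence an element of ['I_3] shifted down by 1. *)
Lemma finite_unit_vectors : finite_set [set e : lattice d | l1norm e = 1].
Proof.
pose f (x : {ffun 'I_d -> 'I_3}) : lattice d := [ffun i => (x i)%:Z - 1].
apply: (@sub_finite_set _ _ (f @` setT)); last first.
  by apply: finite_image; exact: finite_finset.
move=> e /= e1.
have ei i : (absz (e i) <= 1)%N.
  have : `|e i| <= l1norm e.
    rewrite /l1norm (bigD1 i)//= lerDl; exact: sumr_ge0.
  by rewrite e1; lia.
exists [ffun i => inord (absz (e i + 1))] => //.
by apply/ffunP => i; rewrite !ffunE inordK; move: (ei i); move: (e i) => z; lia.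
Qed.

Definition unit_vectors : seq (lattice d) :=
  fset_set [set e : lattice d | l1norm e = 1].

Lemma unit_vectorsP e : reflect (l1norm e = 1) (e \in unit_vectors).
Proof.
apply: (iffP idP); rewrite /unit_vectors in_fset_set ?inE//;
  exact: finite_unit_vectors.
Qed.

Lemma uniq_unit_vectors : uniq unit_vectors.
Proof. exact: fset_uniq. Qed.

(** Summing over displacements makes the index sequence independent of [n], so the hopping term can
    be differentiated, integrated and bounded in the same way at every site. *)
Lemma laplacianE {R : realType} (u : lattice d -> R[i]) n :
  laplacian u n = \sum_(e <- unit_vectors) u (n + e).
Proof.
rewrite /laplacian (reindex_fsbig (fun e => n + e) [set e | l1norm e = 1])/=.
  by rewrite fsbig_finite//=; exact: finite_unit_vectors.
split=> [e /= <-|e e' _ _ /addrI//|k /= k1].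
  by rewrite addrAC subrr add0r.
by exists (k - n) => //; rewrite addrC subrK.
Qed.

End Lattice.

Section Comparison.
Context {R : realType} {d : nat}.
Implicit Types (n : lattice d) (a : seq (lattice d * R)).

Local Notation C := (size (@unit_vectors d))%:R.

Definition nonneg_weights a := all (fun p => 0 <= p.2) a.

(* [Phi s a n] stands for the mean of e^{-i a.V} u_n(s), where u solves
   u' = -i (Delta + V) u. Removing the unbounded potential by the factor
   e^{-i (t - s) V_n}, which is the prefix [(n, t - s)] of the list, leaves a
   bounded hopping term, and the mean value inequality can be iterated. *)
Lemma hopping_bound (Phi : R -> seq (lattice d * R) -> lattice d -> R[i])
    (M : R) (r : nat) :
  (forall s a n, 0 <= s -> nonneg_weights a -> cle (Phi s a n) M) ->
  (forall a n, nonneg_weights a -> Phi 0 a n = 0) ->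
  (forall t a n, Phi t ((n, 0) :: a) n = Phi t a n) ->
  (forall (s t : R) a n, l1norm n < r%:Z ->
     cderive (fun x : R => Phi x ((n, t - x) :: a) n) s
       (- 'i%C * \sum_(e <- unit_vectors) Phi s ((n, t - s) :: a) (n + e))) ->
  forall (j : nat) n (t : R) a, l1norm n + j%:Z <= r%:Z -> 0 <= t ->
    nonneg_weights a -> cle (Phi t a n) (M * (C * t) ^+ j / j`!%:R).
Proof.
move=> PhiM Phi0 Phipad Phid; elim=> [|j IH] n t a nj t0 a0.
  by rewrite expr0 fact0 mulr1 divr1; exact: PhiM.
pose f (s : R) := Phi s ((n, t - s) :: a) n.
pose df (s : R) := - 'i%C * \sum_(e <- unit_vectors) Phi s ((n, t - s) :: a) (n + e).
pose K : R := C * (M * C ^+ j / j`!%:R).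
have fd (s : R) : cderive f s (df s) by apply: Phid; have := l1norm_ge0 n; lia.
have f0 : f 0 = 0 by apply: Phi0; rewrite /= subr0 t0.
have dfK (s : R) : 0 <= s <= t -> cle (df s) (K * s ^+ j).
  move=> /andP[s0 st].
  have : cle (\sum_(e <- unit_vectors) Phi s ((n, t - s) :: a) (n + e))
      (C * (M * (C * s) ^+ j / j`!%:R)).
    (* A neighbour may lie one step farther from the origin; the drop from [j.+1] to [j] pays for
       it. *)
    apply: cle_sum => e /unit_vectorsP e1; apply: IH => //.
      by have := l1norm_leD n e; rewrite e1; lia.
    by rewrite /= subr_ge0 st.
  have -> : C * (M * (C * s) ^+ j / j`!%:R) = K * s ^+ j.
    by rewrite /K exprMn; ring.
  (* Multiplication by - i only exchanges the components up to sign. The factor 2 of [cleM] would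
     compound with [j] and is avoided here. *)
  by rewrite /df /cle cReM cImM /= !(mul0r, oppr0, sub0r, add0r, mulN1r, normrN, opprK) => -[].
have tE : K * t ^+ j.+1 / j.+1%:R = M * (C * t) ^+ j.+1 / j.+1`!%:R.
  rewrite /K exprMn factS natrM [C ^+ j.+1]exprS invfM; ring.
have -> : Phi t a n = f t by rewrite /f subrr Phipad.
rewrite -tE; split.
- apply: (@mean_value_pow _ (fun x => complex.Re (f x)) (fun x => complex.Re (df x))) => //.
  + by move=> s; have [] := fd s.
  + by rewrite f0.
  + by move=> s st; have [] := dfK s st.
- apply: (@mean_value_pow _ (fun x => complex.Im (f x)) (fun x => complex.Im (df x))) => //.
  + by move=> s; have [] := fd s.
  + by rewrite f0.
  + by move=> s st; have [] := dfK s st.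
Qed.

End Comparison.

(** * Integration of bounded real and complex functions *)

Section DerivativeUnderIntegral.
Context {R : realType} {dT : measure_display} {T : measurableType dT}.
Variable mu : {measure set T -> \bar R}.

Lemma is_derive_Rintegral (f df : R -> T -> R) (g : T -> R) (s u v : R) :
  `]u, v[%classic s ->
  (forall x, `]u, v[%classic x -> mu.-integrable setT (EFin \o f x)) ->
  mu.-integrable setT (EFin \o g) ->
  (forall x w, `]u, v[%classic x -> `|df x w| <= g w) ->
  (forall (x : R) w, `]u, v[%classic x -> is_derive x 1 (f ^~ w) (df x w)) ->
  is_derive s 1 (fun x => \int[mu]_w f x w) (\int[mu]_w df s w).
Proof.
move=> Is intf intg dfg fd.
have g0 w : 0 <= g w by apply: le_trans (normr_ge0 _) (dfg s w Is).
have p1 x w : `]u, v[%classic x -> partial1of2 f x w = df x w.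
  by move=> xI; rewrite partial1of2E; have [_ ->] := fd x w xI.
have der x y : `]u, v[%classic x -> setT y -> derivable (f ^~ y) x 1.
  by move=> xI _; have [] := fd x y xI.
have ub x y : `]u, v[%classic x -> setT y -> `|partial1of2 f x y| <= g y.
  by move=> xI _; rewrite p1// dfg.
apply: DeriveDef.
  exact: (derivable_under_integral measurableT Is intf der g0 intg ub).
rewrite -derive1E.
rewrite (differentiation_under_integral measurableT Is intf der g0 intg ub)//.
by apply: eq_Rintegral => w _; rewrite p1.
Qed.

End DerivativeUnderIntegral.

Section BoundedIntegrals.
Context {R : realType} {dT : measure_display} {T : measurableType dT}.
Variable P : probability T R.

Lemma integrable_bounded (f : T -> R) (M : R) : measurable_fun setT f ->
  (forall w, `|f w| <= M) -> P.-integrable setT (EFin \o f).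
Proof.
move=> mf fM; apply: (@le_integrable _ _ _ P _ measurableT _ (EFin \o cst M)).
- exact/measurable_EFinP.
- move=> w _ /=; rewrite lee_fin; apply: le_trans (fM w) _.
  exact: ler_norm.
- exact: finite_measure_integrable_cst.
Qed.

Lemma Rintegral_constant (c : R) : \int[P]_w c = c.
Proof.
rewrite Rintegral_cst// -[RHS]mulr1; congr (c * _).
exact: (congr1 fine (probability_setT P)).
Qed.

Lemma Rintegral_bound (f : T -> R) (M : R) : measurable_fun setT f ->
  (forall w, `|f w| <= M) -> `|\int[P]_w f w| <= M.
Proof.
move=> mf fM; have fi := integrable_bounded mf fM.
apply: le_trans (le_normr_Rintegral measurableT fi) _.
rewrite -[leRHS]Rintegral_constant.
apply: le_Rintegral => //.
- by apply: (@integrable_bounded _ M); [exact: measurableT_comp|move=> w; rewrite normr_id].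
- exact: finite_measure_integrable_cst.
Qed.

Lemma Rintegral_dominated (f_ : nat -> T -> R) (f : T -> R) (M : R) :
  (forall n, measurable_fun setT (f_ n)) -> measurable_fun setT f ->
  (forall n w, `|f_ n w| <= M) ->
  {ae P, forall w, f_ n w @[n --> \oo] --> f w} ->
  \int[P]_w f_ n w @[n --> \oo] --> \int[P]_w f w.
Proof.
move=> mf_ mf f_M cf.
have [] := @dominated_convergence _ _ _ P setT measurableT
  (fun n => EFin \o f_ n) (EFin \o f) (EFin \o cst M).
- by move=> n; exact/measurable_EFinP.
- exact/measurable_EFinP.
- move: cf; apply: filterS => w cw _.
  by apply: cvg_EFin => //; exact: nearW.
- exact: finite_measure_integrable_cst.
- by apply: aeW => w n _ /=; rewrite lee_fin.
move=> fi _ cv; apply: fine_cvg; rewrite fineK//.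
exact: integrable_fin_num.
Qed.

Lemma is_derive_Rintegral_bounded (f df : R -> T -> R) (M K s : R) :
  (forall x, measurable_fun setT (f x)) -> (forall x w, `|f x w| <= M) ->
  (forall x w, `|df x w| <= K) ->
  (forall (x : R) w, is_derive x 1 (f ^~ w) (df x w)) ->
  is_derive s 1 (fun x => \int[P]_w f x w) (\int[P]_w df s w).
Proof.
move=> mf fM dfK fd.
apply: (@is_derive_Rintegral _ _ _ P f df (cst K) s (s - 1) (s + 1)) => //.
- by rewrite /= in_itv/=; lra.
- by move=> x _; apply: integrable_bounded (mf x) (fM x).
- exact: finite_measure_integrable_cst.
Qed.

Definition cmeasurable (f : T -> R[i]) : Prop :=
  measurable_fun setT (fun w => complex.Re (f w)) /\
  measurable_fun setT (fun w => complex.Im (f w)).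

Lemma cmeasurable_cst (z : R[i]) : cmeasurable (fun=> z).
Proof. by split; exact: measurable_cst. Qed.

Lemma cmeasurableD (f g : T -> R[i]) : cmeasurable f -> cmeasurable g ->
  cmeasurable (fun w => f w + g w).
Proof.
move=> [f1 f2] [g1 g2]; split.
- by under eq_fun do rewrite cReD; exact: measurable_funD.
- by under eq_fun do rewrite cImD; exact: measurable_funD.
Qed.

Lemma cmeasurableM (f g : T -> R[i]) : cmeasurable f -> cmeasurable g ->
  cmeasurable (fun w => f w * g w).
Proof.
move=> [f1 f2] [g1 g2]; split.
- by under eq_fun do rewrite cReM; apply: measurable_funB; exact: measurable_funM.
- by under eq_fun do rewrite cImM; apply: measurable_funD; exact: measurable_funM.
Qed.

Lemma cmeasurable_sum (I : Type) (r : seq I) (F : I -> T -> R[i]) :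
  (forall i, cmeasurable (F i)) -> cmeasurable (fun w => \sum_(i <- r) F i w).
Proof.
move=> H; elim: r => [|i r IH].
  by under eq_fun do rewrite big_nil; exact: cmeasurable_cst.
by under eq_fun do rewrite big_cons; exact: cmeasurableD.
Qed.

Lemma cmeasurable_cexpi (g : T -> R) : measurable_fun setT g ->
  cmeasurable (fun w => cexpi (g w)).
Proof.
move=> mg; split => /=; apply: measurableT_comp => //.
- by apply: continuous_measurable_fun; exact: continuous_cos.
- by apply: continuous_measurable_fun; exact: continuous_sin.
Qed.

Lemma cintegralD (f g : T -> R[i]) (M K : R) :
  cmeasurable f -> cmeasurable g ->
  (forall w, cle (f w) M) -> (forall w, cle (g w) K) ->
  cintegral P (fun w => f w + g w) = cintegral P f + cintegral P g.
Proof.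
move=> [f1 f2] [g1 g2] fM gK; apply: complex_parts => /=.
- rewrite -RintegralD//; first by apply: eq_Rintegral => w _; rewrite cReD.
  + by apply: integrable_bounded f1 (fun w => (fM w).1).
  + by apply: integrable_bounded g1 (fun w => (gK w).1).
- rewrite -RintegralD//; first by apply: eq_Rintegral => w _; rewrite cImD.
  + by apply: integrable_bounded f2 (fun w => (fM w).2).
  + by apply: integrable_bounded g2 (fun w => (gK w).2).
Qed.

Lemma cintegralZ (z : R[i]) (f : T -> R[i]) (M : R) :
  cmeasurable f -> (forall w, cle (f w) M) ->
  cintegral P (fun w => z * f w) = z * cintegral P f.
Proof.
move=> [f1 f2] fM.
have i1 := integrable_bounded f1 (fun w => (fM w).1).
have i2 := integrable_bounded f2 (fun w => (fM w).2).
have iZ (c : R) (g : T -> R) : P.-integrable setT (EFin \o g) ->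
    P.-integrable setT (EFin \o (fun w => c * g w)).
  by move=> ig; exact: (integrableZl measurableT c ig).
apply: complex_parts; rewrite ?cReM ?cImM /=.
- rewrite -!RintegralZl// -RintegralB//; try exact: iZ.
  by apply: eq_Rintegral => w _; rewrite cReM.
- rewrite -!RintegralZl// -RintegralD//; try exact: iZ.
  by apply: eq_Rintegral => w _; rewrite cImM.
Qed.

Lemma cintegral_cst (z : R[i]) : cintegral P (fun=> z) = z.
Proof. by apply: complex_parts; exact: Rintegral_constant. Qed.

Lemma eq_cintegral (f g : T -> R[i]) : f =1 g -> cintegral P f = cintegral P g.
Proof. by move=> /funext ->. Qed.

Lemma cintegral_sum (I : Type) (r : seq I) (F : I -> T -> R[i]) (M : R) :
  (forall i, cmeasurable (F i)) -> (forall i w, cle (F i w) M) ->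
  cintegral P (fun w => \sum_(i <- r) F i w) = \sum_(i <- r) cintegral P (F i).
Proof.
move=> mF FM; elim: r => [|i r IH].
  rewrite big_nil -[RHS](cintegral_cst 0).
  by apply: eq_cintegral => w; rewrite big_nil.
rewrite big_cons -IH -(@cintegralD _ _ M ((size r)%:R * M))//.
- by apply: eq_cintegral => w; rewrite big_cons.
- exact: cmeasurable_sum.
- move=> w; elim: r {IH} => [|k r IH]; first by rewrite big_nil mul0r /cle/= normr0.
  by rewrite big_cons/= -natr1 mulrDl mul1r addrC; exact: cleD.
Qed.

Lemma cle_cintegral (f : T -> R[i]) (M : R) : cmeasurable f ->
  (forall w, cle (f w) M) -> cle (cintegral P f) M.
Proof.
move=> [f1 f2] fM; split => /=.
- by apply: Rintegral_bound => // w; case: (fM w).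
- by apply: Rintegral_bound => // w; case: (fM w).
Qed.

Lemma cderive_cintegral (f df : R -> T -> R[i]) (M K s : R) :
  (forall x, cmeasurable (f x)) -> (forall x w, cle (f x w) M) ->
  (forall x w, cle (df x w) K) ->
  (forall (x : R) w, cderive (f ^~ w) x (df x w)) ->
  cderive (fun x => cintegral P (f x)) s (cintegral P (df s)).
Proof.
move=> mf fM dfK fd; split => /=.
- apply: (@is_derive_Rintegral_bounded (fun x w => complex.Re (f x w))
    (fun x w => complex.Re (df x w)) M K).
  + by move=> x; case: (mf x).
  + by move=> x w; case: (fM x w).
  + by move=> x w; case: (dfK x w).
  + by move=> x w; case: (fd x w).
- apply: (@is_derive_Rintegral_bounded (fun x w => complex.Im (f x w))
    (fun x w => complex.Im (df x w)) M K).
  + by move=> x; case: (mf x).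
  + by move=> x w; case: (fM x w).
  + by move=> x w; case: (dfK x w).
  + by move=> x w; case: (fd x w).
Qed.

End BoundedIntegrals.

(** * The Fourier transform of the Cauchy distribution *)

Section RealLineIntegrals.
Context {R : realType}.
Notation leb := (@lebesgue_measure R).

(** Dominated convergence with majorant [|g|]. The intervals are symmetric so that odd integrands
    cancel on each of them. *)
Lemma cvg_Rintegral_sym (g : R -> R) : leb.-integrable setT (EFin \o g) ->
  \int[leb]_(x in `[- n%:R, n%:R]) g x @[n --> \oo] --> \int[leb]_x g x.
Proof.
move=> ig; have mg : measurable_fun setT g.
  by apply/measurable_EFinP; exact: measurable_int ig.
pose h (n : nat) : R -> R := g \_ `[- n%:R, n%:R].
have hE (n : nat) : \int[leb]_(x in `[- n%:R, n%:R]) g x = \int[leb]_x h n x.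
  by rewrite Rintegral_mkcond.
under eq_fun do rewrite hE.
have [] := @dominated_convergence _ _ _ leb setT measurableT
  (fun n => EFin \o h n) (EFin \o g) (fun x => `|g x|%:E).
- move=> n; apply/measurable_EFinP.
  by apply: (iffLR (measurable_restrictT g _)); [exact: measurable_itv|exact: measurable_funTS].
- exact/measurable_EFinP.
- apply: aeW => x _; apply: cvg_EFin; first exact: nearW.
  apply: cvg_near_cst; near=> n => /=.
  rewrite /h patchE mem_set//= in_itv/=; rewrite -ler_norml.
  by near: n; exact: nbhs_infty_ger.
- exact: integrable_abse ig.
- apply: aeW => x n _ /=; rewrite lee_fin /h patchE.
  by case: ifP; rewrite ?normr0 ?normr_ge0.
move=> _ _ cv; apply: fine_cvg; rewrite fineK//.
exact: integrable_fin_num.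
Unshelve. all: by end_near. Qed.

(** The integral over [-n, n] is [G n - G (- n)], which the decay of [G] bounds by [2 * K / n]. This
    is integration by parts on the whole line with vanishing boundary terms. *)
Lemma Rintegral_derivative0 (G g : R -> R) (K : R) :
  (forall x : R, is_derive x 1 G (g x)) -> continuous g ->
  leb.-integrable setT (EFin \o g) ->
  (forall x, `|G x| * `|x| <= K) -> \int[leb]_x g x = 0.
Proof.
move=> Gg cg ig GK.
have cv := cvg_Rintegral_sym ig.
have c0 : \int[leb]_(x in `[- n%:R, n%:R]) g x @[n --> \oo] --> (0 : R).
  have GE (n : nat) : (0 < n)%N -> \int[leb]_(x in `[- n%:R, n%:R]) g x = G n%:R - G (- n%:R).
    move=> n0; rewrite /Rintegral (@continuous_FTC2 _ g G)//.
    - by rewrite gtrN// ltr0n.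
    - by apply: continuous_subspaceT => x; exact: cg.
    - have cG x : {for x, continuous G}.
        by apply/differentiable_continuous/derivable1_diffP; have [] := Gg x.
      split=> [x _||]; first by have [] := Gg x.
      + by apply: cvg_at_right_filter; exact: cG.
      + by apply: cvg_at_left_filter; exact: cG.
    - by move=> x _; rewrite derive1E; have [_ ->] := Gg x.
  apply/cvgr0Pnorm_le => e e0; near=> n.
  have n0 : (0 < n)%N by near: n; exact: nbhs_infty_gt.
  have nR : (0 : R) < n%:R by rewrite ltr0n.
  rewrite GE//; apply: le_trans (ler_normB _ _) _.
  have h1 : `|G n%:R| <= K / n%:R.
    by rewrite ler_pdivlMr//; have := GK n%:R; rewrite (gtr0_norm nR).
  have h2 : `|G (- n%:R)| <= K / n%:R.
    by rewrite ler_pdivlMr//; have := GK (- n%:R); rewrite normrN (gtr0_norm nR).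
  apply: le_trans (lerD h1 h2) _.
  rewrite -mulrDl ler_pdivrMr// mulrC -ler_pdivrMr//.
  by near: n; exact: nbhs_infty_ger.
exact: (cvg_unique _ cv c0).
Unshelve. all: by end_near. Qed.

(** The substitution of - x for x shows that each integral over [-n, n] equals its own opposite. *)
Lemma Rintegral_odd (g : R -> R) : continuous g ->
  leb.-integrable setT (EFin \o g) -> (forall x, g (- x) = - g x) ->
  \int[leb]_x g x = 0.
Proof.
move=> cg ig og.
suff c0 : \int[leb]_(x in `[- n%:R, n%:R]) g x @[n --> \oo] --> (0 : R).
  exact: (cvg_unique _ (cvg_Rintegral_sym ig) c0).
apply: cvg_near_cst; apply: nearW => n.
have ign : leb.-integrable `[- n%:R, n%:R] (EFin \o g).
  exact: integrableS ig.
suff : \int[leb]_(x in `[- n%:R, n%:R]) g x = - \int[leb]_(x in `[- n%:R, n%:R]) g x.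
  by move=> /eqP; rewrite -subr_eq0 opprK -mulr2n mulrn_eq0/= => /eqP.
rewrite -[RHS]mulN1r -RintegralZl//.
transitivity (\int[leb]_(x in `[- n%:R, n%:R]) g (- x)); last first.
  by apply: eq_Rintegral => x _; rewrite og mulN1r.
rewrite /Rintegral; congr fine.
have := @integration_by_substitution_oppr _ g (- n%:R) n%:R.
rewrite opprK => -> //; first by rewrite -subr_ge0 opprK addr_ge0.
by apply: continuous_subspaceT => x; exact: cg.
Qed.

End RealLineIntegrals.

Section BoundedSolutionsODE.
Context {R : realType}.

Lemma is_derive0_cst_pos (f : R -> R) :
  (forall y : R, 0 < y -> is_derive y 1 f 0) ->
  forall x y, 0 < x -> 0 < y -> f x = f y.
Proof.
move=> fd; suff H x y : 0 < x -> x <= y -> f x = f y.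
  move=> x y x0 y0; have [xy|yx] := leP x y; first exact: H.
  by apply/esym/H => //; exact: ltW.
move=> x0 xy.
have pos z : x <= z -> 0 < z by exact: lt_le_trans.
have fd' z : z \in `]x, y[ -> is_derive z 1 f ((fun=> 0) z).
  by rewrite in_itv/= => /andP[/ltW xz _]; apply/fd/pos.
have [|z _] := MVT_segment xy fd'.
  apply: derivable_within_continuous => z; rewrite in_itv/= => /andP[xz _].
  by have [] := fd z (pos z xz).
by rewrite mul0r => /eqP; rewrite subr_eq0 => /eqP.
Qed.

(** The equation J'' = s^2 J factors as (D - s)(D + s) J = 0: (J' + s J) e^{-sy} is a constant [k],
    and then J e^{sy} - k/(2s) e^{2sy} is a constant [c]. Boundedness excludes the growing
    exponential, so [k] is 0. *)
Lemma bounded_ode_solution (J J1 : R -> R) (s M : R) : 0 < s ->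
  (forall y : R, 0 < y -> is_derive y 1 J (J1 y)) ->
  (forall y : R, 0 < y -> is_derive y 1 J1 (s ^+ 2 * J y)) ->
  (forall y, 0 < y -> `|J y| <= M) ->
  exists c, forall y, 0 < y -> J y = c * expR (- (s * y)).
Proof.
move=> s0 Jd J1d JM.
have ed (r : R) (y : R) : is_derive y 1 (fun y => expR (r * y)) (r * expR (r * y)).
  have := is_derive1_comp (is_derive_expR (r * y)) (is_deriveZ r (is_derive_id y (1 : R))).
  by move=> /is_derive_eq; apply; rewrite /GRing.scale/= mulr1 mulrC.
pose K y := (J1 y + s * J y) * expR (- s * y).
have Kd (y : R) : 0 < y -> is_derive y 1 K 0.
  move=> y0; have := is_deriveM (is_deriveD (J1d y y0) (is_deriveZ s (Jd y y0))) (ed (- s) y).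
  move=> /is_derive_eq; apply; rewrite /GRing.scale/=.
  have -> : (J1 + s \*: J) y = J1 y + s * J y by [].
  by ring.
pose k := K 1.
have KE y : 0 < y -> K y = k by move=> y0; exact: is_derive0_cst_pos.
pose L y := J y * expR (s * y) - k / (2 * s) * expR (2 * s * y).
have Ld (y : R) : 0 < y -> is_derive y 1 L 0.
  move=> y0.
  have := is_deriveB (is_deriveM (Jd y y0) (ed s y)) (is_deriveZ (k / (2 * s)) (ed (2 * s) y)).
  move=> /is_derive_eq; apply; rewrite /GRing.scale/=.
  have -> : k / (2 * s) * (2 * s * expR (2 * s * y)) = k * expR (2 * s * y).
    by rewrite mulrA divfK// mulf_neq0 ?pnatr_eq0// gt_eqF.
  rewrite -(KE y y0) /K.
  have -> : 2 * s * y = s * y + s * y by ring.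
  have eN : expR (- s * y) * expR (s * y) = 1.
    by rewrite -expRD mulNr addNr expR0.
  rewrite expRD mulrA -(mulrA _ (expR (- s * y))) eN; ring.
pose c := L 1.
have JE y : 0 < y -> J y = k / (2 * s) * expR (s * y) + c * expR (- (s * y)).
  move=> y0.
  have LE : L y = c by exact: is_derive0_cst_pos.
  have eN : expR (s * y) * expR (- (s * y)) = 1 by rewrite -expRD subrr expR0.
  have -> : c * expR (- (s * y)) =
      J y * (expR (s * y) * expR (- (s * y))) -
      k / (2 * s) * expR (s * y) * (expR (s * y) * expR (- (s * y))).
    rewrite -LE /L; have -> : 2 * s * y = s * y + s * y by ring.
    by rewrite expRD; ring.
  by rewrite eN; ring.
suff k0 : k = 0.
  by exists c => y y0; rewrite JE// k0 mul0r mul0r add0r.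
apply/eqP; apply: contraT => kN0.
pose q : R := `|k / (2 * s)|.
have q0 : 0 < q.
  by rewrite normr_gt0 mulf_neq0// invr_neq0// mulf_neq0 ?pnatr_eq0// gt_eqF.
have qb y : 0 < y -> q * expR (s * y) <= M + `|c|.
  move=> y0; rewrite -[expR (s * y)]ger0_norm ?expR_ge0// -normrM.
  have -> : k / (2 * s) * expR (s * y) = J y - c * expR (- (s * y)).
    by rewrite JE// addrK.
  apply: le_trans (ler_normB _ _) _; apply: lerD; first exact: JM.
  rewrite normrM ler_piMr// ger0_norm ?expR_ge0// -expR0 ler_expR oppr_le0.
  by rewrite mulr_ge0// ltW.
have M0 : 0 <= M + `|c|.
  by apply: le_trans (qb 1 _) => //; rewrite mulr_ge0// ?expR_ge0 ?ltW.
(* At this point the minorant [q * (1 + s * y)] of [q * expR (s * y)] exceeds the bound by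
   [q + q * s]. *)
pose y := (M + `|c|) / (q * s) + 1.
have y0 : 0 < y by rewrite ltr_wpDl// divr_ge0// mulr_ge0 ?ltW.
have := qb y y0; rewrite leNgt => /negP; case.
apply: (@lt_le_trans _ _ (q * (1 + s * y))); last first.
  by apply: ler_wpM2l; [exact: ltW|exact: expR_ge1Dx].
have -> : q * (1 + s * y) = q + (M + `|c|) + q * s.
  by rewrite /y; field; rewrite !gt_eqF.
have := mulr_gt0 q0 s0; move: (q * s) => z; lra.
Qed.

End BoundedSolutionsODE.

(** * The Poisson kernel and its cosine transform *)

Section PoissonKernel.
Context {R : realType}.
Notation leb := (@lebesgue_measure R).

(** The Poisson kernel of the upper half-plane without its factor 1/pi, so that [poisson lambda]
    divided by [pi] is the Cauchy density. [poisson1] and [poisson2] are its first two derivatives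
    in [y], and [poissonx] is its derivative in [x]. *)
Definition poisson (y x : R) : R := y / (x ^+ 2 + y ^+ 2).

Definition poisson1 (y x : R) : R := (x ^+ 2 - y ^+ 2) / (x ^+ 2 + y ^+ 2) ^+ 2.

Definition poisson2 (y x : R) : R :=
  2 * y * (y ^+ 2 - 3 * x ^+ 2) / (x ^+ 2 + y ^+ 2) ^+ 3.

Definition poissonx (y x : R) : R := - (2 * x * y) / (x ^+ 2 + y ^+ 2) ^+ 2.

Lemma sqrD_gt0 (x y : R) : 0 < y -> 0 < x ^+ 2 + y ^+ 2.
Proof. by move=> y0; rewrite ltr_wpDl ?sqr_ge0// exprn_gt0. Qed.

Lemma is_derive_sqr (x : R) : is_derive x 1 (fun x : R => x ^+ 2) (2 * x).
Proof.
have := is_deriveX 2 (is_derive_id x (1 : R)).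
rewrite exprfctE => /is_derive_eq; apply.
by rewrite /GRing.scale/= mulr1.
Qed.

Lemma is_derive_quotient (f g : R -> R) (x a b : R) :
  is_derive x 1 f a -> is_derive x 1 g b -> g x != 0 ->
  is_derive x 1 (fun x => f x / g x) ((a * g x - f x * b) / g x ^+ 2).
Proof.
move=> fa gb gx; have := is_deriveM fa (is_deriveV gx gb).
move=> /is_derive_eq; apply; rewrite /GRing.scale/=.
by field.
Qed.

Lemma is_derive_poisson (y x : R) : 0 < y -> is_derive y 1 (poisson^~ x) (poisson1 y x).
Proof.
move=> y0; have p0 := sqrD_gt0 x y0.
have := is_derive_quotient (is_derive_id y (1 : R))
  (is_deriveD (is_derive_cst (x ^+ 2) y (1 : R)) (is_derive_sqr y)) (lt0r_neq0 p0).
move=> /is_derive_eq; apply; rewrite /poisson1 /=.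
have -> : (cst (x ^+ 2) + (fun y : R => y ^+ 2)) y = x ^+ 2 + y ^+ 2 by [].
by congr (_ / _); ring.
Qed.

Lemma is_derive_poisson1 (y x : R) : 0 < y -> is_derive y 1 (poisson1^~ x) (poisson2 y x).
Proof.
move=> y0; have p0 := lt0r_neq0 (sqrD_gt0 x y0).
have d1 := is_deriveB (is_derive_cst (x ^+ 2) y (1 : R)) (is_derive_sqr y).
have d2 := is_deriveX 2 (is_deriveD (is_derive_cst (x ^+ 2) y (1 : R)) (is_derive_sqr y)).
rewrite exprfctE in d2.
have := is_derive_quotient d1 d2 (expf_neq0 2 p0).
move=> /is_derive_eq; apply; rewrite /poisson2 /GRing.scale /=.
have -> : (cst (x ^+ 2) + (fun y : R => y ^+ 2)) y = x ^+ 2 + y ^+ 2 by [].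
have -> : (cst (x ^+ 2) - (fun y : R => y ^+ 2)) y = x ^+ 2 - y ^+ 2 by [].
by field.
Qed.

Lemma is_derive_poisson_x (y x : R) : 0 < y ->
  is_derive x 1 (poisson y) (poissonx y x).
Proof.
move=> y0; have p0 := lt0r_neq0 (sqrD_gt0 x y0).
have := is_derive_quotient (is_derive_cst y x (1 : R))
  (is_deriveD (is_derive_sqr x) (is_derive_cst (y ^+ 2) x (1 : R))) p0.
move=> /is_derive_eq; apply; rewrite /poissonx /=.
have -> : ((fun x : R => x ^+ 2) + cst (y ^+ 2)) x = x ^+ 2 + y ^+ 2 by [].
by congr (_ / _); ring.
Qed.

(* [poisson2] being also the second derivative in y, the Poisson kernel is
   harmonic. *)
Lemma is_derive_poissonx (y x : R) : 0 < y ->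
  is_derive x 1 (poissonx y) (- poisson2 y x).
Proof.
move=> y0; have p0 := lt0r_neq0 (sqrD_gt0 x y0).
have d1 := is_deriveZ (- (2 * y)) (is_derive_id x (1 : R)).
have d2 := is_deriveX 2 (is_deriveD (is_derive_sqr x) (is_derive_cst (y ^+ 2) x (1 : R))).
rewrite exprfctE in d2.
have := is_derive_quotient d1 d2 (expf_neq0 2 p0).
have -> : (fun x : R => (- (2 * y) \*: id) x / ((fun x : R => x ^+ 2) + cst (y ^+ 2)) x ^+ 2)
    = poissonx y.
  by apply/funext => z; rewrite /poissonx /= /GRing.scale/=; congr (_ / _); ring.
move=> /is_derive_eq; apply; rewrite /poisson2 /GRing.scale /=.
have -> : ((fun x : R => x ^+ 2) + cst (y ^+ 2)) x = x ^+ 2 + y ^+ 2 by [].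
by rewrite /GRing.scale/=; field.
Qed.

Lemma continuous_sqrD (y : R) : continuous (fun x : R => x ^+ 2 + y ^+ 2).
Proof. by move=> x; apply: cvgD; [exact: exprn_continuous|exact: cvg_cst]. Qed.

Lemma continuous_derivable (f df : R -> R) :
  (forall x : R, is_derive x 1 f (df x)) -> continuous f.
Proof.
by move=> fd x; apply/differentiable_continuous/derivable1_diffP; have [] := fd x.
Qed.

Lemma continuous_poisson y : 0 < y -> continuous (poisson y).
Proof.
move=> y0; exact: continuous_derivable (fun x => is_derive_poisson_x x y0).
Qed.

Lemma continuous_rational (y : R) (f : R -> R) k : 0 < y -> continuous f ->
  continuous (fun x => f x / (x ^+ 2 + y ^+ 2) ^+ k).
Proof.
move=> y0 cf x; apply: cvgM; first exact: cf.
apply: cvgV; first by rewrite expf_neq0// gt_eqF// sqrD_gt0.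
apply: (cvg_comp (fun x => x ^+ 2 + y ^+ 2) (fun x => x ^+ k)).
  exact: continuous_sqrD.
exact: exprn_continuous.
Qed.

Lemma continuous_poisson1 y : 0 < y -> continuous (poisson1 y).
Proof.
move=> y0; apply: continuous_rational => // x.
by apply: cvgB; [exact: exprn_continuous|exact: cvg_cst].
Qed.

Lemma continuous_poisson2 y : 0 < y -> continuous (poisson2 y).
Proof.
move=> y0; apply: continuous_rational => // x.
apply: cvgM; first exact: cvg_cst.
apply: cvgB; first exact: cvg_cst.
by apply: cvgM; [exact: cvg_cst|exact: exprn_continuous].
Qed.

Lemma poisson_ge0 y x : 0 < y -> 0 <= poisson y x.
Proof. by move=> y0; rewrite divr_ge0// ?ltW// sqrD_gt0. Qed.

(** A primitive is atan (x / y), with limit [pi / 2]; evenness doubles the integral over the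
    half-line. *)
Lemma integral_poisson y : 0 < y -> (\int[leb]_x (poisson y x)%:E = pi%:E)%E.
Proof.
move=> y0; rewrite ge0_symfun_integralT//; last 3 first.
- by move=> x; exact: poisson_ge0.
- exact: continuous_poisson.
- by move=> x; rewrite /poisson /= sqrrN.
have -> : [set x : R | 0 <= x] = `[0, +oo[%classic by rewrite set_itvcy.
have ad (x : R) : is_derive x 1 (fun x : R => atan (y^-1 * x)) (poisson y x).
  have := is_derive1_comp (is_derive1_atan (y^-1 * x))
    (is_deriveZ y^-1 (is_derive_id x (1 : R))).
  move=> /is_derive_eq; apply; rewrite /poisson /GRing.scale/= mulr1.
  have := lt0r_neq0 (sqrD_gt0 x y0); have := lt0r_neq0 y0 => h1 h2.
  have -> : 1 + (y^-1 * x) ^+ 2 = (x ^+ 2 + y ^+ 2) / y ^+ 2 by field.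
  by field; rewrite h1 h2.
rewrite (@ge0_continuous_FTC2y _ _ (fun x => atan (y^-1 * x)) _ (pi / 2)).
- by rewrite mulr0 atan0 sube0 -EFinM mulrC divfK.
- by move=> x _; exact: poisson_ge0.
- by apply: continuous_subspaceT => x; exact: continuous_poisson.
- apply: (cvg_comp (fun x => y^-1 * x) atan); last exact: cvgy_atan.
  by apply: gt0_cvgMry => //; rewrite invr_gt0.
- by move=> x _; have [] := ad x.
- by apply: cvg_at_right_filter; exact: continuous_derivable ad _.
- by move=> x _; rewrite derive1E; have [_ ->] := ad x.
Qed.

Lemma integrable_poisson y : 0 < y -> leb.-integrable setT (EFin \o poisson y).
Proof.
move=> y0; apply/integrableP; split.
  by apply/measurable_EFinP; apply: continuous_measurable_fun; exact: continuous_poisson.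
under eq_integral do rewrite /= ger0_norm ?poisson_ge0//.
by rewrite integral_poisson// ltry.
Qed.

(** [poisson 1] serves as the single integrable majorant for the kernels of all widths and their
    derivatives. *)
Lemma integrable_le_poisson (f : R -> R) (K : R) : continuous f ->
  (forall x, `|f x| <= K * poisson 1 x) -> leb.-integrable setT (EFin \o f).
Proof.
move=> cf fK; apply: (@le_integrable _ _ _ leb _ measurableT _
  (EFin \o (fun x => K * poisson 1 x))).
- by apply/measurable_EFinP; exact: continuous_measurable_fun.
- by move=> x _ /=; rewrite lee_fin; apply: le_trans (fK x) (ler_norm _).
- exact: (integrableZl measurableT K (integrable_poisson ltr01)).
Qed.

End PoissonKernel.

Section PoissonTransform.
Context {R : realType}.
Notation leb := (@lebesgue_measure R).

(** Since 1 <= u^-2 y^2, one has 1 + x^2 <= (1 + u^-2)(x^2 + y^2). Uniformity in [y >= u] is what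
    domination under the integral sign requires. *)
Lemma inv_sqrD_le (u y x : R) : 0 < u -> u <= y ->
  (x ^+ 2 + y ^+ 2)^-1 <= (1 + u ^- 2) * poisson 1 x.
Proof.
move=> u0 uy; have y0 := lt_le_trans u0 uy.
rewrite /poisson expr1n mul1r ler_pdivlMr; last by rewrite ltr_wpDl ?sqr_ge0.
rewrite mulrC ler_pdivrMr ?sqrD_gt0//.
have h : 1 <= u ^- 2 * y ^+ 2.
  by rewrite mulrC ler_pdivlMr ?exprn_gt0// mul1r lerXn2r// nnegrE ltW.
have h2 : 0 <= u ^- 2 * x ^+ 2 by rewrite mulr_ge0// ?sqr_ge0// invr_ge0 sqr_ge0.
have := sqr_ge0 y; move: h h2; rewrite !mulrDl !mulrDr !mul1r; lra.
Qed.

Lemma poisson_le (u y x : R) : 0 < u -> u <= y ->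
  `|poisson y x| <= y * (1 + u ^- 2) * poisson 1 x.
Proof.
move=> u0 uy; have y0 := lt_le_trans u0 uy.
rewrite ger0_norm ?poisson_ge0// /poisson -mulrA; apply: ler_wpM2l; first exact: ltW.
exact: inv_sqrD_le.
Qed.

Lemma poisson1_le (u y x : R) : 0 < u -> u <= y ->
  `|poisson1 y x| <= (1 + u ^- 2) * poisson 1 x.
Proof.
move=> u0 uy; have y0 := lt_le_trans u0 uy; have p0 := sqrD_gt0 x y0.
apply: le_trans (inv_sqrD_le x u0 uy).
rewrite /poisson1 normrM normfV (ger0_norm (exprn_ge0 2 (ltW p0))).
rewrite ler_pdivrMr ?exprn_gt0// expr2 mulrA mulVf ?gt_eqF// mul1r.
apply: le_trans (ler_normB _ _) _.
by rewrite !ger0_norm ?sqr_ge0.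
Qed.

Lemma poisson2_le (u y x : R) : 0 < u -> u <= y ->
  `|poisson2 y x| <= 6 / u * (1 + u ^- 2) * poisson 1 x.
Proof.
move=> u0 uy; have y0 := lt_le_trans u0 uy; have p0 := sqrD_gt0 x y0.
rewrite -mulrA; apply: (@le_trans _ _ (6 / u * (x ^+ 2 + y ^+ 2)^-1)); last first.
  by apply: ler_wpM2l; [rewrite divr_ge0// ltW|exact: inv_sqrD_le].
apply: (@le_trans _ _ (6 / y * (x ^+ 2 + y ^+ 2)^-1)); last first.
  apply: ler_wpM2r; first by rewrite invr_ge0 ltW.
  by apply: ler_wpM2l => //; rewrite lef_pV2.
(* The numerator is at most 6y (x^2 + y^2), because |y^2 - 3x^2| <= 3 (x^2 + y^2); then y^2 <= x^2 +
   y^2 trades one more factor of the denominator for y^2. *)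
rewrite /poisson2 normrM normfV (ger0_norm (exprn_ge0 3 (ltW p0))).
rewrite ler_pdivrMr ?exprn_gt0//.
have -> : 6 / y * (x ^+ 2 + y ^+ 2)^-1 * (x ^+ 2 + y ^+ 2) ^+ 3 =
  2 * y * (3 * (x ^+ 2 + y ^+ 2)) + 6 / y * x ^+ 2 * (x ^+ 2 + y ^+ 2).
  by field; rewrite !gt_eqF.
rewrite normrM (gtr0_norm (mulr_gt0 (ltr0Sn R 1) y0)).
apply: ler_wpDr.
  exact: mulr_ge0 (mulr_ge0 (divr_ge0 _ (ltW y0)) (sqr_ge0 x)) (ltW p0).
apply: ler_wpM2l; first by rewrite mulr_ge0// ltW.
have x2 := sqr_ge0 x; have y2 := sqr_ge0 y.
by rewrite ler_norml; lra.
Qed.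

(** The mean value inequality is applied to sin and then to 1 - cos; a factor 1/2 is given up. *)
Lemma one_sub_cos_le (t : R) : 0 <= t -> 1 - cos t <= t ^+ 2.
Proof.
move=> t0.
have sin_le (x : R) : 0 <= x -> `|sin x| <= x.
  move=> x0; have := @mean_value_pow _ sin cos 1 x 0 x0.
  rewrite expr1 mul1r divr1; apply.
  - exact: sin0.
  - by move=> z _; rewrite expr0 mulr1 ler_norml cos_geN1 cos_le1.
have := @mean_value_pow _ (fun x => 1 - cos x) sin 1 t 1 t0.
rewrite mul1r => H; apply: le_trans (ler_norm _) _; apply: le_trans (H _ _ _) _.
- move=> z; have := is_deriveB (is_derive_cst (1 : R) z (1 : R)) (is_derive_cos z).
  by move=> /is_derive_eq; apply; rewrite sub0r opprK.
- by rewrite cos0 subrr.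
- by move=> z /andP[z0 _]; rewrite mul1r expr1; exact: sin_le.
- by have := sqr_ge0 t; lra.
Qed.

Section Cosine.
Variable s : R.
Hypothesis s0 : 0 < s.

Let cs (x : R) := cos (s * x).

Let csd (x : R) : is_derive x 1 cs (- s * sin (s * x)).
Proof.
have := is_derive1_comp (is_derive_cos (s * x)) (is_deriveZ s (is_derive_id x (1 : R))).
by move=> /is_derive_eq; apply; rewrite /GRing.scale/= mulr1; ring.
Qed.

Let snd (x : R) : is_derive x 1 (fun x => sin (s * x)) (s * cos (s * x)).
Proof.
have := is_derive1_comp (is_derive_sin (s * x)) (is_deriveZ s (is_derive_id x (1 : R))).
by move=> /is_derive_eq; apply; rewrite /GRing.scale/= mulr1; ring.
Qed.

Let ccs : continuous cs. Proof. exact: continuous_derivable csd. Qed.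

Let cs1 x : `|cs x| <= 1. Proof. by rewrite ler_norml cos_geN1 cos_le1. Qed.

Lemma integrable_mul_cos (f : R -> R) (K : R) : continuous f ->
  (forall x, `|f x| <= K * poisson 1 x) ->
  leb.-integrable setT (EFin \o (fun x => f x * cs x)).
Proof.
move=> cf fK; apply: (@integrable_le_poisson _ _ K).
  by move=> x; apply: cvgM; [exact: cf|exact: ccs].
move=> x; apply: le_trans (fK x); rewrite normrM.
by rewrite ler_piMr.
Qed.

(** The frequency [s] is fixed and the width [y] varies: it is the variable of the differential
    equation. *)
Definition poisson_cos y := \int[leb]_x (poisson y x * cs x).
Definition poisson1_cos y := \int[leb]_x (poisson1 y x * cs x).

Let int0 y : 0 < y -> leb.-integrable setT (EFin \o (fun x => poisson y x * cs x)).
Proof.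
move=> y0; apply: (@integrable_mul_cos _ (y * (1 + y ^- 2))).
  exact: continuous_poisson.
by move=> x; apply: poisson_le.
Qed.

Let int1 y : 0 < y -> leb.-integrable setT (EFin \o (fun x => poisson1 y x * cs x)).
Proof.
move=> y0; apply: (@integrable_mul_cos _ (1 + y ^- 2)).
  exact: continuous_poisson1.
by move=> x; apply: poisson1_le.
Qed.

Let int2 y : 0 < y -> leb.-integrable setT (EFin \o (fun x => poisson2 y x * cs x)).
Proof.
move=> y0; apply: (@integrable_mul_cos _ (6 / y * (1 + y ^- 2))).
  exact: continuous_poisson2.
by move=> x; apply: poisson2_le.
Qed.

(** This neighbourhood of [y] stays away from 0, so the kernel bounds hold on it with
    [u = y / 2]. *)
Let half_itv (y : R) : 0 < y -> `](y / 2), (2 * y)[%classic y.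
Proof. by move=> y0; rewrite /= in_itv/=; lra. Qed.

Lemma is_derive_poisson_cos (y : R) : 0 < y ->
  is_derive y 1 poisson_cos (poisson1_cos y).
Proof.
move=> y0; have u0 : 0 < y / 2 by rewrite divr_gt0.
have itvP z : `](y / 2), (2 * y)[%classic z -> y / 2 <= z.
  by rewrite /= in_itv/= => /andP[/ltW].
have itv0 z : `](y / 2), (2 * y)[%classic z -> 0 < z.
  by move=> /itvP; exact: lt_le_trans.
apply: (@is_derive_Rintegral _ _ _ leb (fun y x => poisson y x * cs x)
  (fun y x => poisson1 y x * cs x)
  (fun x => (1 + (y / 2) ^- 2) * poisson 1 x) y (y / 2) (2 * y)).
- exact: half_itv.
- by move=> z /itv0; exact: int0.
- exact: (integrableZl measurableT _ (integrable_poisson ltr01)).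
- move=> z x zI; apply: le_trans (poisson1_le x u0 (itvP z zI)).
  by rewrite normrM ler_piMr.
- move=> z x zI.
  have := is_deriveM (is_derive_poisson x (itv0 z zI)) (is_derive_cst (cs x) z (1 : R)).
  by move=> /is_derive_eq; apply; rewrite /GRing.scale/= mulr0 add0r mulrC.
Qed.

(** Harmonicity replaces the second [y]-derivative of the kernel by minus its second [x]-derivative,
    and two integrations by parts move the latter to the cosine, which yields [s ^+ 2]. *)
Lemma is_derive_poisson1_cos (y : R) : 0 < y ->
  is_derive y 1 poisson1_cos (s ^+ 2 * poisson_cos y).
Proof.
move=> y0; have u0 : 0 < y / 2 by rewrite divr_gt0.
have itvP z : `](y / 2), (2 * y)[%classic z -> y / 2 <= z.
  by rewrite /= in_itv/= => /andP[/ltW].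
have itv0 z : `](y / 2), (2 * y)[%classic z -> 0 < z.
  by move=> /itvP; exact: lt_le_trans.
have d2 : is_derive y 1 poisson1_cos (\int[leb]_x (poisson2 y x * cs x)).
  apply: (@is_derive_Rintegral _ _ _ leb (fun y x => poisson1 y x * cs x)
    (fun y x => poisson2 y x * cs x)
    (fun x => 6 / (y / 2) * (1 + (y / 2) ^- 2) * poisson 1 x) y (y / 2) (2 * y)).
  - exact: half_itv.
  - by move=> z /itv0; exact: int1.
  - exact: (integrableZl measurableT _ (integrable_poisson ltr01)).
  - move=> z x zI; apply: le_trans (poisson2_le x u0 (itvP z zI)).
    by rewrite normrM ler_piMr.
  - move=> z x zI.
    have := is_deriveM (is_derive_poisson1 x (itv0 z zI)) (is_derive_cst (cs x) z (1 : R)).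
    by move=> /is_derive_eq; apply; rewrite /GRing.scale/= mulr0 add0r mulrC.
apply: is_derive_eq d2 _.
(* [G] collects the boundary terms of both integrations by parts; its derivative [g] is the
   difference of the two integrands. *)
pose G (x : R) := - (poissonx y x * cs x + s * (poisson y x * sin (s * x))).
pose g (x : R) := poisson2 y x * cs x - s ^+ 2 * (poisson y x * cs x).
have Gg (x : R) : is_derive x 1 G (g x).
  have := is_deriveN (is_deriveD (is_deriveM (is_derive_poissonx x y0) (csd x))
    (is_deriveZ s (is_deriveM (is_derive_poisson_x x y0) (snd x)))).
  by move=> /is_derive_eq; apply; rewrite /g /cs /GRing.scale/=; ring.
have iZ : leb.-integrable setT (EFin \o (fun x => s ^+ 2 * (poisson y x * cs x))).
  exact: (integrableZl measurableT (s ^+ 2) (int0 y0)).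
have ig : leb.-integrable setT (EFin \o g) by exact: (integrableB measurableT (int2 y0) iZ).
have cg : continuous g.
  move=> x; apply: cvgB.
    by apply: cvgM; [exact: continuous_poisson2|exact: ccs].
  apply: cvgM; first exact: cvg_cst.
  by apply: cvgM; [exact: continuous_poisson|exact: ccs].
(* The two summands come from 2y x^2 <= (2/y)(x^2 + y^2)^2 and y |x| <= x^2 + y^2. *)
have GK x : `|G x| * `|x| <= 2 / y + s.
  have p0 := sqrD_gt0 x y0.
  rewrite /G normrN; apply: (@le_trans _ _ ((`|poissonx y x| + s * `|poisson y x|) * `|x|)).
    apply: ler_wpM2r => //; apply: le_trans (ler_normD _ _) _; apply: lerD.
      by rewrite normrM ler_piMr.
    rewrite normrM (gtr0_norm s0) ler_pM2l// normrM ler_piMr//.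
    by rewrite ler_norml sin_geN1 sin_le1.
  rewrite mulrDl -mulrA; apply: lerD.
    rewrite -normrM /poissonx normrM normrM normfV normrN.
    rewrite (ger0_norm (exprn_ge0 2 (ltW p0))).
    rewrite mulrAC ler_pdivrMr ?exprn_gt0//.
    have -> : `|2 * x * y| * `|x| = 2 * y * x ^+ 2.
      by rewrite !normrM (gtr0_norm y0) -[x ^+ 2]real_normK ?num_real// ger0_norm//; ring.
    have -> : 2 / y * (x ^+ 2 + y ^+ 2) ^+ 2 =
        2 * y * x ^+ 2 + (2 / y * (x ^+ 2) ^+ 2 + 2 * y * x ^+ 2 + 2 * y ^+ 3).
      by field; rewrite gt_eqF.
    have y1 := ltW y0; rewrite lerDl !addr_ge0//; apply: mulr_ge0;
      by rewrite ?sqr_ge0 ?exprn_ge0// ?divr_ge0// ?mulr_ge0.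
  rewrite -[leRHS]mulr1 ler_pM2l// ger0_norm ?poisson_ge0// /poisson.
  rewrite mulrAC ler_pdivrMr// mul1r.
  have := sqr_ge0 (y - `|x|); rewrite sqrrB real_normK ?num_real//.
  by have := sqr_ge0 x; have := sqr_ge0 y; lra.
have := Rintegral_derivative0 Gg cg ig GK.
rewrite /g RintegralB//; [|exact: int2].
rewrite RintegralZl//; last exact: int0.
by move=> /eqP; rewrite subr_eq0 => /eqP.
Qed.

(** This determines the constant left open by the differential equation. The bounds 2 and s^2 x^2
    for 1 - cos give (1 - cos)(x^2 + 1) <= (s^2 + 2) x^2, and x^2 is absorbed by the denominator x^2
    + y^2 of the kernel. *)
Lemma poisson_cos_near0 (y : R) : 0 < y ->
  `|pi - poisson_cos y| <= y * (s ^+ 2 + 2) * pi.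
Proof.
move=> y0.
have ip := integrable_poisson y0.
have piE (z : R) : 0 < z -> pi = \int[leb]_x poisson z x.
  by move=> z0; rewrite /Rintegral integral_poisson.
rewrite {1}(piE y y0) -RintegralB//; last exact: int0.
have iB : leb.-integrable setT (EFin \o (fun x => poisson y x - poisson y x * cs x)).
  exact: (integrableB measurableT ip (int0 y0)).
apply: le_trans (le_normr_Rintegral measurableT iB) _.
rewrite (piE 1 ltr01) -RintegralZl//; last exact: integrable_poisson.
apply: le_Rintegral => //.
- exact: integrable_norm.
- exact: (integrableZl measurableT _ (integrable_poisson ltr01)).
move=> x _; have p0 := sqrD_gt0 x y0.
have c0 : 0 <= 1 - cs x by rewrite subr_ge0 cos_le1.
have c2 : 1 - cs x <= 2 by have := cs1 x; rewrite ler_norml; lra.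
have cx : 1 - cs x <= s ^+ 2 * x ^+ 2.
  rewrite /cs -exprMn -[(s * x) ^+ 2]real_normK ?num_real//.
  have [x0|x0] := ger0P (s * x); first exact: one_sub_cos_le.
  by rewrite -cosN; apply: one_sub_cos_le; rewrite oppr_ge0 ltW.
rewrite -{1}[poisson y x]mulr1 -mulrBr normrM !ger0_norm ?poisson_ge0//.
rewrite /poisson expr1n -!mulrA; apply: ler_wpM2l; first exact: ltW.
rewrite mul1r ler_pdivlMr; last by rewrite ltr_wpDl ?sqr_ge0.
rewrite [_^-1 * _]mulrC mulrAC ler_pdivrMr//.
have : (1 - cs x) * (x ^+ 2 + 1) <= (s ^+ 2 + 2) * x ^+ 2.
  have := ler_wpM2r (sqr_ge0 x) c2; move: cx.
  by rewrite mulrDr mulr1 [(s ^+ 2 + 2) * _]mulrDl; lra.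
move=> /le_trans; apply; apply: ler_wpM2l; first by rewrite addr_ge0 ?sqr_ge0.
by rewrite lerDl sqr_ge0.
Qed.

Lemma poisson_cosE (y : R) : 0 < y -> poisson_cos y = pi * expR (- (s * y)).
Proof.
have JM z : 0 < z -> `|poisson_cos z| <= pi.
  move=> z0; apply: le_trans (le_normr_Rintegral measurableT (int0 z0)) _.
  have -> : pi = \int[leb]_x poisson z x by rewrite /Rintegral integral_poisson.
  apply: le_Rintegral => //.
  - exact: (integrable_norm (int0 z0)).
  - exact: integrable_poisson.
  - by move=> x _; rewrite normrM ger0_norm ?poisson_ge0// ler_piMr ?poisson_ge0.
have [c cE] := bounded_ode_solution s0 is_derive_poisson_cos is_derive_poisson1_cos JM.
suff -> : pi = c by exact: cE.
apply/eqP; rewrite -subr_eq0 -normr_eq0; apply/eqP/le_anti; rewrite normr_ge0 andbT.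
apply/ler_addgt0Pl => e e0; rewrite addr0.
(* [K] adds the rates at which [poisson_cos z] tends to [pi] and [c * expR (- (s * z))] to [c] as
   [z] tends to 0; the summand 1 makes it positive. *)
pose K : R := (s ^+ 2 + 2) * pi + `|c| * s + 1.
have K0 : 0 < K.
  have h1 := mulr_ge0 (addr_ge0 (sqr_ge0 s) (ler0n R 2)) (pi_ge0 R).
  have h2 := mulr_ge0 (normr_ge0 c) (ltW s0).
  by rewrite /K ltr_wpDl// addr_ge0.
pose z := e / K; have z0 : 0 < z by rewrite divr_gt0.
have -> : pi - c = (pi - poisson_cos z) - c * (1 - expR (- (s * z))).
  by rewrite cE//; ring.
apply: le_trans (ler_normB _ _) _.
have e1 : `|c * (1 - expR (- (s * z)))| <= `|c| * s * z.
  rewrite normrM -mulrA ler_wpM2l// ger0_norm.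
    by rewrite lerBlDr addrC -lerBlDr; exact: expR_ge1Dx.
  by rewrite subr_ge0 -expR0 ler_expR oppr_le0 mulr_ge0 ?(ltW s0) ?(ltW z0).
apply: le_trans (lerD (poisson_cos_near0 z0) e1) _.
have -> : e = K * z by rewrite /z mulrC divfK// gt_eqF.
rewrite -subr_ge0; have -> : K * z - (z * (s ^+ 2 + 2) * pi + `|c| * s * z) = z.
  by rewrite /K; ring.
exact: ltW.
Qed.

End Cosine.

End PoissonTransform.

(** * Local solutions of the Schrodinger equation *)

Section LocalSolutions.
Context {R : realType} {d : nat}.
Implicit Types (n : lattice d) (a : seq (lattice d * R)) (V : lattice d -> R).

Local Notation C := (size (@unit_vectors d))%:R.

(** A list may repeat a site, whose weights then add up; a new weight is thus prefixed without
    searching for the site. *)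
Definition phase a V : R := \sum_(p <- a) p.2 * V p.1.

Definition weight a : R := \sum_(p <- a) p.2.

(* u solves u' = -i (Delta + V) u, u(0) = e_0, at the sites of norm < r. *)
Record local_solution V (r : nat) (u : R -> lattice d -> R[i]) : Prop :=
  LocalSolution {
    ls_bound : forall s n, Normc.normc (u s n) <= 1 ;
    ls_init : forall n, u 0 n = (n == 0)%:R ;
    ls_derive : forall (s : R) n, l1norm n < r%:Z -> cderive (u ^~ n) s
      (- 'i%C * (\sum_(e <- unit_vectors) u s (n + e) + (V n)%:C * u s n)) }.

Definition weighted V (u : R -> lattice d -> R[i]) s a n : R[i] :=
  cexpi (- phase a V) * u s n.

Lemma weighted_bound V r u : local_solution V r u ->
  forall s a n, cle (weighted V u s a n) 1.
Proof. by move=> [ub _ _] s a n; apply: cle_cexpiM. Qed.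

Lemma weighted_pad V u s a n : weighted V u s ((n, 0) :: a) n = weighted V u s a n.
Proof. by rewrite /weighted /phase big_cons mul0r add0r. Qed.

(** The decreasing weight contributes i V_n to the logarithmic derivative of the phase factor, which
    cancels the potential term of the equation; the neighbours inherit the same phase. *)
Lemma weighted_derive V r u : local_solution V r u ->
  forall (s t : R) a n, l1norm n < r%:Z ->
  cderive (fun x : R => weighted V u x ((n, t - x) :: a) n) s
    (- 'i%C * \sum_(e <- unit_vectors) weighted V u s ((n, t - s) :: a) (n + e)).
Proof.
move=> [_ _ ud] s t a n nr.
have phE (x : R) : - phase ((n, t - x) :: a) V = V n * x - (t * V n + phase a V).
  by rewrite /phase big_cons/=; ring.
rewrite /weighted.
have phd : is_derive s 1 (fun x : R => - phase ((n, t - x) :: a) V) (V n).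
  under eq_fun do rewrite phE.
  have := is_deriveB (is_deriveZ (V n) (is_derive_id s (1 : R)))
    (is_derive_cst (t * V n + phase a V) s (1 : R)).
  by move=> /is_derive_eq; apply; rewrite /GRing.scale/= mulr1 subr0.
have := cderiveM (cderive_cexpi phd) (ud s n nr).
move=> /cderive_eq; apply.
by rewrite -mulr_sumr; ring.
Qed.

(** A quantitative uniqueness statement: the difference vanishes at time 0, and each solution
    contributes 1 to the constant 2. *)
Lemma local_solution_comparison V r u1 u2 (t : R) :
  local_solution V r u1 -> local_solution V r u2 -> 0 <= t ->
  cle (u1 t 0 - u2 t 0) (2 * (C * t) ^+ r / r`!%:R).
Proof.
move=> h1 h2 t0.
pose Phi s a n := weighted V u1 s a n - weighted V u2 s a n.
have -> : u1 t 0 - u2 t 0 = Phi t [::] 0.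
  by rewrite /Phi /weighted /phase big_nil oppr0 cexpi0 !mul1r.
apply: (@hopping_bound _ _ Phi 2 r _ _ _ _ r 0) => //.
- move=> s a n _ _; rewrite -[2]/(1 + 1).
  apply: cleD; first exact: weighted_bound h1 _ _ _.
  by apply: cleN; exact: weighted_bound h2 _ _ _.
- by move=> a n _; rewrite /Phi /weighted (ls_init h1) (ls_init h2) subrr.
- by move=> s a n; rewrite /Phi !weighted_pad.
- move=> s s' a n nr.
  have := cderiveD (weighted_derive h1 s s' a nr)
    (cderiveN (weighted_derive h2 s s' a nr)).
  move=> /cderive_eq; apply.
  by rewrite -mulrN -mulrDr raddf_sum -big_split/=.
- by rewrite l1norm0 add0r.
Qed.

End LocalSolutions.

(** * Comparison of expectations for two random potentials *)

Section MeanComparison.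
Context {R : realType} {d : nat}.
Local Notation C := (size (@unit_vectors d))%:R.
Context {d1 d2 : measure_display} {T1 : measurableType d1} {T2 : measurableType d2}.
Variables (P1 : probability T1 R) (P2 : probability T2 R).

Section OneSpace.
Context {dT : measure_display} {T : measurableType dT}.
Variables (P : probability T R) (V : T -> lattice d -> R) (r : nat).
Variable (u : T -> R -> lattice d -> R[i]).
Hypothesis mV : forall n, measurable_fun setT (fun w => V w n).
Hypothesis mu : forall s n, cmeasurable (fun w => u w s n).
Hypothesis us : forall w, local_solution (V w) r (u w).

Definition mean_weighted s a n := cintegral P (fun w => weighted (V w) (u w) s a n).

Lemma cmeasurable_phase a : cmeasurable (fun w => cexpi (- phase a (V w))).
Proof.
apply: cmeasurable_cexpi; apply: measurableT_comp => //.
rewrite /phase; apply: measurable_sum => p.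
by apply: measurable_funM.
Qed.

Lemma cmeasurable_weighted s a n :
  cmeasurable (fun w => weighted (V w) (u w) s a n).
Proof. by apply: cmeasurableM => //; exact: cmeasurable_phase. Qed.

Lemma mean_weighted_bound s a n : cle (mean_weighted s a n) 1.
Proof.
apply: cle_cintegral; first exact: cmeasurable_weighted.
by move=> w; exact: weighted_bound (us w) s a n.
Qed.

Lemma mean_weighted_init a n : mean_weighted 0 a n =
  cintegral P (fun w => cexpi (- phase a (V w))) * (n == 0)%:R.
Proof.
rewrite mulrC.
rewrite -(cintegralZ P _ (cmeasurable_phase a) (fun w => cle_cexpi (- phase a (V w)))).
by apply: eq_cintegral => w; rewrite /weighted (ls_init (us w)) mulrC.
Qed.

(** Once the potential has cancelled, the derivative is bounded uniformly in [w], so it can be taken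
    under the expectation without any moment of [V]. *)
Lemma mean_weighted_derive (s t : R) a n : l1norm n < r%:Z ->
  cderive (fun x : R => mean_weighted x ((n, t - x) :: a) n) s
    (- 'i%C * \sum_(e <- unit_vectors) mean_weighted s ((n, t - s) :: a) (n + e)).
Proof.
move=> nr; rewrite /mean_weighted.
rewrite -(@cintegral_sum _ _ _ P _ _ _ 1); last 2 first.
- by move=> e; exact: cmeasurable_weighted.
- by move=> e w; exact: weighted_bound (us w) _ _ _.
have ms : cmeasurable (fun w => \sum_(e <- unit_vectors)
    weighted (V w) (u w) s ((n, t - s) :: a) (n + e)).
  by apply: cmeasurable_sum => e; exact: cmeasurable_weighted.
have bs (x : R) w : cle (\sum_(e <- unit_vectors)
    weighted (V w) (u w) x ((n, t - x) :: a) (n + e)) (C * 1).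
  by apply: cle_sum => e _; exact: weighted_bound (us w) _ _ _.
rewrite -(cintegralZ P _ ms (bs s)).
apply: (@cderive_cintegral _ _ _ P
  (fun x w => weighted (V w) (u w) x ((n, t - x) :: a) n)
  (fun x w => - 'i%C * \sum_(e <- unit_vectors)
    weighted (V w) (u w) x ((n, t - x) :: a) (n + e)) 1 (2 * (1 * (C * 1)))).
- by move=> x; exact: cmeasurable_weighted.
- by move=> x w; exact: weighted_bound (us w) _ _ _.
- move=> x w; apply: cleM => //; apply: cleN.
  by rewrite /cle/= normr0 normr1; split=> //; exact: ler01.
- by move=> x w; exact: weighted_derive (us w) _ _ _ _ nr.
Qed.

End OneSpace.

Variables (V1 : T1 -> lattice d -> R) (V2 : T2 -> lattice d -> R) (r : nat).
Variables (u1 : T1 -> R -> lattice d -> R[i]) (u2 : T2 -> R -> lattice d -> R[i]).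
Hypothesis mV1 : forall n, measurable_fun setT (fun w => V1 w n).
Hypothesis mu1 : forall s n, cmeasurable (fun w => u1 w s n).
Hypothesis us1 : forall w, local_solution (V1 w) r (u1 w).
Hypothesis mV2 : forall n, measurable_fun setT (fun w => V2 w n).
Hypothesis mu2 : forall s n, cmeasurable (fun w => u2 w s n).
Hypothesis us2 : forall w, local_solution (V2 w) r (u2 w).

(* The total weight [s + weight a] of [(s, a)] is preserved by the hopping
   equation, hence so is the ratio e^{-lambda (s + weight a)} of the means. *)
Lemma mean_comparison (lambda t : R) : 0 <= lambda -> 0 <= t ->
  (forall a, nonneg_weights a -> cintegral P1 (fun w => cexpi (- phase a (V1 w))) =
    (expR (- (lambda * weight a)))%:C *
    cintegral P2 (fun w => cexpi (- phase a (V2 w)))) ->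
  cle (cintegral P1 (fun w => u1 w t 0) -
       (expR (- (lambda * t)))%:C * cintegral P2 (fun w => u2 w t 0))
    (2 * (C * t) ^+ r / r`!%:R).
Proof.
move=> l0 t0 E12.
pose Phi s a n := mean_weighted P1 V1 u1 s a n -
  (expR (- (lambda * (s + weight a))))%:C * mean_weighted P2 V2 u2 s a n.
have -> : cintegral P1 (fun w => u1 w t 0) -
    (expR (- (lambda * t)))%:C * cintegral P2 (fun w => u2 w t 0) = Phi t [::] 0.
  rewrite /Phi /mean_weighted /weight big_nil addr0; congr (_ - _ * _);
  by apply: eq_cintegral => w; rewrite /weighted /phase big_nil oppr0 cexpi0 mul1r.
have weight_cons n (x : R) a : weight ((n, x) :: a) = x + weight a.
  by rewrite /weight big_cons.
apply: (@hopping_bound _ _ Phi 2 r _ _ _ _ r 0) => //.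
- move=> s a n s0 a0; rewrite -[2]/(1 + 1).
  apply: cleD; [|apply: cleN]; first exact: mean_weighted_bound.
  have [h1 h2] := mean_weighted_bound P2 mV2 mu2 us2 s a n.
  have wa : 0 <= weight a.
    by rewrite /weight big_seq; apply: sumr_ge0 => p /(allP a0).
  (* Nonnegative weights keep this factor at most 1, whence the bound 2 for [Phi]. *)
  have e1 : expR (- (lambda * (s + weight a))) <= 1.
    by rewrite -expR0 ler_expR oppr_le0 mulr_ge0// addr_ge0.
  rewrite /cle cReM cImM /= !mul0r subr0 addr0 !normrM (ger0_norm (expR_ge0 _)).
  by split; apply: mulr_ile1 => //; exact: expR_ge0.
- move=> a n a0; rewrite /Phi (mean_weighted_init P1 mV1 us1).
  by rewrite (mean_weighted_init P2 mV2 us2) E12// add0r mulrA subrr.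
- move=> s a n; rewrite /Phi weight_cons add0r /mean_weighted; congr (_ - _ * _);
  by apply: eq_cintegral => w; rewrite weighted_pad.
- move=> s s' a n nr.
  pose c : R[i] := (expR (- (lambda * (s' + weight a))))%:C.
  have D1 := mean_weighted_derive P1 mV1 mu1 us1 s s' a nr.
  have D2 := mean_weighted_derive P2 mV2 mu2 us2 s s' a nr.
  have := cderiveD D1 (cderiveN (cderiveM (cderive_cst c s) D2)).
  have wE (x : R) : x + weight ((n, s' - x) :: a) = s' + weight a.
    by rewrite weight_cons; ring.
  have -> : (fun x : R => Phi x ((n, s' - x) :: a) n) =
      (fun x => mean_weighted P1 V1 u1 x ((n, s' - x) :: a) n -
        c * mean_weighted P2 V2 u2 x ((n, s' - x) :: a) n).
    by apply/funext => x; rewrite /Phi wE.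
  move=> /cderive_eq; apply.
  rewrite mul0r add0r mulrCA -mulrN -mulrDr mulr_sumr raddf_sum -big_split/=.
  by under [in RHS]eq_bigr do rewrite /Phi wE.
- by rewrite l1norm0 add0r.
Qed.

End MeanComparison.

(** * Characters of independent families *)

Section Independence.
Context {R : realType} {dT : measure_display} {T : measurableType dT}.
Variable P : probability T R.

Lemma cmeasurable_comp (f : R -> R[i]) (Y : T -> R) : cmeasurable f ->
  measurable_fun setT Y -> cmeasurable (fun w => f (Y w)).
Proof.
by move=> [f1 f2] mY; split; [exact: (measurableT_comp f1 mY)|exact: (measurableT_comp f2 mY)].
Qed.

Lemma cmeasurable_indic (B : set R) : measurable B ->
  cmeasurable (fun x : R => (\1_B x)%:C : R[i]).
Proof.
by move=> mB; split => /=; [exact: measurable_indic|exact: measurable_cst].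
Qed.

Lemma normc_indic (B : set R) (x : R) : Normc.normc ((\1_B x)%:C : R[i]) <= 1.
Proof.
rewrite /= expr0n/= addr0 sqrtr_sqr indicE; case: (_ \in _);
  by rewrite ?normr1 ?normr0.
Qed.

Section Factorization.
Variables (G : T -> R[i]) (Y : T -> R).
Hypothesis mG : cmeasurable G.
Hypothesis G1 : forall w, Normc.normc (G w) <= 1.
Hypothesis mY : measurable_fun setT Y.
Hypothesis GY : forall B : set R, measurable B ->
  cintegral P (fun w => G w * (\1_B (Y w))%:C) =
  cintegral P G * cintegral P (fun w => (\1_B (Y w))%:C).

Let cG1 w : cle (G w) 1. Proof. exact: cle_normc. Qed.

(* g is approximated within 1/N by a combination of the indicators of the sets
   where k <= N (g + 1) < k + 1. *)
Lemma factorization_real (g : R -> R) : measurable_fun setT g ->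
  (forall x, `|g x| <= 1) ->
  cintegral P (fun w => G w * (g (Y w))%:C) =
  cintegral P G * cintegral P (fun w => (g (Y w))%:C).
Proof.
move=> mg g1; apply/eqP; rewrite -subr_eq0; apply/eqP/cle_eq0 => e e0.
(* The final error is [4 / N.+1], from two terms that each carry the factor 2 of [cleM]; 8 leaves a
   margin. *)
have [N] : exists N : nat, 8 / e < N.+1%:R.
  exists (Num.truncn (8 / e)); exact: truncnS_gt.
rewrite ltr_pdivrMr// mulrC -ltr_pdivrMr// => Ne.
set K := N.+1%:R in Ne; have K0 : 0 < K by rewrite /K ltr0n.
pose B (k : nat) : set R := [set x | k%:R <= K * (g x + 1) < k.+1%:R].
have mB k : measurable (B k).
  rewrite (_ : B k = (fun x => K * (g x + 1)) @^-1` `[k%:R, k.+1%:R[%classic); last first.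
    by apply/seteqP; split => x; rewrite /B/= in_itv.
  rewrite -[X in measurable X]setTI.
  have mK : measurable_fun setT (fun x => K * (g x + 1)).
    by apply: measurable_funM => //; exact: measurable_funD.
  exact: mK.
pose c (k : nat) : R[i] := (k%:R / K - 1)%:C.
(* [K * (g x + 1)] ranges over [0, 2K] with the right end included, hence 2(N + 1) + 1 levels. *)
pose gN (x : R) : R[i] := \sum_(k < N.+1.*2.+1) c k * (\1_(B k) x)%:C.
have gNE x : gN x = ((Num.truncn (K * (g x + 1)))%:R / K - 1)%:C.
  have gx0 : 0 <= K * (g x + 1).
    by rewrite mulr_ge0// ?(ltW K0)//; have := g1 x; rewrite ler_norml; lra.
  have hk : (Num.truncn (K * (g x + 1)) < N.+1.*2.+1)%N.
    rewrite ltnS -(ler_nat R).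
    have /andP[t1 _] := truncn_itv gx0; apply: le_trans t1 _.
    rewrite -muln2 natrM; apply: ler_wpM2l; first exact: ltW.
    by have := g1 x; rewrite ler_norml; lra.
  rewrite /gN (bigD1 (Ordinal hk))//= big1 => [|k kn].
    rewrite addr0 indicE mem_set ?mulr1//.
    rewrite /B/=; exact: truncn_itv.
  rewrite indicE memNset ?mulr0//.
  rewrite /B/= => /andP[k1 k2]; move/negP: kn; apply.
  apply/eqP/val_inj => /=; apply/esym/truncn_def.
  by rewrite k1 k2.
have gNd x : cle (gN x - (g x)%:C) (K^-1).
  have gx0 : 0 <= K * (g x + 1).
    by rewrite mulr_ge0// ?(ltW K0)//; have := g1 x; rewrite ler_norml; lra.
  rewrite gNE /cle/= oppr0 addr0 normr0 invr_ge0 (ltW K0); split => //.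
  have /andP[t1 t2] := truncn_itv gx0.
  set h := (Num.truncn _)%:R in t1 *.
  have -> : h / K - 1 - g x = (h - K * (g x + 1)) / K by field; rewrite gt_eqF.
  rewrite normrM normfV (gtr0_norm K0) -[leRHS]mul1r ler_wpM2r ?invr_ge0 ?(ltW K0)//.
  move: t2; rewrite -natr1 -/h => t2.
  by rewrite ler_norml; lra.
have mgN : cmeasurable gN.
  apply: cmeasurable_sum => k; apply: cmeasurableM; first exact: cmeasurable_cst.
  exact: cmeasurable_indic.
have mgC : cmeasurable (fun x => (g x)%:C : R[i]).
  by split => //=; exact: measurable_cst.
have mdN : cmeasurable (fun x => gN x - (g x)%:C).
  apply: cmeasurableD => //.
  under eq_fun do rewrite -mulN1r.
  by apply: cmeasurableM => //; exact: cmeasurable_cst.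
have ce k : cle (c k) (k%:R / K + 1).
  rewrite /cle/= normr0; split; last by rewrite addr_ge0// divr_ge0// ltW.
  apply: le_trans (ler_normB _ _) _; rewrite normr1 ger0_norm// divr_ge0//.
have ci k x : cle ((\1_(B k) x)%:C : R[i]) 1 by apply: cle_normc; exact: normc_indic.
have miY k : cmeasurable (fun w => (\1_(B k) (Y w))%:C : R[i]).
  exact: (cmeasurable_comp (cmeasurable_indic (mB k)) mY).
pose M : R := 2 * ((N.+1.*2.+1%:R / K + 1) * (2 * (1 * 1))).
have hgN : cintegral P (fun w => G w * gN (Y w)) =
    cintegral P G * cintegral P (fun w => gN (Y w)).
  have ck (k : 'I_N.+1.*2.+1) : cle (c k) (N.+1.*2.+1%:R / K + 1).
    apply: cle_trans (ce k) _; rewrite lerD2r ler_wpM2r ?invr_ge0 ?(ltW K0)//.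
    by rewrite ler_nat ltnW.
  transitivity (cintegral P (fun w => \sum_(k < N.+1.*2.+1)
      c k * (G w * (\1_(B k) (Y w))%:C))).
    apply: eq_cintegral => w; rewrite /gN mulr_sumr.
    by apply: eq_bigr => k _; rewrite mulrCA.
  rewrite (@cintegral_sum _ _ _ _ _ _ _ M); last 2 first.
  - move=> k; apply: cmeasurableM; first exact: cmeasurable_cst.
    exact: cmeasurableM.
  - move=> k w; apply: cleM => //; exact: cleM.
  rewrite (@cintegral_sum _ _ _ _ _ _ _ (2 * ((N.+1.*2.+1%:R / K + 1) * 1))); last 2 first.
  - move=> k; apply: cmeasurableM; first exact: cmeasurable_cst.
    exact: miY.
  - by move=> k w; exact: cleM.
  rewrite mulr_sumr; apply: eq_bigr => k _.
  rewrite (@cintegralZ _ _ _ P _ _ (2 * (1 * 1))); last 2 first.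
  - exact: cmeasurableM.
  - by move=> w; exact: cleM.
  rewrite GY// mulrCA; congr (_ * _).
  by rewrite (@cintegralZ _ _ _ P _ _ 1).
have mdY : cmeasurable (fun w => gN (Y w) - (g (Y w))%:C).
  exact: (cmeasurable_comp mdN mY).
have gC1 x : cle ((g x)%:C : R[i]) 1.
  by rewrite /cle/= normr0 ler01.
have mgY : cmeasurable (fun w => (g (Y w))%:C : R[i]).
  exact: (cmeasurable_comp mgC mY).
have split1 : cintegral P (fun w => G w * gN (Y w)) =
    cintegral P (fun w => G w * (gN (Y w) - (g (Y w))%:C)) +
    cintegral P (fun w => G w * (g (Y w))%:C).
  rewrite -(@cintegralD _ _ _ _ _ _ (2 * (1 * K^-1)) (2 * (1 * 1))).
  - by apply: eq_cintegral => w; rewrite -mulrDr subrK.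
  - exact: cmeasurableM.
  - exact: cmeasurableM.
  - by move=> w; exact: cleM.
  - by move=> w; exact: cleM.
have split2 : cintegral P (fun w => gN (Y w)) =
    cintegral P (fun w => gN (Y w) - (g (Y w))%:C) +
    cintegral P (fun w => (g (Y w))%:C).
  rewrite -(@cintegralD _ _ _ _ _ _ (K^-1) 1)//.
  by apply: eq_cintegral => w; rewrite subrK.
(* By [hgN] the approximants cancel, and only the two error integrals remain. *)
have -> : cintegral P (fun w => G w * (g (Y w))%:C) -
    cintegral P G * cintegral P (fun w => (g (Y w))%:C) =
    cintegral P G * cintegral P (fun w => gN (Y w) - (g (Y w))%:C) -
    cintegral P (fun w => G w * (gN (Y w) - (g (Y w))%:C)).
  by move: hgN; rewrite split1 split2 mulrDr => /eqP; rewrite addrC eq_sym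
    addrC -subr_eq => /eqP <-; ring.
apply: cle_trans (cleD (cleM (b := K^-1) (a := 1) _ _) (cleN (c := 2 * (1 * K^-1)) _)) _.
- exact: cle_cintegral.
- exact: cle_cintegral.
- by apply: cle_cintegral; [exact: cmeasurableM|move=> w; exact: cleM].
- move: Ne; have : 0 <= K^-1 by rewrite invr_ge0 ltW.
  by rewrite !mul1r; move: K^-1 => y; lra.
Qed.

(** By linearity this is the real case for the two components. *)
Lemma factorization (f : R -> R[i]) : cmeasurable f ->
  (forall x, Normc.normc (f x) <= 1) ->
  cintegral P (fun w => G w * f (Y w)) =
  cintegral P G * cintegral P (fun w => f (Y w)).
Proof.
move=> [f1 f2] fn.
have fc x := cle_normc (fn x).
have mc (g : R -> R) : measurable_fun setT g ->
    cmeasurable (fun w => (g (Y w))%:C : R[i]).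
  by move=> mg; split => /=; [exact: (measurableT_comp mg mY)|exact: measurable_cst].
have e1 := factorization_real f1 (fun x => (fc x).1).
have e2 := factorization_real f2 (fun x => (fc x).2).
have m1 := mc _ f1; have m2 := mc _ f2.
have cC (x : R) : `|x| <= 1 -> cle (x%:C) 1.
  by rewrite /cle/= normr0 ler01.
have c1 x : cle ((complex.Re (f x))%:C : R[i]) 1 by apply/cC/(fc x).1.
have c2 x : cle ((complex.Im (f x))%:C : R[i]) 1 by apply/cC/(fc x).2.
have ci : cle ('i%C : R[i]) 1 by rewrite /cle/= normr0 normr1 ler01.
have fE x : f x = (complex.Re (f x))%:C + 'i%C * (complex.Im (f x))%:C.
  exact: complexE.
transitivity (cintegral P (fun w => G w * (complex.Re (f (Y w)))%:C +
    'i%C * (G w * (complex.Im (f (Y w)))%:C))).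
  by apply: eq_cintegral => w; rewrite [in LHS]fE; ring.
have -> : cintegral P (fun w => f (Y w)) =
    cintegral P (fun w => (complex.Re (f (Y w)))%:C + 'i%C * (complex.Im (f (Y w)))%:C).
  by apply: eq_cintegral => w; rewrite -fE.
rewrite [LHS](@cintegralD _ _ _ _ _ _ (2 * (1 * 1)) (2 * (1 * (2 * (1 * 1))))); last 4 first.
- exact: cmeasurableM.
- apply: cmeasurableM; first exact: cmeasurable_cst.
  exact: cmeasurableM.
- by move=> w; exact: cleM.
- by move=> w; apply: cleM => //; exact: cleM.
rewrite (@cintegralD _ _ _ _ _ _ 1 (2 * (1 * 1))); last 4 first.
- by [].
- by apply: cmeasurableM => //; exact: cmeasurable_cst.
- by move=> w.
- by move=> w; exact: cleM.
rewrite [in LHS](@cintegralZ _ _ _ _ _ _ (2 * (1 * 1))); last 2 first.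
- exact: cmeasurableM.
- by move=> w; exact: cleM.
rewrite (@cintegralZ _ _ _ _ _ _ 1); last 2 first.
- by [].
- by move=> w.
by rewrite e1 e2; ring.
Qed.

End Factorization.

Lemma cintegral_indic (A : set T) : measurable A ->
  cintegral P (fun w => (\1_A w)%:C) = (fine (P A))%:C.
Proof.
move=> mA; apply: complex_parts => /=; last exact: Rintegral_constant.
by rewrite /Rintegral integral_indic// setIT.
Qed.

Variables (I : choiceType) (X : I -> {RV P >-> R}).
Hypothesis indX : forall (J : {fset I}) (B : I -> set R),
  (forall i, i \in J -> measurable (B i)) ->
  P (\bigcap_(i in [set` J]) (X i @^-1` B i)) =
  (\prod_(i <- J) P (X i @^-1` B i))%E.

Let mX (i : I) : measurable_fun setT (X i). Proof. exact: measurable_funPT. Qed.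

Let mXB (i : I) (B : set R) : measurable B -> measurable (X i @^-1` B).
Proof. by move=> mB; rewrite -[X in measurable X]setTI; exact: mX. Qed.

Lemma normc_prod (J : Type) (s : seq J) (F : J -> R[i]) :
  (forall j, Normc.normc (F j) <= 1) -> Normc.normc (\prod_(j <- s) F j) <= 1.
Proof.
move=> F1; elim: s => [|j s IH]; first by rewrite big_nil Normc.normc1.
rewrite big_cons Normc.normcM mulr_ile1 ?normc_ge0//.
Qed.

Lemma cmeasurable_prod (J : Type) (s : seq J) (F : J -> T -> R[i]) :
  (forall j, cmeasurable (F j)) -> cmeasurable (fun w => \prod_(j <- s) F j w).
Proof.
move=> H; elim: s => [|i r IH].
  by under eq_fun do rewrite big_nil; exact: cmeasurable_cst.
by under eq_fun do rewrite big_cons; exact: cmeasurableM.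
Qed.

(** The product of indicators is the indicator of the finite intersection that occurs in the
    definition of independence. *)
Lemma independent_indic (s : seq I) (B : I -> set R) : uniq s ->
  (forall i, measurable (B i)) ->
  cintegral P (fun w => \prod_(i <- s) (\1_(B i) (X i w))%:C) =
  \prod_(i <- s) cintegral P (fun w => (\1_(B i) (X i w))%:C).
Proof.
move=> us mB; pose J := [fset i in s]%fset.
pose A := \bigcap_(i in [set` J]) (X i @^-1` B i).
have mA : measurable A.
  apply: fin_bigcap_measurable; first exact: finite_fset.
  by move=> i _; exact: mXB.
have sJ (F : I -> R[i]) : \prod_(i <- s) F i = \prod_(i <- J) F i.
  by apply: perm_big; apply: uniq_perm => // i; rewrite !inE.
transitivity (cintegral P (fun w => (\1_A w)%:C)).
  apply: eq_cintegral => w; rewrite indicE.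
  have [wA|wA] := boolP (w \in A).
    rewrite big_seq big1// => i iS; rewrite indicE mem_set//.
    by move: wA; rewrite inE => /(_ i); apply; rewrite /= !inE.
  have [[i iS nB]|H] := pselect (exists2 i, i \in s & ~ B i (X i w)); last first.
    exfalso; move/negP: wA; apply; rewrite inE => i /=; rewrite !inE => iS.
    by apply: contrapT => nB; apply: H; exists i.
  rewrite (big_rem i)//= indicE memNset//.
  by rewrite mul0r.
rewrite cintegral_indic// /A indX; last by move=> i _.
rewrite sJ; elim: (enum_fset J) => [|i l IH]; first by rewrite !big_nil.
rewrite !big_cons fineM; last 2 first.
- exact: fin_num_measure (mXB _ _).
- by apply: prode_fin_num => k _; exact: fin_num_measure (mXB _ _).
rewrite rmorphM/= IH; congr (_ * _).
by rewrite -cintegral_indic//; exact: mXB.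
Qed.

Lemma independent_prod (s : seq I) (f : I -> R -> R[i]) : uniq s ->
  (forall i, cmeasurable (f i)) ->
  (forall i x, Normc.normc (f i x) <= 1) ->
  cintegral P (fun w => \prod_(i <- s) f i (X i w)) =
  \prod_(i <- s) cintegral P (fun w => f i (X i w)).
Proof.
move=> us mf f1.
have mfX i : cmeasurable (fun w => f i (X i w)) by exact: cmeasurable_comp.
have mi i (B : set R) : measurable B ->
    cmeasurable (fun w => (\1_B (X i w))%:C : R[i]).
  by move=> mB; exact: (cmeasurable_comp (cmeasurable_indic mB) (mX i)).
(* Indicators are exchanged for functions one index at a time: [s1] carries functions, [s2] still
   indicators. Moving the head [j] of [s1] over to [s2] gives the product rule against indicators of
   [X j], which [factorization] extends to [f j]. *)
suff H (s1 s2 : seq I) (B : I -> set R) : uniq (s1 ++ s2) ->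
    (forall i, measurable (B i)) ->
    cintegral P (fun w => \prod_(i <- s1) f i (X i w) *
      \prod_(i <- s2) (\1_(B i) (X i w))%:C) =
    \prod_(i <- s1) cintegral P (fun w => f i (X i w)) *
    \prod_(i <- s2) cintegral P (fun w => (\1_(B i) (X i w))%:C).
  have := H s [::] (fun=> setT); rewrite cats0 big_nil mulr1 => <- //.
  by apply: eq_cintegral => w; rewrite big_nil mulr1.
elim: s1 s2 B => [|j s1 IH] s2 B us12 mB.
  rewrite big_nil mul1r -independent_indic//.
  by apply: eq_cintegral => w; rewrite big_nil mul1r.
pose G w := \prod_(i <- s1) f i (X i w) * \prod_(i <- s2) (\1_(B i) (X i w))%:C.
have us2 : uniq (s1 ++ s2) by move: us12 => /= /andP[].
have js : j \notin s2.
  by move: us12 => /= /andP[]; rewrite mem_cat negb_or => /andP[].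
have mG : cmeasurable G.
  by apply: cmeasurableM; apply: cmeasurable_prod => i //; exact: mi.
have G1 w : Normc.normc (G w) <= 1.
  rewrite /G Normc.normcM mulr_ile1//.
  - exact: normc_ge0.
  - exact: normc_ge0.
  - by apply: normc_prod.
  - by apply: normc_prod => i; exact: normc_indic.
have GE (A : set R) : measurable A ->
    cintegral P (fun w => G w * (\1_A (X j w))%:C) =
    cintegral P G * cintegral P (fun w => (\1_A (X j w))%:C).
  move=> mA.
  (* Since [j] does not occur in [s2], prescribing [A] at [j] leaves the sets used by [s2]
     unchanged. *)
  pose B' i := if i == j then A else B i.
  have B'j : B' j = A by rewrite /B' eqxx.
  have mB' i : measurable (B' i) by rewrite /B'; case: ifP.
  have B'E (F : set R -> I -> R[i]) : \prod_(i <- s2) F (B' i) i = \prod_(i <- s2) F (B i) i.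
    rewrite big_seq [RHS]big_seq; apply: eq_bigr => i iS.
    by rewrite /B' ifF//; apply/negbTE/negP => /eqP ij; move: js; rewrite -ij iS.
  have := IH (j :: s2) B' _ mB'.
  rewrite big_cons B'j (B'E (fun A i => cintegral P (fun w => (\1_A (X i w))%:C))).
  have -> : cintegral P G = \prod_(i <- s1) cintegral P (fun w => f i (X i w)) *
      \prod_(i <- s2) cintegral P (fun w => (\1_(B i) (X i w))%:C).
    exact: IH.
  move=> IH1; rewrite -mulrA [X in _ = _ * X]mulrC -IH1; last first.
    by rewrite -(cat1s j s2) (perm_uniq (permEl (perm_catCA _ _ _))).
  apply: eq_cintegral => w; rewrite big_cons B'j.
  rewrite (B'E (fun A i => (\1_A (X i w))%:C)) /G.
  by ring.
have := factorization mG G1 (mX j) GE (mf j) (f1 j).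
have -> : cintegral P G = \prod_(i <- s1) cintegral P (fun w => f i (X i w)) *
    \prod_(i <- s2) cintegral P (fun w => (\1_(B i) (X i w))%:C).
  exact: IH.
move=> E; rewrite big_cons -[RHS]mulrA [RHS]mulrC -E.
by apply: eq_cintegral => w; rewrite big_cons /G; ring.
Qed.

End Independence.

Section Characters.
Context {R : realType} {dT : measure_display} {T : measurableType dT}.

Lemma cintegral_law (P : probability T R) (Y : {RV P >-> R})
    (Q : probability R R) (f : R -> R[i]) (M : R) :
  (forall B, measurable B -> distribution P Y B = Q B) ->
  cmeasurable f -> (forall x, cle (f x) M) ->
  cintegral P (fun w => f (Y w)) = cintegral Q f.
Proof.
move=> YQ [f1 f2] fM.
have H (g : R -> R) : measurable_fun setT g -> (forall x, `|g x| <= M) ->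
    \int[P]_w g (Y w) = \int[Q]_x g x.
  move=> mg gM; rewrite /Rintegral; congr fine.
  transitivity (\int[distribution P Y]_x (g x)%:E)%E; last first.
    by apply: eq_measure_integral => A mA _; exact: YQ.
  rewrite integral_distribution//; first exact/measurable_EFinP.
  apply: (integrable_bounded P (M := M)) => //.
  by apply: measurableT_comp => //; exact: measurable_funPT.
apply: complex_parts => /=.
- by rewrite -(H (fun x => complex.Re (f x)))// => x; case: (fM x).
- by rewrite -(H (fun x => complex.Im (f x)))// => x; case: (fM x).
Qed.

(** Translation invariance of the law lets every site of a box play the role of the origin. *)
Lemma iid_shift (P : probability T R) (d : nat)
    (X : lattice d -> {RV P >-> R}) kappa (m : lattice d) :
  iid X kappa -> iid (fun n => X (m + n)) kappa.
Proof.
move=> [lawX indX]; split=> [i B mB|J B mB]; first exact: lawX.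
pose J' := [fset (m + j)%R | j in J]%fset.
have J'P (i : lattice d) : i \in J' -> i - m \in J.
  by move=> /imfsetP[j /= jJ ->]; rewrite addrAC subrr add0r.
have JJ' (j : lattice d) : j \in J -> m + j \in J'.
  by move=> jJ; apply/imfsetP; exists j.
have := indX J' (fun i => B (i - m)) _.
have -> : \bigcap_(i in [set` J']) X i @^-1` B (i - m) =
          \bigcap_(i in [set` J]) X (m + i) @^-1` B i.
  apply/seteqP; split => w H j /= jJ.
    by have := H (m + j) (JJ' _ jJ); rewrite /= addrAC subrr add0r.
  by have := H (j - m) (J'P _ jJ); rewrite /= addrCA subrr addr0.
move=> ->; last by move=> i iJ; apply: mB; exact: J'P.
rewrite big_imfset/=; last by move=> i j _ _ /addrI.
by apply: eq_bigr => i _; rewrite addrAC subrr add0r.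
Qed.

Section Coefficients.
Context {I : eqType}.
Implicit Types a : seq (I * R).

(** Independence concerns distinct sites, so repetitions in the list are merged before a character
    is factorised. *)
Definition sites a := undup (map fst a).

Definition coefficient a (j : I) : R := \sum_(p <- a | p.1 == j) p.2.

Lemma sum_sites a (F : I * R -> R) :
  \sum_(p <- a) F p = \sum_(j <- sites a) \sum_(p <- a | p.1 == j) F p.
Proof.
under [RHS]eq_bigr do rewrite big_mkcond.
rewrite exchange_big/= big_seq [RHS]big_seq; apply: eq_bigr => p pa.
have ps : p.1 \in sites a by rewrite mem_undup map_f.
rewrite (bigD1_seq p.1)//= ?undup_uniq// eqxx big1 ?addr0// => j.
by rewrite eq_sym => /negbTE ->.
Qed.

End Coefficients.

Lemma phaseE (d : nat) (a : seq (lattice d * R)) (V : lattice d -> R) :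
  phase a V = \sum_(j <- sites a) coefficient a j * V j.
Proof.
rewrite /phase sum_sites; apply: eq_bigr => j _.
by rewrite /coefficient mulr_suml; apply: eq_bigr => p /eqP ->.
Qed.

Lemma weightE (d : nat) (a : seq (lattice d * R)) :
  weight a = \sum_(j <- sites a) coefficient a j.
Proof. exact: sum_sites. Qed.

Lemma iid_character (P : probability T R) (d : nat)
    (X : lattice d -> {RV P >-> R}) kappa (Q : probability R R) a :
  iid X kappa -> (forall B, measurable B -> Q B = kappa B) ->
  cintegral P (fun w => cexpi (- phase a (fun n => X n w))) =
  \prod_(j <- sites a) fourier Q (coefficient a j).
Proof.
move=> [lawX indX] Qk.
pose f (i : lattice d) (x : R) : R[i] := cexpi (- (coefficient a i * x)).
have mf i : cmeasurable (f i).
  by apply: cmeasurable_cexpi; apply: measurableT_comp => //; exact: measurable_funM.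
have f1 i x : Normc.normc (f i x) <= 1 by rewrite normc_cexpi.
have := @independent_prod _ _ _ P _ X indX (sites a) f (undup_uniq _) mf f1.
have -> : (fun w => \prod_(i <- sites a) f i (X i w)) =
          (fun w => cexpi (- phase a (fun n => X n w))).
  apply/funext => w; rewrite phaseE /f -sumrN.
  by rewrite (big_morph _ (@cexpiD R) (@cexpi0 R)).
move=> ->; apply: eq_bigr => j _.
rewrite /fourier (@cintegral_law P (X j) Q (f j) 1)// => [B mB|x].
  by rewrite lawX// Qk.
exact: cle_cexpi.
Qed.

End Characters.

Section CharacterRatio.
Context {R : realType} {d1 d2 : measure_display}.
Context {T1 : measurableType d1} {T2 : measurableType d2}.

(** Nonnegative weights give nonnegative coefficients, so the exponents [lambda * coefficient a j]
    add up to [lambda * weight a] without absolute values. *)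
Lemma iid_character_ratio (P1 : probability T1 R) (P2 : probability T2 R)
    (d : nat) (X1 : lattice d -> {RV P1 >-> R}) (X2 : lattice d -> {RV P2 >-> R})
    kappa1 kappa2 (Q1 Q2 : probability R R) (lambda : R) a :
  iid X1 kappa1 -> (forall B, measurable B -> Q1 B = kappa1 B) ->
  iid X2 kappa2 -> (forall B, measurable B -> Q2 B = kappa2 B) ->
  (forall s, 0 <= s -> fourier Q1 s = (expR (- (lambda * s)))%:C * fourier Q2 s) ->
  nonneg_weights a ->
  cintegral P1 (fun w => cexpi (- phase a (fun n => X1 n w))) =
    (expR (- (lambda * weight a)))%:C *
    cintegral P2 (fun w => cexpi (- phase a (fun n => X2 n w))).
Proof.
move=> i1 Q1k i2 Q2k Q12 a0.
rewrite (iid_character _ i1 Q1k) (iid_character _ i2 Q2k) weightE.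
elim: (sites a) => [|j s IH].
  by rewrite !big_nil mulr0 oppr0 expR0 mulr1.
rewrite !big_cons IH Q12; last first.
  rewrite /coefficient big_seq_cond; apply: sumr_ge0 => p /andP[pa _].
  exact: (allP a0).
rewrite mulrDr opprD expRD rmorphM/=; ring.
Qed.

End CharacterRatio.

(** * The Cauchy law and its convolutions *)

Section CauchyDistribution.
Context {R : realType}.
Notation leb := (@lebesgue_measure R).
Variable lambda : R.
Hypothesis lambda_gt0 : 0 < lambda.

Let pdfE (x : R) : cauchy_pdf lambda x = pi^-1 * poisson lambda x.
Proof. by rewrite /cauchy_pdf /poisson invfM mulrCA. Qed.

Let pdf_ge0 (x : R) : 0 <= cauchy_pdf lambda x.
Proof. by rewrite pdfE mulr_ge0 ?poisson_ge0// invr_ge0 pi_ge0. Qed.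

Let continuous_pdf : continuous (cauchy_pdf lambda).
Proof.
have -> : cauchy_pdf lambda = (fun x => pi^-1 * poisson lambda x).
  by apply/funext => x; exact: pdfE.
by move=> x; apply: cvgM; [exact: cvg_cst|exact: continuous_poisson].
Qed.

Let measurable_pdf : measurable_fun setT (cauchy_pdf lambda).
Proof. exact: continuous_measurable_fun. Qed.

Let integrable_pdf : leb.-integrable setT (EFin \o cauchy_pdf lambda).
Proof.
have -> : EFin \o cauchy_pdf lambda = (fun x => (pi^-1)%:E * (poisson lambda x)%:E)%E.
  by apply/funext => x /=; rewrite pdfE EFinM.
exact: (integrableZl measurableT _ (integrable_poisson lambda_gt0)).
Qed.

Let integral_pdf : (\int[leb]_x (cauchy_pdf lambda x)%:E = 1)%E.
Proof.
under eq_integral do rewrite pdfE EFinM.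
rewrite (integralZl measurableT (integrable_poisson lambda_gt0)).
by rewrite integral_poisson// -EFinM mulVf// gt_eqF// pi_gt0.
Qed.

Local Notation cauchy := (cauchy_prob lambda).

Let cauchy0 : cauchy set0 = 0%E.
Proof. by rewrite /cauchy_prob integral_set0. Qed.

Let cauchy_ge0 A : (0 <= cauchy A)%E.
Proof. by apply: integral_ge0 => x _; rewrite lee_fin. Qed.

Let cauchy_sigma_additive : semi_sigma_additive cauchy.
Proof.
move=> /= A mA tA mUA.
rewrite /cauchy_prob/= integral_bigcup//=; last first.
  by apply: (integrableS _ _ (subsetT _)) => //; exact: integrable_pdf.
apply: is_cvg_ereal_nneg_natsum_cond => n _ _.
by apply: integral_ge0 => /= x ?; rewrite lee_fin.
Qed.

HB.instance Definition _ := isMeasure.Build _ _ _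
  cauchy cauchy0 cauchy_ge0 cauchy_sigma_additive.

HB.instance Definition _ :=
  @Measure_isProbability.Build _ _ R cauchy integral_pdf.

(* The real line carries two measurable structures with the same sets: the one of
   R, and [measurableTypeR R], on which the Lebesgue measure is defined. *)
Let cauchyT : set (measurableTypeR R) -> \bar R := cauchy.

Let cauchyT_sigma_additive : semi_sigma_additive cauchyT.
Proof. exact: cauchy_sigma_additive. Qed.

HB.instance Definition _ := isMeasure.Build _ _ _
  cauchyT cauchy0 cauchy_ge0 cauchyT_sigma_additive.

HB.instance Definition _ :=
  @Measure_isProbability.Build _ _ R cauchyT integral_pdf.

Let cauchy_dominates : cauchyT `<< leb.
Proof.
apply/null_content_dominatesP => A mA muA0.
apply: null_set_integral => //=; apply/measurable_funTS.
exact/measurable_EFinP.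
Qed.

(** The Radon-Nikodym derivative of the Cauchy law agrees almost everywhere with the density, since
    both have the same integral over every measurable set. *)
Lemma integral_cauchy (f : R -> R) (M : R) : measurable_fun setT f ->
  (forall x, `|f x| <= M) ->
  \int[cauchy]_x f x = \int[leb]_x (f x * cauchy_pdf lambda x).
Proof.
move=> mf fM; rewrite /Rintegral; congr fine.
have fi : cauchyT.-integrable setT (EFin \o f).
  exact: (@integrable_bounded _ _ _ cauchyT f M mf fM).
have mid : measurable_fun setT (idfun : measurableTypeR R -> R).
  by move=> _ B mB; rewrite setTI.
have mEf : measurable_fun (setT : set R) (EFin \o f) by exact/measurable_EFinP.
(* The identity map transports the law between the two measurable structures. *)
transitivity (\int[cauchyT]_x (f x)%:E)%E.
  exact: (integral_pushforward mid mEf fi measurableT).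
rewrite -(Radon_Nikodym_change_of_variables cauchy_dominates)//=.
under [RHS]eq_integral do rewrite EFinM.
apply: ae_eq_integral => //.
- apply: emeasurable_funM; first exact/measurable_EFinP.
  apply: (measurable_int leb).
  by apply: Radon_Nikodym_integrable; exact: cauchy_dominates.
- by apply: emeasurable_funM; exact/measurable_EFinP.
- apply: ae_eqe_mul2l => /=.
  rewrite Radon_NikodymE//=.
  case: cid => /= h [h1 h2 h3].
  apply: integral_ae_eq => //=; first exact/measurable_EFinP.
  by move=> E E01 mE; rewrite -h3.
Qed.

Lemma fourier_cauchy (s : R) : 0 <= s ->
  cintegral cauchy (fun x => cexpi (- (s * x))) = (expR (- (lambda * s)))%:C.
Proof.
move=> s0.
have mlin : measurable_fun setT (fun x : R => - (s * x)).
  by apply: measurableT_comp => //; exact: measurable_funM.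
have [mc ms] := cmeasurable_cexpi mlin.
apply: complex_parts => /=.
- rewrite (integral_cauchy mc (fun x => (cle_cexpi (- (s * x))).1)) /=.
  (* The differential equation needs a positive frequency; at 0 the claim is that the total mass is
     1. *)
  move: s0; rewrite le_eqVlt => /orP[/eqP <-|s0].
    rewrite mulr0 oppr0 expR0 /Rintegral.
    under eq_integral do rewrite mul0r oppr0 cos0 mul1r.
    by rewrite integral_pdf.
  transitivity (\int[leb]_x (pi^-1 * (poisson lambda x * cos (s * x)))).
    by apply: eq_Rintegral => x _; rewrite cosN pdfE; ring.
  rewrite RintegralZl//; last first.
    apply: (@integrable_mul_cos _ s _ (lambda * (1 + lambda ^- 2))).
      exact: continuous_poisson.
    by move=> x; exact: poisson_le.
  have := poisson_cosE s0 lambda_gt0; rewrite /poisson_cos => ->.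
  by rewrite mulKf ?gt_eqF ?pi_gt0// [lambda * s]mulrC.
- rewrite (integral_cauchy ms (fun x => (cle_cexpi (- (s * x))).2)) /=.
  have cs : continuous (fun x : R => sin (- (s * x)) * cauchy_pdf lambda x).
    move=> x; apply: cvgM; last exact: continuous_pdf.
    apply: (cvg_comp (fun x : R => - (s * x)) sin); last exact: continuous_sin.
    by apply: cvgN; apply: cvgM; [exact: cvg_cst|exact: cvg_id].
  apply: Rintegral_odd => //.
    apply: (@le_integrable _ _ _ leb _ measurableT _ (EFin \o cauchy_pdf lambda)).
    + by apply/measurable_EFinP; exact: continuous_measurable_fun.
    + move=> x _ /=; rewrite lee_fin normrM ler_piMl//.
      by rewrite ler_norml sin_geN1 sin_le1.
    + exact: integrable_pdf.
  by move=> x; rewrite mulrN opprK sinN /cauchy_pdf sqrrN; ring.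
Qed.

Section Convolution.
Variable mu2 : probability R R.

Local Notation prod := (cauchy \x mu2)%E.

(** The convolution is the law of the sum of the coordinates on the product space. Their
    independence is known on rectangles; [factorization], applied once for each coordinate, carries
    it over to characters. *)
Lemma fourier_convolution (Q : probability R R) (s : R) :
  (forall B, measurable B -> Q B = convolution cauchy mu2 B) -> 0 <= s ->
  fourier Q s = (expR (- (lambda * s)))%:C * fourier mu2 s.
Proof.
move=> QB s0.
pose P : probability (R * R)%type R := prod.
have m1 : measurable_fun setT (fst : R * R -> R) by exact: measurable_fst.
have m2 : measurable_fun setT (snd : R * R -> R) by exact: measurable_snd.
have ma : measurable_fun setT (fun p : R * R => p.1 + p.2) by exact: measurable_funD.
pose Y1 : {RV P >-> R} := HB.pack_for {RV P >-> R} (fst : R * R -> R) (isMeasurableFun.Build _ _ _ _ _ m1).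
pose Y2 : {RV P >-> R} := HB.pack_for {RV P >-> R} (snd : R * R -> R) (isMeasurableFun.Build _ _ _ _ _ m2).
pose Y : {RV P >-> R} := HB.pack_for {RV P >-> R} (fun p : R * R => p.1 + p.2) (isMeasurableFun.Build _ _ _ _ _ ma).
pose e (x : R) : R[i] := cexpi (- (s * x)).
have me : cmeasurable e.
  by apply: cmeasurable_cexpi; apply: measurableT_comp => //; exact: measurable_funM.
have e1 x : cle (e x) 1 by exact: cle_cexpi.
have en x : Normc.normc (e x) <= 1 by rewrite normc_cexpi.
rewrite {1}/fourier -/e -(@cintegral_law _ _ _ P Y Q e 1)//; last first.
  by move=> B mB; rewrite QB.
transitivity (cintegral P (fun p => e (Y1 p) * e (Y2 p))).
  by apply: eq_cintegral => p; rewrite /e -cexpiD /=; congr cexpi; ring.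
have PE (A B : set R) : measurable A -> measurable B -> P (A `*` B) = (cauchy A * mu2 B)%E.
  by move=> mA mB; exact: product_measure1E.
have cT : cauchy setT = 1%E by exact: integral_pdf.
have mT : mu2 setT = 1%E by exact: probability_setT.
have P1 B : measurable B -> distribution P Y1 B = cauchy B.
  move=> mB; rewrite /distribution /pushforward.
  have -> : Y1 @^-1` B = B `*` setT by apply/seteqP; split => -[x y] //= [].
  by rewrite PE// mT mule1.
have P2 B : measurable B -> distribution P Y2 B = mu2 B.
  move=> mB; rewrite /distribution /pushforward.
  have -> : Y2 @^-1` B = setT `*` B by apply/seteqP; split => -[x y] //= [].
  by rewrite PE// cT mul1e.
have mi (A : set R) (Z : {RV P >-> R}) : measurable A ->
    cmeasurable (fun p => (\1_A (Z p))%:C : R[i]).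
  by move=> mA; exact: (cmeasurable_comp (cmeasurable_indic mA) (measurable_funPT Z)).
have PI (A : set R) (Z : {RV P >-> R}) : measurable A ->
    cintegral P (fun p => (\1_A (Z p))%:C) = (fine (distribution P Z A))%:C.
  move=> mA; rewrite -(cintegral_indic P (A := Z @^-1` A))//.
  by rewrite -[X in measurable X]setTI; exact: (measurable_funPT Z).
have G1 : cmeasurable (fun p => e (Y1 p)).
  exact: (cmeasurable_comp me (measurable_funPT Y1)).
rewrite (factorization G1 (fun p => en (Y1 p)) (measurable_funPT Y2) _ me en).
  rewrite (cintegral_law P1 me e1) (cintegral_law P2 me e1).
  by rewrite fourier_cauchy.
move=> B mB.
transitivity (cintegral P (fun p => (\1_B (Y2 p))%:C * e (Y1 p))).
  by apply: eq_cintegral => p; rewrite mulrC.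
rewrite (factorization (mi B Y2 mB) (fun p => normc_indic B (Y2 p))
  (measurable_funPT Y1) _ me en); first by rewrite mulrC.
move=> A mA; rewrite !PI// P1// P2//.
have mAB : measurable (A `*` B : set (R * R)) by exact: measurableX.
transitivity (cintegral P (fun p => (\1_(A `*` B) p)%:C)).
  apply: eq_cintegral => p; rewrite -rmorphM/= !indicE; congr (_%:C).
  rewrite in_setX andbC; case: (_ \in B); rewrite ?mul1r ?mul0r ?andbT ?andbF//.
rewrite (cintegral_indic P mAB) -rmorphM/=; congr (_%:C).
rewrite PE// fineM//; last 2 first.
- exact: fin_num_measure.
- exact: fin_num_measure.
by rewrite mulrC.
Qed.

End Convolution.

End CauchyDistribution.

(** * Finite volume propagators *)

Section ConjugatedDiag.
Context {C : numClosedFieldType} {N : nat}.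
Implicit Types (S G : 'M[C]_N) (c : 'rV[C]_N).
Local Open Scope sesquilinear_scope.

(** Functional calculus: for a matrix diagonalised by [S], a function of the matrix is obtained by
    changing the row [c] of eigenvalues. *)
Definition conjugated_diag S c : 'M[C]_N := invmx S *m diag_mx c *m S.

Lemma conjugated_diag_entry S c a b :
  conjugated_diag S c a b = \sum_j invmx S a j * S j b * c 0 j.
Proof.
rewrite mxE; apply: eq_bigr => j _.
by rewrite mul_mx_diag !mxE mulrAC.
Qed.

Lemma conjugated_diagM S c c' : S \in unitmx ->
  conjugated_diag S c *m conjugated_diag S c' =
  conjugated_diag S (\row_j (c 0 j * c' 0 j)).
Proof.
move=> S_unit; rewrite /conjugated_diag !mulmxA mulmxK//.
by rewrite -[_ *m diag_mx c *m _]mulmxA mulmx_diag.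
Qed.

Lemma conjugated_diag1 S : S \in unitmx -> conjugated_diag S (const_mx 1) = 1%:M.
Proof.
by move=> S_unit; rewrite /conjugated_diag diag_const_mx mulmx1 mulVmx.
Qed.

Lemma conjugated_diag_trace S c : S \in unitmx ->
  \tr (conjugated_diag S c) = \sum_j c 0 j.
Proof.
move=> S_unit; rewrite /conjugated_diag mxtrace_mulC mulmxA mulmxV// mul1mx.
by rewrite mxtrace_diag.
Qed.

Lemma conjugated_diag_char_poly S c : S \in unitmx ->
  char_poly (conjugated_diag S c) = \prod_j ('X - (c 0 j)%:P).
Proof.
move=> S_unit; rewrite /conjugated_diag.
have -> : char_poly (invmx S *m diag_mx c *m S) = char_poly (diag_mx c).
  rewrite /char_poly /char_poly_mx !map_mxM/= map_invmx/=.
  set T := map_mx _ S.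
  have T_unit : T \in unitmx by rewrite map_unitmx.
  have -> : 'X%:M - invmx T *m map_mx polyC (diag_mx c) *m T =
      invmx T *m ('X%:M - map_mx polyC (diag_mx c)) *m T.
    by rewrite mulmxBr mulmxBl scalar_mxC mulmxKV.
  rewrite !det_mulmx mulrAC -det_mulmx mulVmx// det1 mul1r//.
rewrite char_poly_trig ?diag_mx_is_trig//.
by apply: eq_bigr => j _; rewrite mxE eqxx mulr1n.
Qed.

Lemma conjugated_diag_unitary S c : S \is unitarymx ->
  (forall j, `|c 0 j| = 1) -> conjugated_diag S c \is unitarymx.
Proof.
move=> S_unitary c1; apply: mul_unitarymx => //; apply: mul_unitarymx.
  by rewrite invmx_unitary ?trmxC_unitary.
apply/unitarymxP; rewrite tr_diag_mx map_diag_mx mulmx_diag -diag_const_mx.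
by congr diag_mx; apply/rowP => j; rewrite !mxE -normCK c1 expr1n.
Qed.

Lemma norm_unitary_entry G a b : G \is unitarymx -> `|G a b| <= 1.
Proof.
move=> /unitarymxP/matrixP/(_ a a); rewrite !mxE eqxx => eG.
rewrite -(@expr_le1 _ 2)// -[X in _ <= X]/(1%:R) -[X in _ <= X]eG.
rewrite (bigD1 b)//= !mxE -normCK lerDl.
by apply: sumr_ge0 => j _; rewrite !mxE -normCK exprn_ge0.
Qed.

Lemma hermitian_conjugated_diag (A : 'M[C]_N) : A \is hermsymmx ->
  A = conjugated_diag (spectralmx A) (spectral_diag A).
Proof. by move=> /hermitian_normalmx/orthomx_spectralP. Qed.

End ConjugatedDiag.

Section Propagator.
Context {R : realType}.
Variables (N : nat) (A : 'M[R[i]]_N).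
Hypothesis A_herm : A \is hermsymmx.

Local Notation S := (spectralmx A).

Let S_unit : S \in unitmx. Proof. exact: spectral_unit. Qed.

Definition energy (j : 'I_N) : R := complex.Re (spectral_diag A 0 j).

Lemma energyE j : spectral_diag A 0 j = (energy j)%:C.
Proof.
have /mxOverP/(_ 0 j) := hermitian_spectral_diag_real A_herm.
rewrite /energy; case: (spectral_diag A 0 j) => a b.
by rewrite complex_real => /eqP /= ->.
Qed.

Definition propagator (s : R) : 'M[R[i]]_N :=
  conjugated_diag S (\row_j cexpi (- (s * energy j))).

Lemma propagator0 : propagator 0 = 1%:M.
Proof.
rewrite -(conjugated_diag1 S_unit) /propagator.
have -> // : \row_j cexpi (- (0 * energy j)) = const_mx 1.
by apply/rowP => j; rewrite !mxE mul0r oppr0 cexpi0.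
Qed.

Lemma normc_propagator s a b : Normc.normc (propagator s a b) <= 1.
Proof.
have /(norm_unitary_entry a b) : propagator s \is unitarymx.
  apply: conjugated_diag_unitary; first exact: spectral_unitarymx.
  by move=> j; rewrite mxE -[LHS]/((Normc.normc _)%:C) normc_cexpi.
by rewrite -lecR.
Qed.

Lemma propagator_trace s : \tr (propagator s) = \sum_j cexpi (- (s * energy j)).
Proof.
rewrite (conjugated_diag_trace _ S_unit).
by apply: eq_bigr => j _; rewrite mxE.
Qed.

Lemma propagator_derive (s : R) a b :
  cderive (fun x => propagator x a b) s (- 'i%C * (A *m propagator s) a b).
Proof.
have := conjugated_diagM (spectral_diag A) (\row_j cexpi (- (s * energy j))) S_unit.
rewrite -(hermitian_conjugated_diag A_herm) -/(propagator s) => ->.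
rewrite [X in - 'i%C * X]conjugated_diag_entry mulr_sumr.
under [X in cderive X]eq_fun do rewrite conjugated_diag_entry.
apply: cderive_sum => j.
have hd : is_derive s 1 (fun x : R => - (x * energy j)) (- energy j).
  have -> : (fun x : R => - (x * energy j)) = (- energy j) \*: (id : R -> R).
    by apply/funext => x; rewrite /GRing.scale/= -mulNr mulrC mulrN -mulNr.
  have := is_deriveZ (- energy j) (is_derive_id s (1 : R)).
  by move=> /is_derive_eq; apply; rewrite /GRing.scale/= mulr1.
under [X in cderive X]eq_fun do rewrite mxE.
have := cderiveM (cderive_cst (invmx S a j * S j b) s) (cderive_cexpi hd).
move=> /cderive_eq; apply; rewrite !mxE energyE rmorphN /=; ring.
Qed.

Lemma char_poly_energy : char_poly A = \prod_j ('X - (energy j)%:C%:P).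
Proof.
rewrite {1}(hermitian_conjugated_diag A_herm).
rewrite (conjugated_diag_char_poly _ S_unit).
by apply: eq_bigr => j _; rewrite energyE.
Qed.

End Propagator.

(** * Complex limits and measurability of matrix propagators *)

Section ComplexLimits.
Context {R : realType}.
Implicit Types (f g : nat -> R[i]).

Definition ccvg f (l : R[i]) : Prop :=
  complex.Re (f k) @[k --> \oo] --> complex.Re l /\
  complex.Im (f k) @[k --> \oo] --> complex.Im l.

Lemma ccvg_cst (l : R[i]) : ccvg (fun=> l) l.
Proof. by split; exact: cvg_cst. Qed.

Lemma ccvgD f g l m : ccvg f l -> ccvg g m -> ccvg (fun k => f k + g k) (l + m).
Proof.
move=> [f1 f2] [g1 g2]; split.
- by under eq_fun do rewrite cReD; rewrite cReD; exact: cvgD.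
- by under eq_fun do rewrite cImD; rewrite cImD; exact: cvgD.
Qed.

Lemma ccvgM f g l m : ccvg f l -> ccvg g m -> ccvg (fun k => f k * g k) (l * m).
Proof.
move=> [f1 f2] [g1 g2]; split.
- under eq_fun do rewrite cReM; rewrite cReM.
  by apply: cvgB; [exact: (cvgM f1 g1)|exact: (cvgM f2 g2)].
- under eq_fun do rewrite cImM; rewrite cImM.
  by apply: cvgD; [exact: (cvgM f1 g2)|exact: (cvgM f2 g1)].
Qed.

Lemma ccvg_sum (I : Type) (r : seq I) (F : I -> nat -> R[i]) (l : I -> R[i]) :
  (forall i, ccvg (F i) (l i)) ->
  ccvg (fun k => \sum_(i <- r) F i k) (\sum_(i <- r) l i).
Proof.
move=> H; elim: r => [|i r IH].
  by rewrite big_nil; under eq_fun do rewrite big_nil; exact: ccvg_cst.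
by rewrite big_cons; under eq_fun do rewrite big_cons; exact: ccvgD.
Qed.

Lemma ccvg_unique f l m : ccvg f l -> ccvg f m -> l = m.
Proof.
move=> [f1 f2] [g1 g2]; apply: complex_parts.
- exact: (cvg_unique _ f1 g1).
- exact: (cvg_unique _ f2 g2).
Qed.

Lemma ccvg_cle f l (e : nat -> R) : (forall k, cle (f k - l) (e k)) ->
  e k @[k --> \oo] --> 0 -> ccvg f l.
Proof.
move=> fe e0; split.
- apply/cvgrPdist_le => eps eps0; move/cvgrPdist_le : e0 => /(_ _ eps0).
  apply: filterS => k; rewrite sub0r normrN => ek.
  have [+ _] := fe k; rewrite cReD cReN distrC => h.
  by apply: le_trans h (le_trans (ler_norm _) ek).
- apply/cvgrPdist_le => eps eps0; move/cvgrPdist_le : e0 => /(_ _ eps0).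
  apply: filterS => k; rewrite sub0r normrN => ek.
  have [_ +] := fe k; rewrite cImD cImN distrC => h.
  by apply: le_trans h (le_trans (ler_norm _) ek).
Qed.

Lemma cmeasurable_ccvg d (T : measurableType d) (h : nat -> T -> R[i])
    (f : T -> R[i]) :
  (forall k, cmeasurable (h k)) -> (forall w, ccvg (h^~ w) (f w)) ->
  cmeasurable f.
Proof.
move=> mh hf; split.
- apply: (@measurable_fun_cvg _ _ _ _ (fun k w => complex.Re (h k w))).
  + by move=> k; have [] := mh k.
  + by move=> w _; have [] := hf w.
- apply: (@measurable_fun_cvg _ _ _ _ (fun k w => complex.Im (h k w))).
  + by move=> k; have [] := mh k.
  + by move=> w _; have [] := hf w.
Qed.

(** These are the terms (is)^k / k! of the exponential series, even ones real and odd ones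
    imaginary. *)
Definition cexpi_coeff (s : R) (k : nat) : R[i] := cos_coeff s k +i* sin_coeff s k.

Lemma ccvg_cexpi_series (s x : R) :
  ccvg (fun K => \sum_(0 <= k < K) cexpi_coeff s k * (x%:C) ^+ k) (cexpi (s * x)).
Proof.
have E k : cexpi_coeff s k * (x%:C) ^+ k = cexpi_coeff (s * x) k.
  rewrite -rmorphXn /cexpi_coeff; apply: complex_parts => /=.
    by rewrite mulr0 subr0 /cos_coeff/= exprMn; ring.
  by rewrite mulr0 add0r /sin_coeff/= exprMn; ring.
split.
- have := @is_cvg_series_cos_coeff _ (s * x); rewrite /= cos.unlock.
  apply: cvg_trans; apply: near_eq_cvg; apply: nearW => K.
  by rewrite cRe_sum; apply: eq_bigr => k _; rewrite E.
- have := @is_cvg_series_sin_coeff _ (s * x); rewrite /= sin.unlock.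
  apply: cvg_trans; apply: near_eq_cvg; apply: nearW => K.
  by rewrite cIm_sum; apply: eq_bigr => k _; rewrite E.
Qed.

End ComplexLimits.

Section PropagatorMeasurable.
Context {R : realType}.

Lemma iter_conjugated_diag (C : numClosedFieldType) N (S : 'M[C]_N) (c : 'rV[C]_N) k :
  S \in unitmx ->
  iter k (mulmx (conjugated_diag S c)) 1%:M = conjugated_diag S (\row_j c 0 j ^+ k).
Proof.
move=> S_unit; elim: k => [|k IH].
  rewrite /= -(conjugated_diag1 S_unit); congr conjugated_diag.
  by apply/rowP => j; rewrite !mxE expr0.
rewrite iterS IH conjugated_diagM//; congr conjugated_diag.
by apply/rowP => j; rewrite !mxE exprS.
Qed.

(** [spectralmx] is a choice with no stated regularity in [A], whereas the partial sums of this
    series are polynomial in the entries of [A]. Measurability of the propagator rests on it. *)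
Lemma propagator_series N (A : 'M[R[i]]_N) (s : R) a b : A \is hermsymmx ->
  ccvg (fun K => \sum_(0 <= k < K) cexpi_coeff (- s) k *
                 (iter k (mulmx A) 1%:M) a b) (propagator A s a b).
Proof.
move=> A_herm.
pose S := spectralmx A; have S_unit : S \in unitmx := spectral_unit A.
rewrite /propagator conjugated_diag_entry.
have E K : \sum_(0 <= k < K) cexpi_coeff (- s) k * (iter k (mulmx A) 1%:M) a b =
    \sum_j invmx S a j * S j b *
      \sum_(0 <= k < K) cexpi_coeff (- s) k * (energy A j)%:C ^+ k.
  under [RHS]eq_bigr do rewrite mulr_sumr.
  rewrite exchange_big/=; apply: eq_bigr => k _.
  have -> : iter k (mulmx A) 1%:M =
      conjugated_diag S (\row_j spectral_diag A 0 j ^+ k).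
    rewrite -(iter_conjugated_diag _ k S_unit).
    by rewrite -(hermitian_conjugated_diag A_herm).
  rewrite conjugated_diag_entry mulr_sumr; apply: eq_bigr => j _.
  by rewrite mxE (energyE A_herm) mulrCA.
under [X in ccvg X]eq_fun do rewrite E.
apply: ccvg_sum => j; apply: ccvgM; first exact: ccvg_cst.
by rewrite mxE -mulNr; exact: ccvg_cexpi_series.
Qed.

Lemma cmeasurable_propagator d (T : measurableType d) N (A : T -> 'M[R[i]]_N)
    (s : R) a b :
  (forall w, A w \is hermsymmx) -> (forall i j, cmeasurable (fun w => A w i j)) ->
  cmeasurable (fun w => propagator (A w) s a b).
Proof.
move=> A_herm mA.
apply: (cmeasurable_ccvg _ (fun w => propagator_series s a b (A_herm w))) => K.
apply: cmeasurable_sum => k; apply: cmeasurableM; first exact: cmeasurable_cst.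
elim: k a => [|k IH] a /=; first exact: cmeasurable_cst.
under eq_fun do rewrite mxE.
by apply: cmeasurable_sum => j; exact: cmeasurableM.
Qed.

(** The characteristic polynomial splits over the energies, so root multiplicities are
    multiplicities in the list [l], and only the distinct energies up to [E] contribute to the
    sum. *)
Lemma eigenvalue_countE N (A : 'M[R[i]]_N) (E : R) : A \is hermsymmx ->
  eigenvalue_count A E = (\sum_j (energy A j <= E)%R)%N.
Proof.
move=> A_herm; rewrite /eigenvalue_count.
pose l := [seq energy A j | j <- index_enum 'I_N].
have mupE x : mup x%:C (char_poly A) = count_mem x l.
  rewrite char_poly_energy//.
  have -> : \prod_j ('X - (energy A j)%:C%:P) =
      \prod_(y <- [seq z%:C | z <- l]) ('X - y%:P) :> {poly R[i]}.
    by rewrite !big_map.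
  rewrite mu_prod_XsubC count_map; apply: eq_count => y /=.
  by apply/eqP/eqP => [[]//|->].
pose r := [seq x <- undup l | x <= E].
rewrite (fsbigE r); first last.
- move=> x /= xE; rewrite mem_filter mem_undup xE/= => xl.
  by rewrite mupE; apply/eqP; rewrite -leqn0 leqNgt -has_count has_pred1.
- by move=> x /=; rewrite mem_filter => /andP[].
- by rewrite filter_uniq ?undup_uniq.
have -> : (\sum_(x <- r | x \in [set x | (x <= E)%R]) mup x%:C (char_poly A) =
    \sum_(x <- r) \sum_(y <- l) (y == x))%N.
  rewrite big_seq_cond [RHS]big_seq_cond; apply: eq_big => x.
    rewrite andbT; apply: andb_idr; rewrite mem_filter => /andP[xE _].
    by apply/mem_set.
  by move=> _; rewrite mupE -sum1_count big_mkcond/=.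
rewrite exchange_big/= /l big_map; apply: eq_big_seq => j jN.
set y := energy A j.
have -> : (\sum_(x <- r) (y == x) = count_mem y r)%N.
  by rewrite -sum1_count [RHS]big_mkcond/=; apply: eq_bigr => x _; rewrite eq_sym; case: eqP.
rewrite count_uniq_mem ?filter_uniq ?undup_uniq// mem_filter mem_undup.
by rewrite (map_f (energy A) jN) andbT.
Qed.

End PropagatorMeasurable.

(** * Hamiltonians on finite sets of sites and on boxes *)

Section FiniteVolume.
Context {R : realType} {d : nat}.
Variables (N : nat) (sx : 'I_N -> lattice d).
Hypothesis sx_inj : injective sx.
Implicit Types (V : lattice d -> R) (n m : lattice d).

Definition finite_volume V : 'M[R[i]]_N :=
  \matrix_(a, b) anderson V (std_basis (sx b)) (sx a).

Lemma finite_volume_entry V a b : finite_volume V a b =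
  \sum_(e <- unit_vectors) (sx a + e == sx b)%:R + (V (sx a))%:C * (a == b)%:R.
Proof.
rewrite mxE /anderson laplacianE /multiplication /std_basis.
by rewrite (inj_eq sx_inj).
Qed.

Lemma l1normN n : l1norm (- n) = l1norm n.
Proof. by apply: eq_bigr => i _; rewrite ffunE normrN. Qed.

Lemma sum_unit_vectors n m :
  \sum_(e <- unit_vectors) (n + e == m)%:R = (l1norm (m - n) == 1)%:R :> R[i].
Proof.
have E e : (n + e == m) = (e == m - n).
  by rewrite addrC [RHS]eq_sym subr_eq eq_sym.
under eq_bigr do rewrite E.
have -> : (l1norm (m - n) == 1) = (m - n \in unit_vectors).
  by apply/eqP/unit_vectorsP.
rewrite -(count_uniq_mem _ uniq_unit_vectors) -sum1_count natr_sum.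
rewrite [RHS]big_mkcond/=; apply: eq_bigr => e _.
by case: eqP.
Qed.

Lemma finite_volume_herm V : finite_volume V \is hermsymmx.
Proof.
apply: realsym_hermsym.
  apply/is_hermitianmxP/matrixP => a b; rewrite expr0 scale1r !mxE.
  have := finite_volume_entry V a b; have := finite_volume_entry V b a.
  rewrite !mxE => -> ->; rewrite !sum_unit_vectors -l1normN opprB eq_sym.
  by congr (_ + _); rewrite [b == a]eq_sym; case: eqP => [->|]; rewrite ?mulr0.
apply/mxOverP => a b; rewrite finite_volume_entry sum_unit_vectors.
by rewrite realD ?realn// realM ?realn// complex_real.
Qed.

(** Extension by zero, written as a finite sum so that measurability and the hopping term are
    treated termwise. *)
Definition extend (f : 'I_N -> R[i]) m : R[i] := \sum_a (sx a == m)%:R * f a.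

Lemma extend_site f a : extend f (sx a) = f a.
Proof.
rewrite /extend (bigD1 a)//= eqxx mul1r big1 ?addr0// => b ba.
by rewrite (inj_eq sx_inj) (negbTE ba) mul0r.
Qed.

Lemma extend_eq0 f m : (forall a, sx a <> m) -> extend f m = 0.
Proof. by move=> H; rewrite /extend big1// => a _; case: eqP (H a) => // _ _; rewrite mul0r. Qed.

(** Column [b0] of the propagator, translated so that [b0] becomes the origin: it starts at [e_0]
    and sees the translated potential. *)
Definition box_solution V (b0 : 'I_N) (s : R) n : R[i] :=
  extend (fun a => propagator (finite_volume V) s a b0) (sx b0 + n).

Lemma box_solution0 V b0 s : box_solution V b0 s 0 = propagator (finite_volume V) s b0 b0.
Proof. by rewrite /box_solution addr0 extend_site. Qed.

(** Extension by zero matches the truncation of the Hamiltonian: a neighbour outside the volume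
    contributes nothing to either. The equation thus holds at all sites of the volume, among them
    those at distance less than [r] from [b0]. *)
Lemma box_local_solution V b0 r :
  (forall n, l1norm n < r%:Z -> exists a, sx a = sx b0 + n) ->
  local_solution (fun n => V (sx b0 + n)) r (box_solution V b0).
Proof.
move=> sx_ball; have A_herm := finite_volume_herm V.
split.
- move=> s n; rewrite /box_solution.
  have [[a <-]|na] := pselect (exists a, sx a = sx b0 + n).
    by rewrite extend_site; exact: normc_propagator.
  by rewrite extend_eq0 ?Normc.normc0 ?ler01// => a ea; apply: na; exists a.
- move=> n; rewrite /box_solution propagator0.
  have [[a ea]|na] := pselect (exists a, sx a = sx b0 + n).
    rewrite -ea extend_site mxE -(inj_eq sx_inj) ea.
    by rewrite -[X in _ == X]addr0 (inj_eq (addrI _)).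
  rewrite extend_eq0; last by move=> a ea; apply: na; exists a.
  by case: eqP na => // -> []; exists b0; rewrite addr0.
- move=> s n /sx_ball[a ea]; rewrite /box_solution -ea.
  under [X in cderive X]eq_fun do rewrite extend_site.
  apply: cderive_eq (propagator_derive A_herm s a b0) _; congr (_ * _).
  rewrite mxE extend_site.
  under eq_bigr do rewrite finite_volume_entry mulrDl.
  rewrite big_split/=; congr (_ + _).
    under eq_bigr do rewrite mulr_suml.
    rewrite exchange_big/=; apply: eq_bigr => e _.
    rewrite addrA -ea /extend; apply: eq_bigr => b _.
    by rewrite [sx b == _]eq_sym.
  rewrite (bigD1 a)//= eqxx mulr1 big1 ?addr0// => b ba.
  by rewrite eq_sym (negbTE ba) mulr0 mul0r.
Qed.

Lemma cmeasurable_box_solution disp (T : measurableType disp)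
    (V : T -> lattice d -> R) b0 s n :
  (forall m, measurable_fun setT (fun w => V w m)) ->
  cmeasurable (fun w => box_solution (V w) b0 s n).
Proof.
move=> mV; apply: cmeasurable_sum => a; apply: cmeasurableM.
  exact: cmeasurable_cst.
apply: cmeasurable_propagator => [w|i j]; first exact: finite_volume_herm.
under eq_fun do rewrite finite_volume_entry.
apply: cmeasurableD; first exact: cmeasurable_cst.
apply: cmeasurableM; last exact: cmeasurable_cst.
by split => //=; exact: measurable_cst.
Qed.

End FiniteVolume.

Section BoxGeometry.
Context {d : nat}.

Definition box_site (L : nat) (a : 'I_#|@box d L|) : lattice d := site (enum_val a).

Lemma box_site_inj L : injective (@box_site L).
Proof.
move=> a b /ffunP E; apply: enum_val_inj; apply/ffunP => i.
by apply: val_inj; move: (E i); rewrite !ffunE => /addIr [].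
Qed.

(** The coordinates are shifted by [L] and run from 0 to 2L; the two inequalities keep distance [r]
    from opposite faces. *)
Definition inner_site (r L : nat) (a : 'I_#|@box d L|) : bool :=
  [forall i, (r <= enum_val a i)%N && (enum_val a i + r <= 2 * L)%N].

Lemma inner_siteP r L (a : 'I_#|@box d L|) n : inner_site r a ->
  l1norm n < r%:Z -> exists b : 'I_#|@box d L|, box_site b = box_site a + n.
Proof.
move=> /forallP a_inner nr; set j := enum_val a.
have ni i : `|n i| < r%:Z.
  apply: le_lt_trans nr; rewrite /l1norm (bigD1 i)//= lerDl.
  exact: sumr_ge0.
have ji i : (absz ((j i)%:Z + n i)%R < 2 * L + 1)%N.
  by have /andP[] := a_inner i; have := ni i; rewrite -/j; lia.
exists (enum_rank [ffun i => Ordinal (ji i)]).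
rewrite /box_site enum_rankK; apply/ffunP => i; rewrite !ffunE /=.
rewrite -/j; have /andP[] := a_inner i; have := ni i; rewrite -/j.
by move: (n i) (nat_of_ord (j i)) => z x; lia.
Qed.

Lemma card_box L : #|@box d L| = ((2 * L + 1) ^ d)%N.
Proof. by rewrite card_ffun !card_ord. Qed.

(** Adding [r] to the shifted coordinates embeds the small box into the inner sites of the large
    one. Passing from [L] to [L + r] avoids truncated subtraction. *)
Lemma card_inner_site r L :
  (#|@box d L| <= #|[pred a : 'I_#|@box d (L + r)| | inner_site r a]|)%N.
Proof.
have lt_shift (x : 'I_(2 * L + 1)) : (x + r < 2 * (L + r) + 1)%N.
  by have := ltn_ord x; lia.
pose f (j : @box d L) : 'I_#|@box d (L + r)| :=
  enum_rank ([ffun i => Ordinal (lt_shift (j i))] : @box d (L + r)%N).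
have f_inj : injective f.
  move=> j j' /enum_rank_inj/ffunP E; apply/ffunP => i; apply: val_inj.
  by move: (E i); rewrite !ffunE => -[] /addIn.
apply: (@leq_trans #|codom f|); first by rewrite card_codom.
apply/subset_leq_card/fintype.subsetP => a /codomP[j ->]; rewrite inE; apply/forallP => i.
rewrite /f enum_rankK ffunE/=; have := ltn_ord (j i).
by move: (nat_of_ord (j i)) => x; lia.
Qed.

Lemma box_center r : exists a : 'I_#|@box d r|, inner_site r a /\ box_site a = 0.
Proof.
have lt_r : (r < 2 * r + 1)%N by lia.
exists (enum_rank ([ffun=> Ordinal lt_r] : @box d r)); split.
  by apply/forallP => i; rewrite enum_rankK ffunE/=; lia.
by rewrite /box_site enum_rankK; apply/ffunP => i; rewrite !ffunE/= subrr.
Qed.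

End BoxGeometry.

(** * The unitary group in infinite volume *)

Section SquareSummable.
Context {R : realType} {d : nat}.
Implicit Types (u v : lattice d -> R[i]) (n m : lattice d).

Lemma esum_point (T : choiceType) (t : T) (a : T -> \bar R) : (0 <= a t)%E ->
  (forall x, x != t -> a x = 0%E) -> \esum_(x in [set: T]) a x = a t.
Proof.
move=> at0 a0; rewrite -(esum_set1 at0) [RHS]esum_mkcond.
apply: eq_esum => x _; case: ifPn => // xt; apply: a0.
by apply: contra xt => /eqP ->; rewrite inE.
Qed.

Lemma l2sqnorm_std_basis m : l2sqnorm (std_basis m : lattice d -> R[i]) = 1%E.
Proof.
rewrite /l2sqnorm (@esum_point _ m) => [||n nm].
- by rewrite /std_basis eqxx Normc.normc1 expr1n.
- by rewrite lee_fin sqr_ge0.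
- by rewrite /std_basis (negbTE nm) Normc.normc0 expr0n.
Qed.

Lemma inner_std_basis v : inner (std_basis 0) v = v 0.
Proof.
rewrite /inner.
have rsum_point (f : lattice d -> R) : (forall n, n != 0 -> f n = 0) -> rsum f = f 0.
  move=> f0; rewrite /rsum (@esum_point _ 0) ?(@esum_point _ 0)//=.
  - by have /(congr1 (fun g => g 0)) := funrposBneg f.
  - by rewrite lee_fin funrneg_ge0.
  - by move=> n /f0 fn; rewrite /funrneg fn oppr0 maxxx.
  - by rewrite lee_fin funrpos_ge0.
  - by move=> n /f0 fn; rewrite /funrpos fn maxxx.
rewrite !rsum_point; first last.
- by move=> n n0; rewrite /std_basis (negbTE n0) conjc0 mul0r.
- by move=> n n0; rewrite /std_basis (negbTE n0) conjc0 mul0r.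
by rewrite /std_basis eqxx conjc1 mul1r; case: (v 0).
Qed.

Lemma le_l2sqnorm u n : (((Normc.normc (u n)) ^+ 2)%:E <= l2sqnorm u)%E.
Proof.
apply: esum_ge; exists [set n]; first by split => //; exact: finite_set1.
by rewrite fsbig_set1.
Qed.

(** At each site the moduli satisfy (x + y)^2 <= 2 x^2 + 2 y^2. *)
Lemma l2_linear (a : R[i]) u v : l2 u -> l2 v -> l2 (fun n => a * u n + v n).
Proof.
move=> lu lv; rewrite /l2/=.
pose c := 2 * (Normc.normc a) ^+ 2.
have c0 : 0 <= c by rewrite mulr_ge0 ?sqr_ge0.
apply: (@le_lt_trans _ _ (\esum_(n in [set: lattice d])
   (c%:E * ((Normc.normc (u n)) ^+ 2)%:E + 2%:E * ((Normc.normc (v n)) ^+ 2)%:E)%E)).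
  apply: le_esum => n _; rewrite -!EFinM -EFinD lee_fin.
  have h : Normc.normc (a * u n + v n) <=
      Normc.normc a * Normc.normc (u n) + Normc.normc (v n).
    by rewrite -Normc.normcM; exact: le_normcD.
  have p0 := normc_ge0 (a * u n + v n); rewrite /c -mulrA -exprMn.
  move: h p0; set p := Normc.normc _; set x := _ * _; set y := Normc.normc _.
  move=> h p0; apply: (@le_trans _ _ ((x + y) ^+ 2)).
    by rewrite ler_sqr ?nnegrE// (le_trans p0).
  rewrite -subr_ge0.
  have -> : 2 * x ^+ 2 + 2 * y ^+ 2 - (x + y) ^+ 2 = (x - y) ^+ 2 by ring.
  exact: sqr_ge0.
have scale (k : R) (b : lattice d -> R) : 0 <= k -> (forall n, 0 <= b n) ->
    (\esum_(n in [set: lattice d]) (b n)%:E < +oo)%E ->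
    (\esum_(n in [set: lattice d]) (k%:E * (b n)%:E) < +oo)%E.
  move=> k0 b0 blt; apply: (@le_lt_trans _ _ (k%:E * \esum_(n in [set: lattice d]) (b n)%:E)%E).
    rewrite ge_ereal_sup => //= _ [X [finX XI]] <-.
    rewrite -ge0_mule_fsumr; last by move=> n; rewrite lee_fin.
    apply: lee_wpmul2l; first by rewrite lee_fin.
    by apply: esum_ge; exists X.
  apply: lte_mul_pinfty => //.
rewrite esumD.
- by rewrite lte_add_pinfty// scale// => n; rewrite sqr_ge0.
- by move=> n _; rewrite -EFinM lee_fin mulr_ge0 ?sqr_ge0.
- by move=> n _; rewrite -EFinM lee_fin mulr_ge0 ?sqr_ge0.
Qed.

End SquareSummable.

Section UnitaryGroupSolution.
Context {R : realType} {d : nat}.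
Variables (V : lattice d -> R).
Variable (U : R -> (lattice d -> R[i]) -> lattice d -> R[i]).
Hypothesis U_exp : is_exp_mit (anderson V) (anderson_dom V) U.
Implicit Types (u v : lattice d -> R[i]).

Local Notation e0 := (std_basis 0 : lattice d -> R[i]).

Lemma l2_std_basis m : l2 (std_basis m : lattice d -> R[i]).
Proof. by rewrite /l2/= l2sqnorm_std_basis ltry. Qed.

Lemma l2_cst0 : l2 ((fun=> 0) : lattice d -> R[i]).
Proof.
have := l2_linear (-1) (l2_std_basis 0) (l2_std_basis 0).
by under eq_fun do rewrite mulN1r addNr.
Qed.

Lemma l2_scale (a : R[i]) u : l2 u -> l2 (fun n => a * u n).
Proof.
by move=> lu; have := l2_linear a lu l2_cst0; under eq_fun do rewrite addr0.
Qed.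

Lemma l2_sum (I : Type) (r : seq I) (F : I -> lattice d -> R[i]) :
  (forall i, l2 (F i)) -> l2 (fun n => \sum_(i <- r) F i n).
Proof.
move=> lF; elim: r => [|i r IH].
  by under eq_fun do rewrite big_nil; exact: l2_cst0.
under eq_fun do rewrite big_cons -[F i _]mul1r.
exact: l2_linear.
Qed.

Lemma l2_multiplication_std_basis : l2 (multiplication V e0).
Proof.
have -> : multiplication V e0 = (fun n => (V 0)%:C * e0 n).
  apply/funext => n; rewrite /multiplication /std_basis.
  by case: eqP => [->//|]; rewrite !mulr0.
by apply: l2_scale; exact: l2_std_basis.
Qed.

Lemma l2_anderson_std_basis : l2 (anderson V e0).
Proof.
have -> : anderson V e0 = (fun n => 1 * laplacian e0 n + multiplication V e0 n).
  by apply/funext => n; rewrite mul1r.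
apply: l2_linear; last exact: l2_multiplication_std_basis.
have -> : laplacian e0 = (fun n => \sum_(e <- unit_vectors) std_basis (- e) n).
  apply/funext => n; rewrite laplacianE; apply: eq_bigr => e _.
  by rewrite /std_basis addr_eq0.
by apply: l2_sum => e; exact: l2_std_basis.
Qed.

Let UG : unitary_group U. Proof. by case: U_exp. Qed.

Lemma ug_scale s (a : R[i]) u : l2 u -> U s (fun n => a * u n) = (fun n => a * U s u n).
Proof.
move=> lu; have := ug_linear UG s (a - 1) lu lu.
have -> : (fun n => (a - 1) * u n + u n) = (fun n => a * u n).
  by apply/funext => n; ring.
by move=> ->; apply/funext => n; ring.
Qed.

(* U s commutes with the group, hence with its generator. *)
Lemma generator_orbit s u v : l2 u -> l2 v ->
  anderson_dom V u -> v = (fun n => - 'i%C * anderson V u n) ->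
  l2sqnorm (fun n => (t^-1)%:C * (U t (U s u) n - U s u n) - U s v n)
    @[t --> 0^'] --> (0 : \bar R).
Proof.
move=> lu lv Du vE; have [_ gen] := U_exp.
have cv := (gen u v lu lv).2 (conj Du vE).
apply: cvg_trans cv; apply: near_eq_cvg; apply: nearW => t /=.
set w := fun n => -1 * u n + U t u n.
have lw : l2 w by apply: l2_linear => //; exact: (ug_l2 UG).
have lz : l2 (fun n => (t^-1)%:C * w n) by exact: l2_scale.
have -> : (fun n => (t^-1)%:C * (U t u n - u n) - v n) =
    (fun n => -1 * v n + (t^-1)%:C * w n).
  by apply/funext => n; rewrite /w; ring.
rewrite -[LHS](ug_isometry UG s (l2_linear (-1) lv lz)).
rewrite (ug_linear UG s (-1) lv lz) (ug_scale s _ lw).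
rewrite (ug_linear UG s (-1) lu (ug_l2 UG t lu)).
rewrite -(ug_add UG s t lu) addrC (ug_add UG t s lu).
by congr l2sqnorm; apply/funext => n; ring.
Qed.

Lemma l2_cvg_component (f : R -> lattice d -> R[i]) (n : lattice d) :
  l2sqnorm (f t) @[t --> 0^'] --> (0 : \bar R) ->
  complex.Re (f t n) @[t --> 0^'] --> (0 : R) /\
  complex.Im (f t n) @[t --> 0^'] --> (0 : R).
Proof.
move=> f0.
have small (e : R) : 0 < e -> \forall t \near 0^', cle (f t n) e.
  move=> e0.
  have e2 : 0 < e ^+ 2 by rewrite exprn_gt0.
  have : \forall t \near (0 : R)^', (l2sqnorm (f t) < (e ^+ 2)%:E)%E.
    exact: f0 _ (@nbhs_open_ereal_lt R 0 (fun=> e ^+ 2) e2).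
  apply: filterS => t /= ft; apply: cle_normc.
  rewrite -ler_sqr ?nnegrE ?normc_ge0 ?(ltW e0)// -lee_fin.
  exact: le_trans (le_l2sqnorm _ _) (ltW ft).
split; apply/cvgrPdist_le => e e0; have := small e e0; apply: filterS => t [h1 h2].
- by rewrite sub0r normrN.
- by rewrite sub0r normrN.
Qed.

(** The vector [e_0] has finite support, hence lies in the domain for every [V], and so does its
    orbit. Convergence of difference quotients in l2 implies convergence at each site, which gives
    the equation there. *)
Lemma unitary_local_solution r : local_solution V r (fun s => U s e0).
Proof.
have le0 := l2_std_basis 0.
split.
- move=> s n.
  rewrite -(@expr_le1 _ 2)// ?normc_ge0// -lee_fin.
  apply: le_trans (le_l2sqnorm _ _) _.
  by rewrite (ug_isometry UG)// l2sqnorm_std_basis.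
- by move=> n; rewrite (ug_0 UG).
- move=> s n _.
  set v := fun n => - 'i%C * anderson V e0 n.
  have lv : l2 v by apply: l2_scale; exact: l2_anderson_std_basis.
  have Du : anderson_dom V e0 by split => //; exact: l2_multiplication_std_basis.
  have cs := @generator_orbit s e0 v le0 lv Du erefl.
  have [_ gen] := U_exp.
  (* Read from limit to domain, the equivalence at [U s e0] identifies the derivative of the orbit
     as - i times the Hamiltonian applied to [U s e0]. *)
  have [_ UvE] := (gen _ _ (ug_l2 UG s le0) (ug_l2 UG s lv)).1 cs.
  have [cRe cIm] := l2_cvg_component n cs.
  have -> : - 'i%C * (\sum_(e <- unit_vectors) U s e0 (n + e) + (V n)%:C * U s e0 n) =
      U s v n.
    by rewrite UvE /anderson laplacianE.
  have derive_cvg (g : R -> R) (l : R) :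
      t^-1 * (g (t + s) - g s) - l @[t --> 0^'] --> (0 : R) -> is_derive s 1 g l.
    move=> gl.
    have gl' : t^-1 *: (g (t *: (1 : R) + s) - g s) @[t --> 0^'] --> l.
      have hl : (fun _ : R => l) @ (0 : R)^' --> l by exact: cvg_cst.
      have -> : (fun t : R => t^-1 *: (g (t *: (1 : R) + s) - g s)) =
          (fun t => t^-1 * (g (t + s) - g s) - l) \+ (fun=> l).
        by apply/funext => t; rewrite /GRing.scale/= mulr1 subrK.
      by rewrite -[X in _ --> X](add0r l); exact: cvgD.
    by split; [apply: cvgP gl'|exact: cvg_lim gl'].
  split; apply: derive_cvg.
  + apply: cvg_trans cRe; apply: near_eq_cvg; apply: nearW => t /=.
    by rewrite (ug_add UG t s le0) cReD cReN cReM/= mul0r subr0 cReD cReN.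
  + apply: cvg_trans cIm; apply: near_eq_cvg; apply: nearW => t /=.
    by rewrite (ug_add UG t s le0) cImD cImN cImM/= mul0r addr0 cImD cImN.
Qed.

End UnitaryGroupSolution.

(** * Approximation of infinite-volume amplitudes by boxes *)

Section Approximation.
Context {R : realType} {d : nat}.
Local Notation C := (size (@unit_vectors d))%:R.

Lemma exp_tail_cvg0 (M x : R) : M * x ^+ r / r`!%:R @[r --> \oo] --> 0.
Proof.
have -> : (fun r => M * x ^+ r / r`!%:R) = (fun r => M * exp_coeff x r).
  by apply/funext => r; rewrite -mulrA.
rewrite -[X in _ --> X](mulr0 M); apply: cvgMr.
exact: cvg_series_cvg_0 (is_cvg_series_exp_coeff x).
Qed.

(** Started at the centre of the box of radius [r], this is measurable in the potential and
    approximates any solution valid on all of the lattice. *)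
Definition centred_solution (r : nat) (V : lattice d -> R) : R -> lattice d -> R[i] :=
  box_solution (@box_site d r) V (sval (cid (@box_center d r))).

Lemma centred_local_solution r V : local_solution V r (centred_solution r V).
Proof.
rewrite /centred_solution; case: cid => b0 [b0_inner b0_site] /=.
have := @box_local_solution _ _ _ _ (@box_site_inj d r) V b0 r
  (fun n => inner_siteP b0_inner).
by rewrite b0_site; under eq_fun do rewrite add0r.
Qed.

Lemma cmeasurable_centred_solution disp (T : measurableType disp)
    (V : T -> lattice d -> R) r s n :
  (forall m, measurable_fun setT (fun w => V w m)) ->
  cmeasurable (fun w => centred_solution r (V w) s n).
Proof.
by move=> mV; apply: cmeasurable_box_solution => //; exact: box_site_inj.
Qed.

Lemma ccvg_centred_solution V u (t : R) : (forall r, local_solution V r u) ->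
  0 <= t -> ccvg (fun r => centred_solution r V t 0) (u t 0).
Proof.
move=> us t0; apply: (ccvg_cle (e := fun r => 2 * (C * t) ^+ r / r`!%:R)).
  move=> r; apply: local_solution_comparison t0 => //.
  exact: centred_local_solution.
exact: exp_tail_cvg0.
Qed.

(** Measurability in [w] is inherited from the box amplitudes, of which [u] at the origin is the
    pointwise limit. *)
Lemma cmeasurable_local_solution disp (T : measurableType disp)
    (V : T -> lattice d -> R) (u : T -> R -> lattice d -> R[i]) (t : R) :
  (forall m, measurable_fun setT (fun w => V w m)) ->
  (forall w r, local_solution (V w) r (u w)) -> 0 <= t ->
  cmeasurable (fun w => u w t 0).
Proof.
move=> mV us t0.
apply: (cmeasurable_ccvg _ (fun w => ccvg_centred_solution (us w) t0)) => r.
exact: cmeasurable_centred_solution.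
Qed.

(* Time reversal combined with complex conjugation preserves the equation. *)
Lemma local_solution_reversal V (u : R -> lattice d -> R[i]) (t : R) : (forall r, local_solution V r u) ->
  0 <= t -> u (- t) 0 = ((u t 0)^*)%C.
Proof.
move=> us t0.
have vs r : local_solution V r (fun s n => ((u (- s) n)^*)%C).
  have [ub ui ud] := us r; split.
  - by move=> s n; move: (ub (- s) n); case: (u _ _) => a b /=; rewrite sqrrN.
  - by move=> n; rewrite oppr0 ui; case: eqP => _; rewrite ?conjc1 ?conjc0.
  - move=> s n nr; have [h1 h2] := ud (- s) n nr.
    have comp (f : R -> R) (l : R) : is_derive (- s) 1 f l ->
        is_derive s 1 (fun x => f (- x)) (- l).
      move=> fl.
      have := is_derive1_comp fl (is_deriveN (is_derive_id s (1 : R))).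
      by move=> /is_derive_eq; apply; rewrite mulrN1.
    have -> : \sum_(e <- unit_vectors) ((u (- s) (n + e))^*)%C =
        ((\sum_(e <- unit_vectors) u (- s) (n + e))^*)%C.
      by rewrite rmorph_sum.
    move: h1 h2; set S := \sum_(e <- _) _ => h1 h2.
    split.
    + under eq_fun do rewrite cReJ.
      have := comp _ _ h1; move=> /is_derive_eq; apply.
      rewrite !(cReM, cImM, cReD, cImD, cReN, cImN, cReJ, cImJ)/=; ring.
    + under eq_fun do rewrite cImJ.
      have := is_deriveN (comp _ _ h2); move=> /is_derive_eq; apply.
      rewrite !(cReM, cImM, cReD, cImD, cReN, cImN, cReJ, cImJ)/=; ring.
(* Both solutions are limits of the same box amplitudes at the origin, hence agree there. *)
rewrite (ccvg_unique (ccvg_centred_solution us t0) (ccvg_centred_solution vs t0)).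
by rewrite conjcK.
Qed.

End Approximation.

(** * Weak convergence from distribution functions *)

Section HellyBray.
Context {R : realType}.

(** As a function of [q] this is the distribution function of the point mass at [x], so [grid_sum]
    and [escape] apply to it as well as to the distribution function of a mean. *)
Definition below (x q : R) : R := ((x <= q)%R : nat)%:R.

(** The points form a countable family, so almost sure convergence at each of them holds for all of
    them simultaneously. *)
Definition grid (K m i : nat) : R := i%:R / m.+1%:R - K%:R.

Definition grid_sum (f F : R -> R) (K m : nat) : R :=
  \sum_(0 <= i < (K.*2 * m.+1)%N) f (grid K m i) * (F (grid K m i.+1) - F (grid K m i)).

(* The mass of the complement of ]-K, K] for the distribution function F. *)
Definition escape (F : R -> R) (K m : nat) : R :=
  1 - (F (grid K m (K.*2 * m.+1)) - F (grid K m 0)).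

Lemma grid_first K m : grid K m 0 = - K%:R.
Proof. by rewrite /grid mul0r sub0r. Qed.

Lemma grid_last K m : grid K m (K.*2 * m.+1) = K%:R.
Proof.
by rewrite /grid natrM mulfK ?pnatr_eq0// -addnn natrD addrK.
Qed.

Lemma gridS K m i : grid K m i.+1 = grid K m i + m.+1%:R^-1.
Proof. by rewrite /grid -natr1 mulrDl mul1r addrAC. Qed.

(** The case of a point mass. If [x] lies in ]-K, K], only its cell counts, and [f] varies there by
    at most [c / m.+1]; otherwise the grid sum vanishes and the escape term is 1. *)
Lemma grid_sum_approx (f : R -> R) (c : R) (K m : nat) (x : R) :
  (forall y, `|f y| <= 1) -> (forall y z, `|f y - f z| <= c * `|y - z|) ->
  `|f x - grid_sum f (below x) K m| <=
    c / m.+1%:R + escape (below x) K m.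
Proof.
move=> f1 fc; set F := below x.
have m0 : (0 : R) < m.+1%:R^-1 by rewrite invr_gt0 ltr0n.
have c0 : 0 <= c.
  by have := fc 1 0; rewrite subr0 normr1 mulr1; apply: le_trans.
pose D := F (grid K m (K.*2 * m.+1)) - F (grid K m 0).
have dF i : 0 <= F (grid K m i.+1) - F (grid K m i).
  rewrite subr_ge0 /F /below ler_nat; case: (leP x (grid K m i)) => //= xi.
  by rewrite gridS (le_trans xi)// lerDl ltW.
have D1 : D <= 1.
  apply: (@le_trans _ _ (F (grid K m (K.*2 * m.+1)))); first by rewrite lerBlDr lerDl ler0n.
  by rewrite /F /below -[leRHS]/(1%:R) ler_nat leq_b1.
have DE : D = \sum_(0 <= i < (K.*2 * m.+1)%N) (F (grid K m i.+1) - F (grid K m i)).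
  by rewrite (@telescope_sumr _ 0 _ (fun i => F (grid K m i))).
have D0 : 0 <= D by rewrite DE; apply: sumr_ge0 => i _; exact: dF.
have -> : f x - grid_sum f F K m = f x * (1 - D) +
    \sum_(0 <= i < (K.*2 * m.+1)%N)
      (f x - f (grid K m i)) * (F (grid K m i.+1) - F (grid K m i)).
  under [X in _ = _ + X]eq_bigr do rewrite mulrBl.
  rewrite big_split/= sumrN -mulr_sumr -DE /grid_sum; ring.
rewrite [leRHS]addrC; apply: le_trans (ler_normD _ _) _; apply: lerD; last first.
  apply: le_trans (ler_norm_sum _ _ _) _.
  apply: (@le_trans _ _ (\sum_(0 <= i < (K.*2 * m.+1)%N)
      c / m.+1%:R * (F (grid K m i.+1) - F (grid K m i)))).
    apply: ler_sum => i _; rewrite normrM (ger0_norm (dF i)).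
    rewrite /F /below; case: (leP x (grid K m i)) => [xi|xi].
      by rewrite gridS (le_trans xi) ?subrr ?mulr0// lerDl ltW.
    case: (leP x (grid K m i.+1)) => [xS|_]; last by rewrite subrr !mulr0.
    rewrite subr0 !mulr1; apply: le_trans (fc _ _) _.
    rewrite ler_wpM2l// gtr0_norm ?subr_gt0//.
    by move: xS; rewrite gridS lerBlDl.
  rewrite -mulr_sumr -DE ler_piMr// divr_ge0// ?ler0n//.
rewrite normrM (@ger0_norm _ (1 - D)) ?subr_ge0//.
by rewrite ler_piMl// subr_ge0.
Qed.

Definition bounded_measurable (f : R -> R) : Prop :=
  measurable_fun setT f /\ exists M, forall x, `|f x| <= M.

(** The common structure of integration against [nu] and of averaging over eigenvalues; a single
    estimate then serves both. *)
Record mean (E : (R -> R) -> R) : Prop := Mean {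
  mean_linear : forall a f g, bounded_measurable f -> bounded_measurable g ->
    E (fun x => a * f x + g x) = a * E f + E g ;
  mean_normr : forall f g, bounded_measurable f -> bounded_measurable g ->
    (forall x, `|f x| <= g x) -> `|E f| <= E g ;
  mean_1 : E (fun=> 1) = 1 }.

Lemma bounded_measurable_cst (a : R) : bounded_measurable (fun=> a).
Proof. by split; [exact: measurable_cst|exists `|a|]. Qed.

Lemma bounded_measurable_linear (a : R) f g : bounded_measurable f ->
  bounded_measurable g -> bounded_measurable (fun x => a * f x + g x).
Proof.
move=> [mf [M fM]] [mg [M' gM]]; split.
  by apply: measurable_funD => //; exact: measurable_funM.
exists (`|a| * M + M') => x; apply: le_trans (ler_normD _ _) _.
by rewrite normrM lerD// ler_wpM2l.
Qed.

Lemma bounded_measurable_sum (I : Type) (r : seq I) (a : I -> R) (f : I -> R -> R) :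
  (forall i, bounded_measurable (f i)) ->
  bounded_measurable (fun x => \sum_(i <- r) a i * f i x).
Proof.
move=> bf; elim: r => [|i r IH].
  by under eq_fun do rewrite big_nil; exact: bounded_measurable_cst.
by under eq_fun do rewrite big_cons; exact: bounded_measurable_linear.
Qed.

Lemma bounded_measurable_below q : bounded_measurable (fun x => below x q).
Proof.
split; last first.
  by exists 1 => x; rewrite /below normr_nat -[leRHS]/(1%:R) ler_nat leq_b1.
have -> : (fun x => below x q) = \1_(`]-oo, q]%classic).
  apply/funext => x; rewrite indicE /below; congr (_%:R).
  by apply: congr1; apply/idP/idP; rewrite inE/= in_itv.
exact: measurable_indic.
Qed.

Lemma mean_sum E (I : Type) (r : seq I) (a : I -> R) (f : I -> R -> R) : mean E ->
  (forall i, bounded_measurable (f i)) ->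
  E (fun x => \sum_(i <- r) a i * f i x) = \sum_(i <- r) a i * E (f i).
Proof.
move=> hE bf; elim: r => [|i r IH].
  rewrite big_nil; under eq_fun do rewrite big_nil.
  have b1 := bounded_measurable_cst 1.
  have := mean_linear hE (-1) b1 b1; under eq_fun do rewrite mulr1 addNr.
  rewrite (mean_1 hE) mulr1 addNr; exact.
rewrite big_cons -IH; under eq_fun do rewrite big_cons.
by rewrite (mean_linear hE)//; exact: bounded_measurable_sum.
Qed.

Lemma mean_grid_sum E (f : R -> R) (c : R) (K m : nat) : mean E ->
  measurable_fun setT f ->
  (forall y, `|f y| <= 1) -> (forall y z, `|f y - f z| <= c * `|y - z|) ->
  `|E f - grid_sum f (fun q => E (below ^~ q)) K m| <=
    c / m.+1%:R + escape (fun q => E (below ^~ q)) K m.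
Proof.
move=> hE mf f1 fc.
have bf : bounded_measurable f by split => //; exists 1.
have b1 := bounded_measurable_cst 1.
have bb := bounded_measurable_below.
pose db i x := -1 * below x (grid K m i) + below x (grid K m i.+1).
have bdb i : bounded_measurable (db i) by exact: bounded_measurable_linear.
have Edb i : E (db i) = E (below ^~ (grid K m i.+1)) - E (below ^~ (grid K m i)).
  by rewrite (mean_linear hE)// mulN1r addrC.
pose h x := \sum_(0 <= i < (K.*2 * m.+1)%N) f (grid K m i) * db i x.
have bh : bounded_measurable h by exact: bounded_measurable_sum.
have hE' x : h x = grid_sum f (below x) K m.
  by apply: eq_bigr => i _; rewrite /db mulN1r addrC.
have -> : grid_sum f (fun q => E (below ^~ q)) K m = E h.
  by rewrite (mean_sum _ _ hE)//; apply: eq_bigr => i _; rewrite Edb.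
have -> : E f - E h = E (fun x => -1 * h x + f x).
  by rewrite (mean_linear hE)// mulN1r addrC.
(* [g] is the error bound of [grid_sum_approx] spelt as a linear combination of constants and
   [below] functions, to which [E] can be applied. *)
pose g1 x := -1 * below x (grid K m (K.*2 * m.+1)) + (c / m.+1%:R * 1 + 1).
pose g x := 1 * below x (grid K m 0) + g1 x.
have bc := bounded_measurable_linear (c / m.+1%:R) b1 b1.
have bg1 : bounded_measurable g1 by exact: bounded_measurable_linear.
have bg : bounded_measurable g by exact: bounded_measurable_linear.
have -> : c / m.+1%:R + escape (fun q => E (below ^~ q)) K m = E g.
  rewrite /g (mean_linear hE)// /g1 (mean_linear hE)// (mean_linear hE)//.
  by rewrite (mean_1 hE) /escape; ring.
apply: (mean_normr hE) => // [|x]; first exact: bounded_measurable_linear.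
have -> : g x = c / m.+1%:R + escape (below x) K m.
  by rewrite /g /g1 /escape; ring.
by rewrite mulN1r addrC hE'; exact: grid_sum_approx.
Qed.

Lemma mean_Rintegral (nu : probability R R) : mean (fun f => \int[nu]_x f x).
Proof.
split; last exact: Rintegral_constant.
- move=> a f g [mf [M fM]] [mg [M' gM]].
  have fi := integrable_bounded nu mf fM; have gi := integrable_bounded nu mg gM.
  rewrite RintegralD// ?RintegralZl//.
  by apply: (integrable_bounded nu (M := `|a| * M)) => [|x];
    [exact: measurable_funM|rewrite normrM ler_wpM2l].
- move=> f g [mf [M fM]] [mg [M' gM]] fg.
  have fi := integrable_bounded nu mf fM; have gi := integrable_bounded nu mg gM.
  apply: le_trans (le_normr_Rintegral measurableT fi) _.
  have ai : nu.-integrable setT (EFin \o (fun x => `|f x|)).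
    by apply: (integrable_bounded nu (M := M)) => [|x];
      [exact: measurableT_comp|rewrite normr_id].
  by apply: le_Rintegral => // x _; exact: fg.
Qed.

Lemma mean_average (N : nat) (e : 'I_N -> R) : (0 < N)%N ->
  mean (fun f => (\sum_j f (e j)) / N%:R).
Proof.
move=> N0; have N1 : (N%:R : R) != 0 by rewrite pnatr_eq0 -lt0n.
split.
- by move=> a f g _ _; rewrite big_split/= -mulr_sumr mulrDl mulrA.
- move=> f g _ _ fg; rewrite normrM normfV normr_nat ler_wpM2r ?invr_ge0 ?ler0n//.
  by apply: le_trans (ler_norm_sum _ _ _) _; exact: ler_sum.
- by rewrite sumr_const card_ord mulfV.
Qed.

(** [K] and [m] are fixed from [nu] and [f] alone; only finitely many values of the distribution
    functions then matter as [k] grows. The escaping mass of [E k] converges to that of [nu], so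
    none is lost at infinity. *)
Lemma helly_bray (nu : probability R R) (E : nat -> (R -> R) -> R)
    (f : R -> R) (c : R) : (forall k, mean (E k)) ->
  (forall K m i, E k (below ^~ (grid K m i)) @[k --> \oo] -->
     \int[nu]_x below x (grid K m i)) ->
  measurable_fun setT f ->
  (forall y, `|f y| <= 1) -> (forall y z, `|f y - f z| <= c * `|y - z|) ->
  E k f @[k --> \oo] --> \int[nu]_x f x.
Proof.
move=> hE Ecvg mf f1 fc.
have hnu := mean_Rintegral nu.
pose F q := \int[nu]_x below x q.
have F_cvg (x : nat -> R) (l : R) : (forall y, below y (x K) @[K --> \oo] --> l) ->
    F (x K) @[K --> \oo] --> l.
  move=> xl; rewrite -[l](Rintegral_constant nu).
  apply: (@Rintegral_dominated _ _ _ nu (fun K y => below y (x K)) (fun=> l) 1).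
  - by move=> K; have [] := bounded_measurable_below (x K).
  - exact: measurable_cst.
  - by move=> K y; rewrite /below normr_nat -[leRHS]/(1%:R) ler_nat leq_b1.
  - by apply: aeW => y; exact: xl.
have F_escape : 1 - (F K%:R - F (- K%:R)) @[K --> \oo] --> (0 : R).
  have -> : (0 : R) = 1 - (1 - 0) by ring.
  apply: cvgB; first exact: cvg_cst.
  apply: cvgB.
  - apply: (@F_cvg (fun K => K%:R)) => y; apply: cvg_near_cst.
    near=> K; rewrite /below; have -> // : y <= K%:R.
    by near: K; exact: nbhs_infty_ger.
  - apply: (@F_cvg (fun K => - K%:R)) => y; apply: cvg_near_cst.
    near=> K; rewrite /below lerNr leNgt; have -> // : - y < K%:R.
    by near: K; exact: nbhs_infty_gtr.
apply/cvgrPdist_le => eps eps0.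
(* Six errors of this size are added: two for [nu], three for [E k], and one between the grid
   sums. *)
have e8 : 0 < eps / 8 by rewrite divr_gt0.
have [K FK] : exists K, 1 - (F K%:R - F (- K%:R)) <= eps / 8.
  move/cvgrPdist_le : F_escape => /(_ _ e8) [K _ /(_ K (leqnn K))/=].
  by rewrite sub0r normrN => h; exists K; apply: le_trans h; exact: ler_norm.
have [m cm] : exists m, c / m.+1%:R <= eps / 8.
  have : c / m.+1%:R @[m --> \oo] --> (0 : R).
    by rewrite -[X in _ --> X](mulr0 c); apply: cvgMr; exact: cvg_harmonic.
  move/cvgrPdist_le => /(_ _ e8) [m _ /(_ m (leqnn m))/=].
  by rewrite sub0r normrN => h; exists m; apply: le_trans h; exact: ler_norm.
have escF : escape F K m <= eps / 8 by rewrite /escape grid_first grid_last.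
pose Fk k q := E k (below ^~ q).
have gk : grid_sum f (Fk k) K m @[k --> \oo] --> grid_sum f F K m.
  rewrite /grid_sum; apply: (cvg_big (op := +%R)) => [|i _]; first exact: add_continuous.
  by apply: cvgMr; apply: cvgB; exact: Ecvg.
have ek : escape (Fk k) K m @[k --> \oo] --> escape F K m.
  by apply: cvgB; [exact: cvg_cst|apply: cvgB; exact: Ecvg].
move/cvgrPdist_le : gk => /(_ _ e8) gk; move/cvgrPdist_le : ek => /(_ _ e8) ek.
near=> k.
have h1 : `|grid_sum f F K m - grid_sum f (Fk k) K m| <= eps / 8 by near: k.
have h2 : `|escape F K m - escape (Fk k) K m| <= eps / 8 by near: k.
have := mean_grid_sum K m (hE k) mf f1 fc; rewrite -/(Fk k).
have := mean_grid_sum K m hnu mf f1 fc; rewrite -/F.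
move: h1 h2 cm escF; move: (c / _) (grid_sum f F K m) (grid_sum f (Fk k) K m)
  (escape F K m) (escape (Fk k) K m) (\int[nu]_x f x) (E k f) => a b b' s s' I J.
rewrite !ler_distl => /andP[? ?] /andP[? ?] ? ? /andP[? ?] /andP[? ?].
by apply/andP; split; lra.
Unshelve. all: by end_near. Qed.

End HellyBray.

(** * Normalised traces and the density of states *)

Section DensityOfStates.
Context {R : realType} {d : nat}.

Lemma cos_sin_lipschitz (t y z : R) : `|cos (t * y) - cos (t * z)| <= `|t| * `|y - z|
  /\ `|sin (t * y) - sin (t * z)| <= `|t| * `|y - z|.
Proof.
wlog yz : y z / z <= y => [H|].
  case: (leP z y) => [|/ltW] zy; first exact: H.
  rewrite (distrC y) (distrC (cos _)) (distrC (sin _)); exact: H.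
rewrite (@ger0_norm _ (y - z)) ?subr_ge0//.
have hd (s : R) : is_derive s 1 (fun s : R => t * (z + s)) t.
  have := is_deriveZ t (is_deriveD (is_derive_cst z s (1 : R)) (is_derive_id s (1 : R))).
  by move=> /is_derive_eq; apply; rewrite /GRing.scale/= add0r mulr1.
have key (g dg : R -> R) : (forall x : R, is_derive x 1 g (dg x)) ->
    (forall x, `|dg x| <= 1) -> `|g (t * y) - g (t * z)| <= `|t| * (y - z).
  move=> gd dg1.
  have := @mean_value_pow R (fun s => g (t * (z + s)) - g (t * z))
    (fun s => dg (t * (z + s)) * t) `|t| (y - z) 0.
  rewrite /= (addrC z (y - z)) subrK expr1 divr1; apply.
  - by rewrite subr_ge0.
  - move=> s.
    have := is_deriveB (@is_derive1_comp _ g (fun s => t * (z + s)) s _ _ (gd _) (hd s))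
      (is_derive_cst (g (t * z)) s (1 : R)).
    by move=> /is_derive_eq; apply; rewrite subr0.
  - by rewrite addr0 subrr.
  - by move=> s _; rewrite expr0 mulr1 normrM ler_piMl.
split.
- apply: (key cos (fun x => - sin x)) => x; rewrite normrN ler_norml.
  by rewrite sin_geN1 sin_le1.
- by apply: (key sin cos) => x; rewrite ler_norml cos_geN1 cos_le1.
Qed.

Lemma Rintegral_below (nu : probability R R) q :
  \int[nu]_x below x q = fine (nu `]-oo, q]%classic).
Proof.
have -> : (fun x => below x q) = \1_(`]-oo, q]%classic).
  apply/funext => x; rewrite indicE /below; congr (_%:R).
  by apply: congr1; apply/idP/idP; rewrite inE/= in_itv.
by rewrite /Rintegral integral_indic// setIT.
Qed.

Lemma anderson_boxE (V : lattice d -> R) L :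
  anderson_box V L = finite_volume (@box_site d L) V.
Proof. by []. Qed.

Lemma anderson_box_herm (V : lattice d -> R) L : anderson_box V L \is hermsymmx.
Proof. by rewrite anderson_boxE finite_volume_herm//; exact: box_site_inj. Qed.

Lemma card_box_gt0 L : (0 < #|@box d L|)%N.
Proof. by rewrite card_box expn_gt0 addn1. Qed.

Definition mean_trace (V : lattice d -> R) (t : R) (L : nat) : R[i] :=
  (#|@box d L|%:R^-1)%:C * \tr (propagator (anderson_box V L) t).

(** Eigenvalue counts and traces are the same average over energies, applied to [below] in one case
    and to cosine and sine in the other. *)
Lemma mean_trace_cvg (nu : probability R R) V t :
  (forall K m i, (eigenvalue_count (anderson_box V L) (grid K m i))%:R
     / ((2 * L + 1) ^ d)%N%:R @[L --> \oo] --> fine (nu `]-oo, grid K m i]%classic)) ->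
  ccvg (mean_trace V t) (fourier nu t).
Proof.
move=> Vnu.
pose e L := energy (anderson_box V L).
pose E L (f : R -> R) := (\sum_j f (e L j)) / #|@box d L|%:R.
have hE L : mean (E L) by apply: mean_average; exact: card_box_gt0.
have Ecvg K m i : E L (below ^~ (grid K m i)) @[L --> \oo] -->
    \int[nu]_x below x (grid K m i).
  rewrite Rintegral_below; apply: cvg_trans (Vnu K m i).
  apply: near_eq_cvg; apply: nearW => L.
  by rewrite /E -card_box eigenvalue_countE ?anderson_box_herm// natr_sum.
have mt : measurable_fun setT (fun x : R => - (t * x)).
  by apply: measurableT_comp => //; exact: measurable_funM.
have [m1 m2] := cmeasurable_cexpi mt.
split.
- have -> : (fun L => complex.Re (mean_trace V t L)) =
      (fun L => E L (fun x => cos (- (t * x)))).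
    apply/funext => L; rewrite /mean_trace cReM/= mul0r subr0 mulrC.
    by rewrite propagator_trace ?anderson_box_herm// cRe_sum.
  apply: (helly_bray (c := `|t|)) => // y.
    by rewrite ler_norml cos_geN1 cos_le1.
  by move=> z; have := cos_sin_lipschitz (- t) y z; rewrite normrN !mulNr => -[].
- have -> : (fun L => complex.Im (mean_trace V t L)) =
      (fun L => E L (fun x => sin (- (t * x)))).
    apply/funext => L; rewrite /mean_trace cImM/= mul0r addr0 mulrC.
    by rewrite propagator_trace ?anderson_box_herm// cIm_sum.
  apply: (helly_bray (c := `|t|)) => // y.
    by rewrite ler_norml sin_geN1 sin_le1.
  by move=> z; have := cos_sin_lipschitz (- t) y z; rewrite normrN !mulNr => -[].
Qed.

Lemma cle_mean_trace (V : lattice d -> R) t L : cle (mean_trace V t L) 1.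
Proof.
have N0 : (0 : R) < #|@box d L|%:R by rewrite ltr0n card_box_gt0.
have : cle (\tr (propagator (anderson_box V L) t)) #|@box d L|%:R.
  have := @cle_sum R _ (index_enum 'I_#|@box d L|)
    (fun a => propagator (anderson_box V L) t a a) 1.
  rewrite mulr1 -[size _]/(size (index_enum _)) -sum1_size sum1_card card_ord; apply.
  move=> a _; apply: cle_normc; apply: normc_propagator.
rewrite /mean_trace /cle cReM cImM/= !mul0r subr0 addr0 !normrM.
rewrite gtr0_norm ?invr_gt0// => -[h1 h2].
by rewrite !(mulrC _^-1) !ler_pdivrMr// !mul1r.
Qed.

Context {disp : measure_display} {T : measurableType disp}.
Variables (P : probability T R) (X : lattice d -> {RV P >-> R}).
Variable nu : probability R R.
Hypothesis X_dosm : is_dosm X nu.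

Lemma cmeasurable_mean_trace t L :
  cmeasurable (fun w => mean_trace (fun n => X n w) t L).
Proof.
apply: cmeasurableM; first exact: cmeasurable_cst.
apply: cmeasurable_sum => a.
have := @cmeasurable_box_solution R d _ _ (@box_site_inj d L) _ _
  (fun w n => X n w) a t 0 (fun n => measurable_funP (X n)).
by under eq_fun do rewrite (box_solution0 (@box_site_inj d L)).
Qed.

Lemma expected_mean_trace_cvg t :
  ccvg (fun L => cintegral P (fun w => mean_trace (fun n => X n w) t L))
    (fourier nu t).
Proof.
have ae_cvg : {ae P, forall w, ccvg (mean_trace (fun n => X n w) t) (fourier nu t)}.
  have : {ae P, forall w, forall K m i,
      (eigenvalue_count (anderson_box (fun n => X n w) L) (grid K m i))%:R
        / ((2 * L + 1) ^ d)%N%:R @[L --> \oo] -->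
      fine (nu `]-oo, grid K m i]%classic)}.
    (* One null set for each grid point, and countably many in all. *)
    apply: ae_foralln => K; apply: ae_foralln => m; apply: ae_foralln => i.
    exact: X_dosm.
  by apply: filterS => w; exact: mean_trace_cvg.
split.
- rewrite -[X in _ --> X](Rintegral_constant P).
  apply: (Rintegral_dominated (M := 1)).
  + by move=> L; have [] := cmeasurable_mean_trace t L.
  + exact: measurable_cst.
  + by move=> L w; have [] := cle_mean_trace (fun n => X n w) t L.
  + by apply: filterS ae_cvg => w [].
- rewrite -[X in _ --> X](Rintegral_constant P).
  apply: (Rintegral_dominated (M := 1)).
  + by move=> L; have [] := cmeasurable_mean_trace t L.
  + exact: measurable_cst.
  + by move=> L w; have [] := cle_mean_trace (fun n => X n w) t L.
  + by apply: filterS ae_cvg => w [].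
Qed.

End DensityOfStates.

(** * The Fourier transform of the density of states *)

Section BoxAverages.
Context {R : realType}.

Lemma cle_limit (f : nat -> R[i]) (l z : R[i]) (b : nat -> R) (c : R) :
  ccvg f l -> (forall k, cle (f k - z) (b k)) -> b k @[k --> \oo] --> c ->
  cle (l - z) c.
Proof.
move=> [f1 f2] fb bc; split.
- have h : `|complex.Re (f k) - complex.Re z| @[k --> \oo] -->
      `|complex.Re l - complex.Re z|.
    by apply: cvg_norm; apply: cvgB => //; exact: cvg_cst.
  rewrite cReD cReN; apply: (ler_cvg_to h bc); apply: nearW => k.
  by have := @proj1 _ _ (fb k); rewrite cReD cReN.
- have h : `|complex.Im (f k) - complex.Im z| @[k --> \oo] -->
      `|complex.Im l - complex.Im z|.
    by apply: cvg_norm; apply: cvgB => //; exact: cvg_cst.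
  rewrite cImD cImN; apply: (ler_cvg_to h bc); apply: nearW => k.
  by have := @proj2 _ _ (fb k); rewrite cImD cImN.
Qed.

Lemma cle_sum_bounds (I : Type) (r : seq I) (F : I -> R[i]) (c : I -> R) :
  (forall i, cle (F i) (c i)) -> cle (\sum_(i <- r) F i) (\sum_(i <- r) c i).
Proof.
move=> H; elim: r => [|i r IH]; first by rewrite !big_nil /cle/= normr0.
by rewrite !big_cons; exact: cleD.
Qed.

(** Meant for averages over a box: sites near the boundary have only the crude bound [B], but their
    proportion will tend to 0. *)
Lemma cle_average (N : nat) (F : 'I_N -> R[i]) (z : R[i]) (good : pred 'I_N)
    (e B : R) : (0 < N)%N -> 0 <= e -> 0 <= B ->
  (forall a, good a -> cle (F a - z) e) -> (forall a, cle (F a - z) B) ->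
  cle ((N%:R^-1)%:C * \sum_a F a - z) (e + B * (1 - #|good|%:R / N%:R)).
Proof.
move=> N0 e0 B0 Fe FB.
have N1 : (0 : R) < N%:R by rewrite ltr0n.
have -> : (N%:R^-1)%:C * \sum_a F a - z = (N%:R^-1)%:C * \sum_a (F a - z).
  rewrite sumrB mulrBr sumr_const card_ord -[z *+ N]mulr_natl mulrA.
  congr (_ - _); rewrite -[LHS]mul1r; congr (_ * _).
  by rewrite -(rmorph_nat (real_complex R)) -rmorphM/= mulVf ?gt_eqF.
have : cle (\sum_a (F a - z)) (\sum_a (e + B * (~~ good a)%:R)).
  apply: cle_sum_bounds => a; have [ga|_] := boolP (good a).
    by rewrite mulr0 addr0; exact: Fe.
  by rewrite mulr1; apply: cle_trans (FB a) _; rewrite lerDr.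
have -> : \sum_a (e + B * (~~ good a)%:R) = N%:R * e + B * (N%:R - #|good|%:R).
  rewrite big_split/= sumr_const card_ord -mulr_sumr -natr_sum mulr_natl.
  rewrite -natrB; last by rewrite -[X in (_ <= X)%N]card_ord max_card.
  congr (_ + _ * _%:R).
  rewrite -[X in (X - _)%N]card_ord -(cardC good) addKn -sum1_card.
  rewrite [RHS]big_mkcond/=.
  by apply: eq_bigr => a _; rewrite inE/= -topredE/=; case: (good a).
set b := _ + _ => h.
have bE : N%:R^-1 * b = e + B * (1 - #|good|%:R / N%:R).
  by rewrite /b; field; rewrite gt_eqF.
rewrite -bE; move: h; rewrite /cle cReM cImM/= !mul0r subr0 addr0 !normrM.
rewrite (@gtr0_norm _ N%:R^-1) ?invr_gt0// => -[h1 h2].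
by split; rewrite ler_wpM2l// invr_ge0 ltW.
Qed.

Lemma box_ratio_cvg (d r : nat) :
  #|@box d L|%:R / #|@box d (L + r)|%:R @[L --> \oo] --> (1 : R).
Proof.
have h : ((2 * L + 1)%N%:R / (2 * (L + r) + 1)%N%:R : R) @[L --> \oo] --> (1 : R).
  have E (L : nat) : ((2 * L + 1)%N%:R / (2 * (L + r) + 1)%N%:R : R) =
      1 - (2 * r)%N%:R / (2 * (L + r) + 1)%N%:R.
    have n0 : ((2 * (L + r) + 1)%N%:R : R) != 0 by rewrite pnatr_eq0 addn1.
    apply: (mulIf n0); rewrite mulrBl !divfK// mul1r -natrB; last by lia.
    by congr (_%:R); lia.
  rewrite (funext E).
  rewrite -[X in _ --> X]subr0; apply: cvgB; first exact: cvg_cst.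
  rewrite -[X in _ --> X](mulr0 (2 * r)%N%:R); apply: cvgMr.
  apply: (@squeeze_cvgr _ _ _ _ (fun=> 0) (fun L => L.+1%:R^-1)).
  - apply: nearW => L; rewrite invr_ge0 ler0n/= lef_pV2 ?posrE ?ltr0n ?addn1//.
    by rewrite ler_nat; lia.
  - exact: cvg_cst.
  - exact: cvg_harmonic.
have E (L : nat) : #|@box d L|%:R / #|@box d (L + r)|%:R =
    ((2 * L + 1)%N%:R / (2 * (L + r) + 1)%N%:R : R) ^+ d.
  by rewrite !card_box expr_div_n !natrX.
rewrite (funext E) -[X in _ --> X](expr1n _ d).
exact: (continuous_cvg _ (@exprn_continuous R d 1) h).
Qed.

End BoxAverages.

(** * Comparison of the density of states with the second model *)

Section DosmComparison.
Context {R : realType} {d : nat}.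
Context {disp disp2 : measure_display}.
Context {Omega : measurableType disp} {Omega2 : measurableType disp2}.
Variables (lambda : R) (mu2 : probability R R).
Hypothesis lambda_gt0 : 0 < lambda.
Variables (P : probability Omega R) (omega : lattice d -> {RV P >-> R}).
Hypothesis omega_iid : iid omega (convolution (cauchy_prob lambda) mu2).
Variables (nu : probability R R).
Hypothesis nu_dosm : is_dosm omega nu.
Variables (P2 : probability Omega2 R) (omega2 : lattice d -> {RV P2 >-> R}).
Hypothesis omega2_iid : iid omega2 mu2.

Local Notation C := (size (@unit_vectors d))%:R.

(** The right-hand side of the theorem with [h] restricted to the box of radius [r]. It depends
    neither on the large box nor on the site, so all inner sites are compared with one quantity. *)
Definition mean_centred (t : R) (r : nat) : R[i] := (expR (- (lambda * t)))%:C *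
  cintegral P2 (fun w => centred_solution r (fun n => omega2 n w) t 0).

(** Translating [a] to the origin preserves the law of the potential, and the open ball of radius
    [r] around an inner site stays in the box; the bound does not depend on [L]. *)
Lemma inner_site_comparison (t : R) r L (a : 'I_#|@box d L|) : 0 <= t ->
  inner_site r a ->
  cle (cintegral P (fun w => propagator (anderson_box (fun n => omega n w) L) t a a) -
       mean_centred t r) (2 * (C * t) ^+ r / r`!%:R).
Proof.
move=> t0 a_inner.
have -> : (fun w => propagator (anderson_box (fun n => omega n w) L) t a a) =
    (fun w => box_solution (@box_site d L) (fun n => omega n w) a t 0).
  by apply/funext => w; rewrite (box_solution0 (@box_site_inj d L)).
pose Y n := omega (box_site a + n).
have Y_iid := iid_shift (box_site a) omega_iid.
apply: (@mean_comparison _ _ _ _ _ _ P P2 (fun w n => Y n w) (fun w n => omega2 n w) r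
  (fun w => box_solution (@box_site d L) (fun n => omega n w) a)
  (fun w => centred_solution r (fun n => omega2 n w))) => //.
- by move=> s n; apply: cmeasurable_box_solution => //; exact: box_site_inj.
- move=> w; apply: box_local_solution; first exact: box_site_inj.
  by move=> n; exact: inner_siteP.
- by move=> s n; exact: cmeasurable_centred_solution.
- by move=> w; exact: centred_local_solution.
- exact: ltW.
(* The convolution is a bare set function; the law of [omega 0] is a probability with the same
   values on Borel sets. *)
- move=> c; apply: (iid_character_ratio Y_iid (Q1 := distribution P (omega 0))
    _ omega2_iid (Q2 := mu2)) => //.
  + by move=> B mB; case: omega_iid => law _; exact: law.
  + move=> s s0; apply: (fourier_convolution lambda_gt0) => // B mB.
    by case: omega_iid => law _; exact: law.
Qed.

Lemma cle_mean_centred t r : 0 <= t -> cle (mean_centred t r) 2.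
Proof.
move=> t0; rewrite -[2]mulr1 -[X in 2 * X](mulr1 1); apply: cleM.
  rewrite /cle/= normr0 ler01 ger0_norm ?expR_ge0//; split=> //.
  by rewrite -expR0 ler_expR oppr_le0 mulr_ge0// ltW.
apply: cle_cintegral; first exact: cmeasurable_centred_solution.
by move=> w; apply: cle_normc; case: (centred_local_solution r (fun n => omega2 n w)).
Qed.

(** With [r] fixed, letting [L] grow removes the boundary sites, and the error at inner sites is all
    that remains. *)
Lemma fourier_dosm_approx t r : 0 <= t ->
  cle (fourier nu t - mean_centred t r) (2 * (C * t) ^+ r / r`!%:R).
Proof.
move=> t0; set e := 2 * _ / _.
have e0 : 0 <= e by rewrite /e divr_ge0 ?ler0n// mulr_ge0// exprn_ge0// mulr_ge0 ?ler0n.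
pose G L a w := propagator (anderson_box (fun n => omega n w) L) t a a.
have Gc L a w : cle (G L a w) 1 by apply: cle_normc; exact: normc_propagator.
have mG L a : cmeasurable (G L a).
  have := @cmeasurable_box_solution R d _ _ (@box_site_inj d L) _ _
    (fun w n => omega n w) a t 0 (fun n => measurable_funP (omega n)).
  by under eq_fun do rewrite (box_solution0 (@box_site_inj d L)).
have cvgE : ccvg (fun L => cintegral P (fun w =>
    mean_trace (fun n => omega n w) t (L + r))) (fourier nu t).
  have [h1 h2] := expected_mean_trace_cvg nu_dosm t.
  by split; [exact: (cvg_comp _ _ (cvg_addnr r) h1)|exact: (cvg_comp _ _ (cvg_addnr r) h2)].
have E L : cintegral P (fun w => mean_trace (fun n => omega n w) t L) =
    (#|@box d L|%:R^-1)%:C * \sum_a cintegral P (G L a).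
  have mS : cmeasurable (fun w => \sum_a G L a w) by exact: cmeasurable_sum.
  have bS w : cle (\sum_a G L a w) ((size (index_enum 'I_#|@box d L|))%:R * 1).
    by apply: cle_sum => a _; exact: Gc.
  by rewrite -(cintegral_sum P _ (mG L) (Gc L)) -(cintegralZ P _ mS bS).
(* The constant 3 is the bound 1 for a mean entry plus the bound 2 for [mean_centred]. *)
apply: (@cle_limit _ _ _ _ (fun L =>
  e + 3 * (1 - #|@box d L|%:R / #|@box d (L + r)|%:R)) _ cvgE) => [L|]; last first.
  rewrite -[X in _ --> X]addr0; apply: cvgD; first exact: cvg_cst.
  rewrite -[X in _ --> X](mulr0 3); apply: cvgMr.
  rewrite -[X in _ --> X](subrr (1 : R)); apply: cvgB; first exact: cvg_cst.
  exact: box_ratio_cvg.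
rewrite E.
have := @cle_average _ _ (fun a => cintegral P (G (L + r)%N a)) (mean_centred t r)
  [pred a | inner_site r a] e 3 (card_box_gt0 _) e0.
move=> /(_ _ _ _) h; apply: cle_trans (h _ _ _) _ => //.
- by move=> a ga; exact: inner_site_comparison.
- move=> a; rewrite -[3]/(1 + 2); apply: cleD; first exact: cle_cintegral.
  by apply: cleN; exact: cle_mean_centred.
- rewrite lerD2l ler_wpM2l// lerD2l lerN2 ler_wpM2r ?invr_ge0 ?ler0n//.
  by rewrite ler_nat card_inner_site.
Qed.

End DosmComparison.

Section Conjugation.
Context {R : realType} {disp : measure_display} {T : measurableType disp}.

Lemma cintegral_conj (P : probability T R) (f : T -> R[i]) (M : R) :
  cmeasurable f -> (forall w, cle (f w) M) ->
  cintegral P (fun w => ((f w)^*)%C) = ((cintegral P f)^*)%C.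
Proof.
move=> [m1 m2] fM; apply: complex_parts; rewrite ?cReJ ?cImJ /cintegral/=.
  by under eq_Rintegral do rewrite cReJ.
under eq_Rintegral do rewrite cImJ -mulN1r.
rewrite RintegralZl ?mulN1r//.
by apply: (integrable_bounded P m2 (M := M)) => w; case: (fM w).
Qed.

End Conjugation.

Lemma fourierN (R : realType) (nu : probability R R) t : fourier nu (- t) = ((fourier nu t)^*)%C.
Proof.
have mt : measurable_fun setT (fun x : R => - (t * x)).
  by apply: measurableT_comp => //; exact: measurable_funM.
rewrite -(cintegral_conj nu (cmeasurable_cexpi mt) (fun x => cle_cexpi _)).
by apply: eq_cintegral => x; rewrite -cexpiN mulNr.
Qed.

Theorem theorem1p1 (R : realType) (d : nat) (d_ge1 : (1 <= d)%N)
  (lambda : R) (lambda_gt0 : 0 < lambda)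
  (mu2 : probability R R)
  (* the Anderson model H with single site distribution mu_1 * mu_2 *)
  (disp : measure_display) (Omega : measurableType disp) (P : probability Omega R)
  (omega : lattice d -> {RV P >-> R})
  (omega_iid : iid omega (convolution (cauchy_prob lambda) mu2))
  (* its density of states measure *)
  (nu : probability R R) (nu_dosm : is_dosm omega nu)
  (* the Anderson model h with single site distribution mu_2 *)
  (disp2 : measure_display) (Omega2 : measurableType disp2)
  (P2 : probability Omega2 R)
  (omega2 : lattice d -> {RV P2 >-> R})
  (omega2_iid : iid omega2 mu2)
  (* U w t = e^{-ith} for the realisation w of the potential *)
  (U : Omega2 -> R -> (lattice d -> R[i]) -> lattice d -> R[i])
  (U_exp : forall w : Omega2,
     is_exp_mit (anderson (fun n => omega2 n w))
                (anderson_dom (fun n => omega2 n w)) (U w)) :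
  forall t : R,
    fourier nu t =
    (expR (- (lambda * `|t|)))%:C *
      cintegral P2 (fun w => inner (std_basis 0) (U w t (std_basis 0))).
Proof.
move=> t.
pose u w s := U w s (std_basis 0).
have us w r : local_solution (fun n => omega2 n w) r (u w).
  exact: unitary_local_solution (U_exp w) r.
have mu (s : R) : 0 <= s -> cmeasurable (fun w => u w s 0).
  by move=> s0; apply: (cmeasurable_local_solution (V := fun w n => omega2 n w)).
have u1 s w : cle (u w s 0) 1 by apply: cle_normc; case: (us w 0).
have forward (s : R) : 0 <= s ->
    fourier nu s = (expR (- (lambda * s)))%:C * cintegral P2 (fun w => u w s 0).
  (* Both sides are limits of [mean_centred] as [r] grows: the left one by the factorial bound, the
     right one by dominated convergence. *)
  move=> s0; apply: (@ccvg_unique _ (mean_centred lambda omega2 s)).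
    apply: (ccvg_cle (e := fun r => 2 * ((size (@unit_vectors d))%:R * s) ^+ r / r`!%:R)).
      move=> r; rewrite -opprB; apply: cleN.
      exact: (fourier_dosm_approx lambda_gt0 omega_iid nu_dosm omega2_iid).
    exact: exp_tail_cvg0.
  apply: ccvgM; first exact: ccvg_cst.
  split; apply: (Rintegral_dominated (M := 1)).
  - by move=> r; case: (@cmeasurable_centred_solution R d _ _ (fun w n => omega2 n w) r s 0).
  - by case: (mu s s0).
  - by move=> r w; case: (cle_normc (ls_bound (centred_local_solution r (fun n => omega2 n w)) s 0)).
  - by apply: aeW => w; case: (ccvg_centred_solution (us w) s0).
  - by move=> r; case: (@cmeasurable_centred_solution R d _ _ (fun w n => omega2 n w) r s 0).
  - by case: (mu s s0).
  - by move=> r w; case: (cle_normc (ls_bound (centred_local_solution r (fun n => omega2 n w)) s 0)).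
  - by apply: aeW => w; case: (ccvg_centred_solution (us w) s0).
rewrite (eq_cintegral _ (fun w => inner_std_basis (u w t))).
have [t0|/ltW t0] := leP 0 t; first by rewrite ger0_norm// forward.
have t0' : 0 <= - t by rewrite oppr_ge0.
(* Conjugation reverses time on both sides: on the left through the character, on the right through
   [local_solution_reversal] for each realisation. *)
have -> : fourier nu t = ((fourier nu (- t))^*)%C by rewrite -fourierN opprK.
rewrite ler0_norm// (forward _ t0') rmorphM.
congr (_ * _); first exact: conjc_real.
apply: etrans (esym (cintegral_conj P2 (mu _ t0') (u1 (- t)))) _.
apply: eq_cintegral => w.
by rewrite -(local_solution_reversal (us w) t0') opprK.
Qed.
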